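(* Assume $T$ is resilient and $A$ is an extension base. Then: (1) every strict Morley sequence over $A$ is a witness over $A$; (2) every Morley sequence over $A$ which is a witness over $A$ is a strict Morley sequence over $A$; (3) if $I=\langle a_i:i<\omega\rangle$ is a strict Morley sequence over $A$, then $a_i\downarrow^{st}_A a_{i+1}$ for every $i$.
   Context: $T$ is a complete first-order theory (not assumed dependent); work in a monster model. $T$ is resilient if for every indiscernible sequence $I=\langle a_i:i\in\mathbb{Z}\rangle$ and formula $\varphi(x,y)$, if $\varphi(x,a_0)$ divides over $\{a_i:i\neq 0\}$ then $\{\varphi(x,a_i):i\in\mathbb{Z}\}$ is inconsistent. $x\downarrow_A B$ means $\operatorname{tp}(x/AB)$ does not fork over $A$. $A$ is an extension base if no type over $A$ forks over $A$. Strict non-forking: $x\downarrow^{st}_A y$ means there is a global type $q\supseteq\operatorname{tp}(x/Ay)$ not forking over $A$ such that for every set $D\supseteq Ay$ and every $c\models q|_D$, $\operatorname{tp}(D/Ac)$ does not divide over $A$. A Morley (resp. strict Morley) sequence over $A$ is an $A$-indiscernible sequence with $a_i\downarrow_A a_{<i}$ (resp. $a_i\downarrow^{st}_A a_{<i}$) for all $i$. A witness over $A$ is an infinite sequence $I$ of tuples all of the same type over $A$ such that for every formula $\varphi(x,y)$ over $A$ and every $e$ of that type, if $\varphi(x,e)$ divides over $A$ then $\{\varphi(x,e'):e'\in I_0\}$ is inconsistent for every countably infinite $I_0\subseteq I$. *)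

(* Defs.v *)
(* First-order model theory inside a monster model.                           *)
(* Formulas are indexed by their type of free variables; tuples of elements   *)
(* of a model M, possibly infinite, are functions X -> M, the tuple variable  *)
(* x being the family of variables indexed by X.                              *)
From HB Require Import structures.
From mathcomp Require Import all_boot all_order all_algebra.
From mathcomp Require Import boolp classical_sets functions cardinality.

Set Implicit Arguments.
Unset Strict Implicit.
Unset Printing Implicit Defensive.

Local Open Scope classical_set_scope.
Local Open Scope card_scope.

Record language := Language {
  fsym : Type; farity : fsym -> nat;
  rsym : Type; rarity : rsym -> nat }.

Inductive term (L : language) (V : Type) :=
| TVar of V
| TApp (f : fsym L) of 'I_(farity f) -> term L V.

(* The bound variable of FAll is None. *)
Inductive formula (L : language) (V : Type) :=
| FBot
| FEq of term L V & term L V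
| FRel (r : rsym L) of 'I_(rarity r) -> term L V
| FImp of formula L V & formula L V
| FAll of formula L (option V).

Definition FNot L (V : Type) (phi : formula L V) : formula L V :=
  FImp phi (FBot L V).

Record structure (L : language) := Structure {
  dom :> Type;
  dom_inhabited : inhabited dom;
  finterp : forall f : fsym L, ('I_(farity f) -> dom) -> dom;
  rinterp : forall r : rsym L, ('I_(rarity r) -> dom) -> Prop }.

Fixpoint eval L (M : structure L) (V : Type) (v : V -> M) (t : term L V) : M :=
  match t with
  | TVar x => v x
  | TApp f ts => finterp (fun i => eval v (ts i))
  end.

Fixpoint sat L (M : structure L) (V : Type) (v : V -> M)
    (phi : formula L V) : Prop :=
  match phi with
  | FBot => False
  | FEq s t => eval v s = eval v t
  | FRel r ts => rinterp (fun i => eval v (ts i))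
  | FImp phi1 phi2 => sat v phi1 -> sat v phi2
  | FAll phi1 => forall m : M, sat (oapp v m) phi1
  end.

Fixpoint tvars L (V : Type) (t : term L V) : set V :=
  match t with
  | TVar x => [set x]
  | TApp f ts => \bigcup_i tvars (ts i)
  end.

Fixpoint fvars L (V : Type) (phi : formula L V) : set V :=
  match phi with
  | FBot => set0
  | FEq s t => tvars s `|` tvars t
  | FRel r ts => \bigcup_i tvars (ts i)
  | FImp phi1 phi2 => fvars phi1 `|` fvars phi2
  | FAll phi1 => Some @^-1` fvars phi1
  end.

Definition sentence (L : language) := formula L void.

Definition models L (M : structure L) (phi : sentence L) : Prop :=
  sat (fun x : void => match x return dom M with end) phi.

Definition is_model L (T : set (sentence L)) (M : structure L) : Prop :=
  forall phi, T phi -> models M phi.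

Definition entails L (T : set (sentence L)) (phi : sentence L) : Prop :=
  forall M : structure L, is_model T M -> models M phi.

Definition complete_theory L (T : set (sentence L)) : Prop :=
  (exists M : structure L, is_model T M) /\
  (forall phi, entails T phi \/ entails T (FNot phi)).

Definition automorphism L (M : structure L) (s : M -> M) : Prop :=
  [/\ bijective s,
      forall (f : fsym L) (ms : 'I_(farity f) -> M),
        s (finterp ms) = finterp (s \o ms)
    & forall (r : rsym L) (ms : 'I_(rarity r) -> M),
        rinterp (s \o ms) <-> rinterp ms].

(* The concatenation of two tuples. *)
Definition join (X Y M : Type) (c : X -> M) (b : Y -> M) : X + Y -> M :=
  fun z => match z with inl x => c x | inr y => b y end.

(* A formula in the variables X with parameters in M is an element of         *)
(* formula L (X + M), where inr m stands for the parameter m.                 *)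
Definition over L (M : structure L) (X : Type) (B : set M) :
  set (formula L (X + M)) :=
  [set phi : formula L (X + M) | forall m : M, fvars phi (inr m) -> B m].

Definition psat L (M : structure L) (X : Type) (c : X -> M)
    (phi : formula L (X + M)) : Prop :=
  sat (join c id) phi.

Definition tp L (M : structure L) (X : Type) (c : X -> M) (B : set M) :
  set (formula L (X + M)) := [set phi | over B phi /\ psat c phi].

Definition finitely_satisfiable L (M : structure L) (X : Type)
    (p : set (formula L (X + M))) : Prop :=
  forall n (psi : 'I_n -> formula L (X + M)), (forall i, p (psi i)) ->
    exists c : X -> M, forall i, psat c (psi i).

Definition complete_type L (M : structure L) (X : Type) (B : set M)
    (p : set (formula L (X + M))) : Prop :=
  [/\ p `<=` @over L M X B, finitely_satisfiable p
    & forall phi, over B phi -> p phi \/ p (FNot phi)].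

(* The cardinal kappa of the monster model is given by a type K with kappa    *)
(* elements; small means of cardinality less than kappa.                      *)
Definition small (K U : Type) (S : set U) : Prop := ~ ([set: K] #<= S).

Definition saturated L (K : Type) (M : structure L) : Prop :=
  forall (B : set M) (p : set (formula L (unit + M))),
    small K B -> p `<=` @over L M unit B -> finitely_satisfiable p ->
    exists c : unit -> M, forall phi, p phi -> psat c phi.

Definition strongly_homogeneous L (K : Type) (M : structure L) : Prop :=
  forall (X : Type) (a b : X -> M),
    small K [set: X] -> tp a set0 = tp b set0 ->
    exists s : M -> M, automorphism s /\ forall x, s (a x) = b x.

(* kappa > |L| + aleph_0, and M is kappa-saturated and strongly               *)
(* kappa-homogeneous.                                                         *)
Definition monster L (T : set (sentence L)) (K : Type) (M : structure L) :
    Prop :=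
  [/\ is_model T M,
      [/\ small K [set: nat], small K [set: fsym L] & small K [set: rsym L]],
      saturated K M
    & strongly_homogeneous K M].

Section Independence.
Context (L : language) (M : structure L).

(* phi(x, b) divides over A. *)
Definition divides (X Y : Type) (A : set M) (phi : formula L (X + Y))
    (b : Y -> M) : Prop :=
  exists (k : nat) (b_ : nat -> Y -> M),
    (forall i, tp (b_ i) A = tp b A) /\
    (forall s : 'I_k -> nat, injective s ->
       ~ exists c : X -> M, forall j, sat (join c (b_ (s j))) phi).

(* A partial type divides over A if it implies a formula dividing over A, and *)
(* forks over A if it implies a finite disjunction of formulas dividing over  *)
(* A. Implication is stated through finite subsets of p, since a type over    *)
(* all of M need not be realized in M.                                        *)
Definition type_divides (X : Type) (A : set M)
    (p : set (formula L (X + M))) : Prop :=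
  exists (n : nat) (psi : 'I_n -> formula L (X + M))
         (m : nat) (b : 'I_m -> M) (chi : formula L (X + 'I_m)),
    [/\ forall i, p (psi i), divides A chi b
      & forall c : X -> M, (forall i, psat c (psi i)) -> sat (join c b) chi].

Definition type_forks (X : Type) (A : set M)
    (p : set (formula L (X + M))) : Prop :=
  exists (n : nat) (psi : 'I_n -> formula L (X + M))
         (m : nat) (b : 'I_m -> M)
         (r : nat) (chi : 'I_r -> formula L (X + 'I_m)),
    [/\ forall i, p (psi i), forall j, divides A (chi j) b
      & forall c : X -> M, (forall i, psat c (psi i)) ->
          exists j, sat (join c b) (chi j)].

Definition nonforking (X : Type) (c : X -> M) (A B : set M) : Prop :=
  ~ type_forks A (tp c (A `|` B)).

Definition extension_base (K : Type) (A : set M) : Prop :=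
  forall (X : Type) (p : set (formula L (X + M))),
    small K [set: X] -> complete_type A p -> ~ type_forks A p.

(* In the last clause, @set_val M D is the tuple enumerating D. *)
Definition strict_nonforking (K X Y : Type) (A : set M) (c : X -> M)
    (b : Y -> M) : Prop :=
  exists q : set (formula L (X + M)),
    [/\ complete_type [set: M] q,
        tp c (A `|` range b) `<=` q,
        ~ type_forks A q
      & forall D : set M, small K D -> A `|` range b `<=` D ->
        forall c' : X -> M,
          (forall phi, q phi -> over D phi -> psat c' phi) ->
          ~ type_divides A (tp (@set_val M D) (A `|` range c'))].

Local Open Scope order_scope.

Definition indiscernible d (I : orderType d) (Y : Type) (A : set M)
    (a : I -> Y -> M) : Prop :=
  forall (n : nat) (s t : 'I_n -> I),
    {homo s : i j / (i < j)%N >-> i < j} ->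
    {homo t : i j / (i < j)%N >-> i < j} ->
    tp (fun z : 'I_n * Y => a (s z.1) z.2) A =
    tp (fun z : 'I_n * Y => a (t z.1) z.2) A.

(* The tuple a_{<i}, indexed by the pairs (j, y) with j < i. *)
Definition before d (I : orderType d) (Y : Type) (a : I -> Y -> M) (i : I) :
    [set j | j < i] * Y -> M :=
  fun z => a (val z.1) z.2.
Arguments before d I Y a i : clear implicits.
Arguments before {d I Y} a i _.

Definition Morley d (I : orderType d) (Y : Type) (A : set M)
    (a : I -> Y -> M) : Prop :=
  indiscernible A a /\
  forall i, nonforking (a i) A (range (before a i)).

Definition strict_Morley (K : Type) d (I : orderType d) (Y : Type) (A : set M)
    (a : I -> Y -> M) : Prop :=
  indiscernible A a /\
  forall i, strict_nonforking K A (a i) (before a i).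

(* Subsequences are given by sets S of indices. A formula phi(x, y) over A is *)
(* a formula in x and y, extended by the tuple enumerating A.                 *)
Definition witness (I Y : Type) (A : set M) (a : I -> Y -> M) : Prop :=
  [/\ infinite_set [set: I],
      forall i j, tp (a i) A = tp (a j) A
    & forall (X : Type) (phi : formula L (X + (Y + A))) i (e : Y -> M),
        tp e A = tp (a i) A ->
        divides A phi (join e (@set_val M A)) ->
        forall S : set I, S #= [set: nat] ->
        ~ exists c : X -> M,
            forall j, S j -> sat (join c (join (a j) (@set_val M A))) phi].

Definition resilient (K : Type) : Prop :=
  forall (X Y : Type) (a : int -> Y -> M) (phi : formula L (X + Y)),
    small K [set: Y] -> indiscernible set0 a ->
    divides (\bigcup_(i in [set i : int | i != 0%R]) range (a i)) phi
      (a 0%R) ->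
    ~ exists c : X -> M, forall i, sat (join c (a i)) phi.

End Independence.

(* Main.v *)
(* Over an extension base of a resilient theory forking equals dividing, and  *)
(* strict Morley sequences are witnesses because in them every term is        *)
(* independent from the other ones in the sense that resilience asks for: if  *)
(* tp(c/D) does not divide over A, then a formula over D that divides over A  *)
(* still divides over Ac. Hence a formula phi(x,a_0) dividing over A divides  *)
(* over A together with a_(<0), by strictness, and then with a_(>0) added, by *)
(* non-forking, and resilience makes {phi(x,a_i)} inconsistent.               *)
(*                                                                            *)
(* For (2) and (3), strict non-forking of c over b says that tp(c/Ab) does    *)
(* not imply a disjunction of formulas phi(x,m) dividing over A and formulas  *)
(* psi(x,m) such that psi(c,y) divides over A. If it did, move a long tuple   *)
(* a_1, ..., a_N of realisations, non-forking over its base, away from all    *)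
(* the phi; then many of the a_k satisfy a common psi, against the witness    *)
(* property. In (3) the tuple is a_(<N) over a_N, which by strictness does    *)
(* not divide over A; so forking = dividing is needed.                        *)
(*                                                                            *)
(* For forking = dividing, suppose that U is a union of sets phi_j(x,m)       *)
(* dividing over A. First, finitely many conjugates of U have an empty        *)
(* intersection: otherwise, by the broom argument of Chernikov and Kaplan,    *)
(* phi_j(x,m) is replaced by phi_j(x,c_0), ..., phi_j(x,c_N) for a Morley     *)
(* sequence of a suitable invariant type on which phi_j is inconsistent, and  *)
(* the disjuncts are removed one by one. This yields strictly non-forking     *)
(* conjugates of m, in whose strict Morley sequences every phi_j is           *)
(* inconsistent.                                                              *)

Require Import Defs.
From mathcomp Require Import all_boot all_order all_algebra.
From mathcomp Require Import boolp classical_sets functions cardinality filter.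
From mathcomp Require Import zify.

Set Implicit Arguments.
Unset Strict Implicit.
Unset Printing Implicit Defensive.

Local Open Scope classical_set_scope.
Local Open Scope card_scope.

(** * Cardinal arithmetic *)

(** Formulas are handled through the sets they define ([Def]), and dividing through translates under
    automorphisms ([kdiv]). Two facts carry the proof. [kdiv_extend]: if tp(c/D) does not divide
    over A, then a D-definable set that k-divides over A still does so over A and c, with the same
    k. [resilience_bound]: for fixed k and R, there is a bound on the length of a consistent family
    R(x,f_t) each member of which k-divides over the other terms (a [spread]). Iterating the first
    fact along a sequence ([kdiv_chain], [kdiv_strict]) produces the families whose length the
    second bounds. This is how [strict_Morley_witness] gives (1).

    Forking equals dividing is reached through [rows_quasi_divide], [strict_conjugate] and
    [ndiv_nonforking]: each disjunct of a forking set holds at boundedly many terms of a strict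
    sequence of conjugates, so by the pigeonhole principle the set itself divides.

    Statements (2) and (3) are two instances of [strict_nonforking_of_witness]. The long
    non-dividing piece of the sequence lies after the base tuple in (2), in [Morley_witness_strict],
    and before it in (3), in [strict_Morley_next]. *)

Definition elt (T : Type) (A : set T) (x : T) (Ax : A x) : A :=
  SigSub (mem_set Ax).

Lemma card_le_setTP (T U : Type) (S : set U) :
  ([set: T] #<= S) <-> exists f : T -> U, injective f /\ forall t, S (f t).
Proof.
split.
  move=> /card_leP[f].
  exists (fun t => set_val (f (SigSub (mem_set (I : [set: T] t))))); split.
    move=> t t' /val_inj /(@inj _ _ _ f) h.
    by have /(congr1 set_val) := h (mem_set I) (mem_set I).
  by move=> t; exact: set_valP.
move=> [f [finj fS]].
have h : {in [set: T] &, injective f} by move=> x y _ _ /finj.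
rewrite -(card_le_eql (inj_card_eq h)).
by apply: subset_card_le => _ [t _ <-].
Qed.

(** Zorn's lemma on graphs of partial injections: a maximal one is total on one of the two sides. *)
Lemma card_comparable (X Y : Type) :
  (exists f : X -> Y, injective f) \/ (exists f : Y -> X, injective f).
Proof.
pose P (G : set (X * Y)) := forall p q, G p -> G q ->
  (p.1 = q.1 -> p.2 = q.2) /\ (p.2 = q.2 -> p.1 = q.1).
have [G [PG Gmax]] : exists G, P G /\ forall H, G `<` H -> ~ P H.
  apply: Zorn_bigcup => F FP Ftot p q [G FG Gp] [H FH Hq].
  have [GH|HG] := Ftot _ _ FG FH.
    by apply: (FP _ FH) => //; exact: GH.
  by apply: (FP _ FG) => //; exact: HG.
have [Gtot|/existsNP[x nGx]] := pselect (forall x, exists y, G (x, y)).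
  have [f Gf] := choice Gtot; left; exists f => x x' fxx.
  by have [_] := PG _ _ (Gf x) (Gf x'); apply.
have [Gsur|/existsNP[y nGy]] := pselect (forall y, exists x, G (x, y)).
  have [f Gf] := choice Gsur; right; exists f => y y' fyy.
  by have [+ _] := PG _ _ (Gf y) (Gf y'); apply.
exfalso; apply: (Gmax (G `|` [set (x, y)])).
  split; first by move=> p; left.
  by move=> /(_ (x, y) (or_intror erefl)) Gxy; apply: nGx; exists y.
move=> [a b] [a' b'] [Gp|[-> ->]] [Gq|[-> ->]] //=.
- exact: PG Gp Gq.
- by split=> h; exfalso; [apply: nGx; exists b; rewrite -h|apply: nGy; exists a; rewrite -h].
- by split=> h; exfalso; [apply: nGx; exists b'; rewrite h|apply: nGy; exists a'; rewrite h].
Qed.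

(** * An infinite type injects its square *)

Section Hessenberg.
Variable T : Type.

Let dg (G : set (T * T * T)) : set T := [set x | exists z, G (x, x, z)].

(* G is the graph of an injection of (dg G) x (dg G) into dg G. *)
Let pairing (G : set (T * T * T)) : Prop :=
  [/\ forall x y z, G (x, y, z) -> [/\ dg G x, dg G y & dg G z],
      forall x y, dg G x -> dg G y -> exists z, G (x, y, z),
      forall x y z z', G (x, y, z) -> G (x, y, z') -> z = z'
    & forall x y x' y' z, G (x, y, z) -> G (x', y', z) -> x = x' /\ y = y'].

Let pairing_chain (F : set (set (T * T * T))) :
  F `<=` pairing -> total_on F subset -> pairing (\bigcup_(G in F) G).
Proof.
move=> FP Ftot.
have two G H : F G -> F H -> exists K, [/\ F K, G `<=` K & H `<=` K].
  by move=> FG FH; have [?|?] := Ftot _ _ FG FH; [exists H; split|exists G; split].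
have up G x : F G -> dg G x -> dg (\bigcup_(G in F) G) x.
  by move=> FG [z Gz]; exists z; exists G.
split.
- move=> x y z [G FG Gxyz]; have [h _ _ _] := FP _ FG.
  by have [? ? ?] := h _ _ _ Gxyz; split; apply: up FG _.
- move=> x y [z [G FG Gx]] [z' [H FH Hy]].
  have [K [FK GK HK]] := two _ _ FG FH.
  have [_ h _ _] := FP _ FK.
  have [w Kw] : exists w, K (x, y, w).
    by apply: h; [exists z; exact: GK|exists z'; exact: HK].
  by exists w; exists K.
- move=> x y z z' [G FG Gx] [H FH Hy].
  have [K [FK GK HK]] := two _ _ FG FH.
  have [_ _ h _] := FP _ FK; apply: h; [exact: GK Gx|exact: HK Hy].
- move=> x y x' y' z [G FG Gx] [H FH Hy].
  have [K [FK GK HK]] := two _ _ FG FH.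
  have [_ _ _ h] := FP _ FK; apply: h; [exact: GK Gx|exact: HK Hy].
Qed.

(** A maximal pairing lives on some D. If D embedded into its complement, the pairing could be
    enlarged; so the complement embeds into D, and T injects into D. *)
Lemma card_square (e : nat -> T) :
  injective e -> exists f : T * T -> T, injective f.
Proof.
move=> einj.
have [c [cinj _]] : exists c : nat * nat -> nat, injective c /\ forall p, [set: nat] (c p).
  by apply/card_le_setTP; have := card_nat2; rewrite card_eq_le => /andP[].
pose G0 : set (T * T * T) :=
  [set p | exists m n, p = (e m, e n, e (c (m, n)))].
have dgG0 x : dg G0 x <-> exists n, x = e n.
  split=> [[z [m [n [-> _ _]]]]|[n ->]]; first by exists m.
  by exists (e (c (n, n))), n, n.
have pG0 : pairing G0.
  split.
  - move=> x y z [m [n [-> -> ->]]].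
    by split; apply/dgG0; eexists; reflexivity.
  - by move=> x y /dgG0[m ->] /dgG0[n ->]; exists (e (c (m, n))), m, n.
  - by move=> x y z z' [m [n [-> -> ->]]] [m' [n' [/einj -> /einj -> ->]]].
  - by move=> x y x' y' z [m [n [-> -> ->]]] [m' [n' [-> -> /einj/cinj[-> ->]]]].
(* Zorn's lemma for unions includes the empty chain, so the countable seed [G0] is adjoined to every
   [H]; it also keeps the values of [e] in the domain, for use as tags. *)
pose P (H : set (T * T * T)) := pairing (H `|` G0).
have [H [PH Hmax]] : exists H, P H /\ forall H', H `<` H' -> ~ P H'.
  apply: Zorn_bigcup => F FP Ftot.
  pose F' : set (set (T * T * T)) := [set H | H = G0 \/ exists2 K, F K & H = K `|` G0].
  rewrite /P; suff -> : \bigcup_(X in F) X `|` G0 = \bigcup_(X in F') X.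
    apply: pairing_chain.
      by move=> X [->//|[K FK ->]]; exact: FP.
    move=> X Y [->|[K FK ->]] [->|[K' FK' ->]].
    - by left.
    - by left; exact: subsetUr.
    - by right; exact: subsetUr.
    - by have [?|?] := Ftot _ _ FK FK'; [left|right]; exact: setSU.
  apply/seteqP; split=> p.
    move=> [[X FX Xp]|G0p]; last by exists G0 => //; left.
    by exists (X `|` G0); [right; exists X|left].
  move=> [X [->|[K FK ->]]]; first by right.
  by move=> [Kp|]; [left; exists K|right].
set G := H `|` G0; have [g1 g2 g3 g4] : pairing G := PH.
set D := dg G.
have De n : D (e n) by have /dgG0[z h] : exists m, e n = e m by [exists n]; exists z; right.
have [f fG] : exists f : T * T -> T, forall x y, D x -> D y -> G (x, y, f (x, y)).
  suff /choice[f fP] : forall p : T * T, exists z, D p.1 -> D p.2 -> G (p.1, p.2, z).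
    by exists f => x y Dx Dy; exact: (fP (x, y)).
  move=> [x y]; have [[Dx Dy]|nD] := pselect (D x /\ D y).
    by have [z ?] := g2 _ _ Dx Dy; exists z.
  by exists x => Dx Dy; exfalso; exact: nD.
have fD x y : D x -> D y -> D (f (x, y)).
  by move=> Dx Dy; have [] := g1 _ _ _ (fG _ _ Dx Dy).
have finj x y x' y' : D x -> D y -> D x' -> D y' -> f (x, y) = f (x', y') -> x = x' /\ y = y'.
  move=> Dx Dy Dx' Dy' fe; apply: g4 (fG _ _ Dx Dy) _.
  by rewrite fe; exact: fG.
have en m n : e m = e n -> m = n by exact: einj.
have [[h hinj]|[h hinj]] := card_comparable (set_type (~` D)) (set_type D).
  (* T is compressed into D; the tags [e 0] and [e 1] keep D and its complement apart. *)
  have [j [jD jinj]] : exists j : T -> T, (forall x, D (j x)) /\ injective j.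
    pose j x := match pselect (D x) with left _ => f (e 0, x)
       | right nDx => f (e 1, set_val (h (@elt _ (~` D) x nDx))) end.
    exists j; split=> [x|x y]; rewrite /j.
      by case: pselect => Dx; apply: fD => //; exact: set_valP.
    case: pselect => Dx; case: pselect => Dy.
    - by move=> /finj[].
    - by move=> /finj[]//; [exact: set_valP|move=> /en].
    - by move=> /finj[]//; [exact: set_valP|move=> /en].
    - move=> /finj[]; try exact: set_valP; try exact: De.
      by move=> _ /val_inj/hinj [].
  exists (fun p => f (j p.1, j p.2)) => -[x y] [x' y'] /= /finj[] //.
  by move=> /jinj -> /jinj ->.
exfalso.
pose hh x := if pselect (D x) is left Dx then set_val (h (elt Dx)) else x.
have hhD x : D x -> ~ D (hh x).
  by rewrite /hh; case: pselect => // Dx _; exact: (set_valP (h (elt Dx))).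
have hhinj x y : D x -> D y -> hh x = hh y -> x = y.
  rewrite /hh; case: pselect => // Dx; case: pselect => // Dy _ _.
  by move=> /val_inj/hinj [].
pose E : set T := [set x | D x \/ exists2 y, D y & x = hh y].
have [u uP] : exists u : T -> T, forall x, E x -> D (u x) /\ ((D x /\ u x = x) \/ (~ D x /\ x = hh (u x))).
  suff /choice[u uP] : forall x, exists y, E x -> D y /\ ((D x /\ y = x) \/ (~ D x /\ x = hh y)).
    by exists u.
  move=> x; have [Dx|nDx] := pselect (D x); first by exists x => _; split=> //; left.
  have [[//|[y Dy ->]]|nEx] := pselect (E x); last by exists x.
  by exists y => _; split=> //; right; split => //; exact: hhD.
have uinj x y : E x -> E y -> (D x <-> D y) -> u x = u y -> x = y.
  move=> /uP[Du [[Dx ux]|[nDx ux]]] /uP[Dv [[Dy uy]|[nDy uy]]].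
  - by rewrite ux uy.
  - by move=> [/(_ Dx)].
  - by move=> [_ /(_ Dy)].
  - by move=> _ uxy; rewrite ux uy uxy.
(* New pairs are coded in the copy [hh] of D by the projections [u] of their coordinates to D and a
   tag for the side each coordinate came from; three tags suffice, as a new pair never has both
   coordinates in D. *)
pose tag x y := if pselect (D x) then e 0 else if pselect (D y) then e 1 else e 2.
have tagD x y : D (tag x y) by rewrite /tag; case: pselect => ?; [|case: pselect => ?]; exact: De.
have taginj x y x' y' : ~ (D x /\ D y) -> ~ (D x' /\ D y') -> tag x y = tag x' y' ->
    (D x <-> D x') /\ (D y <-> D y').
  rewrite /tag; case: pselect => Dx; case: pselect => Dx'; try case: pselect => Dy;
  try case: pselect => Dy'; move=> h1 h2 /en //= _; tauto.
pose N : set (T * T * T) := [set p | [/\ E p.1.1, E p.1.2, ~ (D p.1.1 /\ D p.1.2) &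
   p.2 = hh (f (tag p.1.1 p.1.2, f (u p.1.1, u p.1.2)))]].
have DE x : D x -> E x by left.
have fuD x y : E x -> E y -> D (f (tag x y, f (u x, u y))).
  by move=> /uP[? _] /uP[? _]; apply: (fD) => //; apply: fD.
have GN x y z : (G `|` N) (x, y, z) -> [/\ E x, E y & E z].
  move=> [/g1[? ? ?]|[/= Ex Ey _ ->]]; first by split; exact: DE.
  by split=> //; right; exists (f (tag x y, f (u x, u y))) => //; exact: fuD.
have dgGN x : dg (G `|` N) x <-> E x.
  split=> [[z /GN[]]//|Ex]; have [Dx|nDx] := pselect (D x).
    by have [z Gz] := g2 _ _ Dx Dx; exists z; left.
  exists (hh (f (tag x x, f (u x, u x)))); right; split=> //=; tauto.
apply: (Hmax (H `|` N)).
  split; first exact: subsetUl.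
  move=> HN; have Hh : H (hh (e 0), hh (e 0), hh (f (tag (hh (e 0)) (hh (e 0)), f (u (hh (e 0)), u (hh (e 0)))))).
    apply: HN; right; have E0 : E (hh (e 0)) by right; exists (e 0).
    by split=> //= -[Dh _]; exact: hhD (De 0) Dh.
  have [] := g1 _ _ _ (or_introl Hh).
  by move=> Dh _ _; exact: hhD (De 0) Dh.
rewrite /P; have -> : H `|` N `|` G0 = G `|` N by rewrite /G setUAC.
split.
- by move=> x y z /GN[? ? ?]; split; apply/dgGN.
- move=> x y /dgGN Ex /dgGN Ey.
  have [[Dx Dy]|nD] := pselect (D x /\ D y).
    by have [z Gz] := g2 _ _ Dx Dy; exists z; left.
  by exists (hh (f (tag x y, f (u x, u y)))); right.
- move=> x y z z' [Gz|[/= Ex Ey nD zE]] [Gz'|[/= Ex' Ey' nD' zE']].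
  + exact: g3 Gz Gz'.
  + by have [? ? _] := g1 _ _ _ Gz; case: nD'.
  + by have [? ? _] := g1 _ _ _ Gz'; case: nD.
  + by rewrite zE zE'.
- move=> x y x' y' z [Gz|[/= Ex Ey nD zE]] [Gz'|[/= Ex' Ey' nD' zE']].
  + exact: g4 Gz Gz'.
  + have [_ _] := g1 _ _ _ Gz; rewrite zE' => Dh; case: (hhD _ (fuD _ _ Ex' Ey') Dh).
  + have [_ _] := g1 _ _ _ Gz'; rewrite zE => Dh; case: (hhD _ (fuD _ _ Ex Ey) Dh).
  + move: zE'; rewrite zE => /(hhinj _ _ (fuD _ _ Ex Ey) (fuD _ _ Ex' Ey')).
    have [[Dux _] [Duy _]] := (uP _ Ex, uP _ Ey).
    have [[Dux' _] [Duy' _]] := (uP _ Ex', uP _ Ey').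
    have fu a b : D a -> D b -> D (f (a, b)) by exact: fD.
    move=> /finj[]; [exact: tagD|exact: fu|exact: tagD|exact: fu|].
    move=> /(taginj _ _ _ _ nD nD')[t1 t2] /finj[]// u1 u2.
    by split; apply: uinj.
Qed.

End Hessenberg.

(** * Closure properties of smallness *)

Section Small.
Variable K : Type.
Hypothesis Knat : small K [set: nat].

Lemma smallP (U : Type) (S : set U) :
  small K S <-> ~ exists f : K -> U, injective f /\ forall k, S (f k).
Proof. by split; apply: contra_not => /card_le_setTP. Qed.

Lemma small_inj (T U : Type) (A : set T) (f : U -> T) :
  small K A -> injective f -> (forall u, A (f u)) -> small K [set: U].
Proof.
move=> /smallP sA finj fA; apply/smallP => -[g [ginj _]]; apply: sA.
by exists (f \o g); split=> [|k] /=; [exact: inj_comp|exact: fA].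
Qed.

Lemma small_sub (U : Type) (A B : set U) : A `<=` B -> small K B -> small K A.
Proof.
move=> AB /smallP sB; apply/smallP => -[f [finj fA]]; apply: sB.
by exists f; split=> // k; exact: AB.
Qed.

Lemma small_image (T U : Type) (f : T -> U) (A : set T) :
  small K A -> small K (f @` A).
Proof.
move=> sA /card_le_trans h; apply: sA; apply: h; exact: card_image_le.
Qed.

Lemma small_set_type (U : Type) (A : set U) : small K A <-> small K [set: set_type A].
Proof.
split=> sA.
  by apply: (small_inj sA (f := set_val)) => [x y /val_inj|x] //; exact: set_valP.
have -> : A = set_val @` [set: set_type A].
  apply/seteqP; split=> [x Ax|_ [x _ <-]]; last exact: set_valP.
  by exists (elt Ax).
exact: small_image.
Qed.

(** The product embeds into the square of the larger factor Z. Either Z is infinite and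
    [card_square] applies, or Z is countable, which [Knat] covers. *)
Lemma small_prod (X Y : Type) :
  small K [set: X] -> small K [set: Y] -> small K [set: X * Y].
Proof.
have sq (Z : Type) : small K [set: Z] -> small K [set: Z * Z].
  move=> sZ; have [[f finj]|[f finj]] := card_comparable nat Z.
    have [g ginj] := card_square finj.
    by apply: (small_inj sZ ginj).
  have [c [cinj _]] : exists c : nat * nat -> nat, injective c /\ forall p, [set: nat] (c p).
    by apply/card_le_setTP; have := card_nat2; rewrite card_eq_le => /andP[].
  apply: (small_inj Knat (f := fun p : Z * Z => c (f p.1, f p.2))) => //.
  by move=> [x y] [x' y'] /cinj [/finj -> /finj ->].
move=> sX sY; have [[f finj]|[f finj]] := card_comparable X Y.
  apply: (small_inj (sq _ sY) (f := fun p : X * Y => (f p.1, p.2))) => //.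
  by move=> [x y] [x' y'] /= [/finj -> ->].
apply: (small_inj (sq _ sX) (f := fun p : X * Y => (p.1, f p.2))) => //.
by move=> [x y] [x' y'] /= [-> /finj ->].
Qed.

Lemma small_countType (X : countType) : small K [set: X].
Proof. exact: (small_inj Knat (f := @pickle X)) (pcan_inj pickleK) _. Qed.

Lemma small_sum (X Y : Type) :
  small K [set: X] -> small K [set: Y] -> small K [set: X + Y].
Proof.
move=> sX sY; have sO (Z : Type) : small K [set: Z] -> small K [set: option Z].
  move=> sZ.
  have [[z0]|nZ] := pselect (inhabited Z).
    pose f (o : option Z) := if o is Some z then (z, true) else (z0, false).
    apply: (small_inj (small_prod sZ (@small_countType bool)) (f := f)) => //.
    by move=> [x|] [y|] // [->].
  apply: (small_inj (@small_countType unit) (f := fun=> tt)) => //.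
  by move=> [x|] [y|] // _; exfalso; apply: nZ; constructor.
pose f (s : X + Y) : option X * option Y :=
  match s with inl x => (Some x, None) | inr y => (None, Some y) end.
apply: (small_inj (small_prod (sO _ sX) (sO _ sY)) (f := f)) => //.
by move=> [x|x] [y|y] // [->].
Qed.

Lemma small_setU (U : Type) (A B : set U) :
  small K A -> small K B -> small K (A `|` B).
Proof.
move=> /small_set_type sA /small_set_type sB.
have -> : A `|` B = join (@set_val _ A) (@set_val _ B) @` setT.
  apply/seteqP; split=> [x [Ax|Bx]|_ [[x|x] _ <-]] /=.
  - by exists (inl (elt Ax)).
  - by exists (inr (elt Bx)).
  - by left; exact: set_valP.
  - by right; exact: set_valP.
exact: small_image (small_sum sA sB).
Qed.

Lemma small_range (X U : Type) (f : X -> U) : small K [set: X] -> small K (range f).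
Proof. exact: small_image. Qed.

Lemma small_finite (U : Type) (A : set U) : finite_set A -> small K A.
Proof.
move=> /finite_set_countable Ac h; apply: Knat; exact: card_le_trans h Ac.
Qed.

End Small.

(** * Formulas *)

Section Formulas.
Variable L : language.

Fixpoint trename (V W : Type) (f : V -> W) (t : term L V) : term L W :=
  match t with
  | TVar x => TVar L (f x)
  | TApp g ts => TApp (fun i => trename f (ts i))
  end.

Fixpoint frename (V W : Type) (f : V -> W) (phi : formula L V) : formula L W :=
  match phi with
  | FBot => FBot L W
  | FEq s t => FEq (trename f s) (trename f t)
  | FRel r ts => FRel (fun i => trename f (ts i))
  | FImp phi1 phi2 => FImp (frename f phi1) (frename f phi2)
  | FAll phi1 => FAll (frename (omap f) phi1)
  end.

Lemma eval_trename (M : structure L) (V W : Type) (f : V -> W) (w : W -> M) t :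
  eval w (trename f t) = eval (w \o f) t.
Proof. by elim: t => //= g ts IH; congr finterp; apply: funext. Qed.

Lemma oapp_omap (M V W : Type) (f : V -> W) (w : W -> M) m :
  oapp w m \o omap f = oapp (w \o f) m.
Proof. by apply: funext => -[]. Qed.

Lemma sat_frename (M : structure L) (V W : Type) (f : V -> W) (w : W -> M) phi :
  sat w (frename f phi) <-> sat (w \o f) phi.
Proof.
elim: phi W f w => //= {V} [V s t|V r ts|V p1 IH1 p2 IH2|V p IH] W f w.
- by rewrite !eval_trename.
- suff -> : (fun i => eval w (trename f (ts i))) = (fun i => eval (w \o f) (ts i)) by [].
  by apply: funext => i; exact: eval_trename.
- by split=> h s; apply/IH2/h/IH1.
- by split=> h m; [have /IH := h m|apply/IH]; rewrite oapp_omap.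
Qed.

Lemma tvars_trename (V W : Type) (f : V -> W) (t : term L V) w :
  tvars (trename f t) w -> exists2 v, tvars t v & f v = w.
Proof.
elim: t => [x /= ->|g ts IH [i _ /IH[v tv <-]]]; first by exists x.
by exists v => //; exists i.
Qed.

Lemma fvars_frename (V W : Type) (f : V -> W) (phi : formula L V) w :
  fvars (frename f phi) w -> exists2 v, fvars phi v & f v = w.
Proof.
elim: phi W f w => //= {V} [V s t|V r ts|V p1 IH1 p2 IH2|V p IH] W f w.
- by case=> h; have [v tv fv] := tvars_trename h; exists v => //; [left|right].
- by move=> [i _ h]; have [v tv fv] := tvars_trename h; exists v => //; exists i.
- by case=> h; [have [v tv fv] := IH1 _ _ _ h|have [v tv fv] := IH2 _ _ _ h]; exists v => //; [left|right].
- by move=> h; have [[v|] pv // [fv]] := IH _ _ _ h; exists v.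
Qed.

Lemma eval_ext (M : structure L) (V : Type) (v w : V -> M) (t : term L V) :
  (forall x, tvars t x -> v x = w x) -> eval v t = eval w t.
Proof.
elim: t => [x|g ts IH] /= vw; first exact: vw.
by congr finterp; apply: funext => i; apply: IH => x tx; apply: vw; exists i.
Qed.

Lemma sat_ext (M : structure L) (V : Type) (v w : V -> M) (phi : formula L V) :
  (forall x, fvars phi x -> v x = w x) -> sat v phi <-> sat w phi.
Proof.
elim: phi v w => //= {V} [V s t|V r ts|V p1 IH1 p2 IH2|V p IH] v w vw.
- by rewrite (@eval_ext _ _ v w s) 1?(@eval_ext _ _ v w t)// => x tx; apply: vw; [right|left].
- suff -> : (fun i => eval v (ts i)) = (fun i => eval w (ts i)) by [].
  by apply: funext => i; apply: eval_ext => x tx; apply: vw; exists i.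
- have [h1 h1'] : sat v p1 <-> sat w p1 by apply: IH1 => x px; apply: vw; left.
  have [h2 h2'] : sat v p2 <-> sat w p2 by apply: IH2 => x px; apply: vw; right.
  by split=> h /[dup] ?; [move=> /h1' /h|move=> /h1 /h].
- have h m : sat (oapp v m) p <-> sat (oapp w m) p.
    by apply: IH => -[x|] px //=; exact: vw.
  by split=> H m; apply/h.
Qed.

Lemma finite_tvars (V : Type) (t : term L V) : finite_set (tvars t).
Proof.
elim: t => [x|g ts IH] /=; first exact: finite_set1.
by apply: bigcup_finite => // i _; exact: IH.
Qed.

Lemma finite_fvars (V : Type) (phi : formula L V) : finite_set (fvars phi).
Proof.
elim: phi => /= {V} [V|V s t|V r ts|V p1 IH1 p2 IH2|V p IH].
- exact: finite_set0.
- by rewrite finite_setU; split; exact: finite_tvars.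
- by apply: bigcup_finite => // i _; exact: finite_tvars.
- by rewrite finite_setU.
- by apply: finite_preimage IH => x y _ _ -[].
Qed.

End Formulas.

Lemma finite_enum (T : Type) (F : set T) :
  finite_set F -> exists n (g : 'I_n -> T), range g = F.
Proof.
move=> /(@finite_seqP {classic T})[s ->].
exists (size s), (tnth (in_tuple s)); apply/seteqP; split=> x.
  by move=> [i _ <-]; exact: mem_tnth.
by move=> /= xs; have /tnthP[i ->] : x \in in_tuple s := xs; exists i.
Qed.

(** * Definable sets of tuples *)

Section Definable.
Context (L : language) (M : structure L).
Implicit Types (A B C D : set M) (X Y Z : Type).

(** Definable sets rather than formulas: Boolean operations, substitution and quantification then
    become closure properties, free of syntax. *)
Definition Def A X (S : set (X -> M)) : Prop :=
  exists2 phi : formula L (X + M), Defs.over A phi & forall c, S c <-> psat c phi.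

Lemma Def_mono A B X (S : set (X -> M)) : A `<=` B -> Def A S -> Def B S.
Proof. by move=> AB [phi oA SE]; exists phi => // m pm; exact/AB/oA. Qed.

Lemma Def_iff A X (S S' : set (X -> M)) :
  (forall c, S c <-> S' c) -> Def A S -> Def A S'.
Proof. by move=> SS [phi oA SE]; exists phi => // c; rewrite -SE -SS. Qed.

Lemma Def_compl A X (S : set (X -> M)) : Def A S -> Def A (~` S).
Proof.
move=> [phi oA SE]; exists (FNot phi); first by move=> m [pm|[]]; exact: oA.
by move=> c; split=> h /SE.
Qed.

Lemma Def_imp A X (S S' : set (X -> M)) :
  Def A S -> Def A S' -> Def A [set c | S c -> S' c].
Proof.
move=> [phi oA SE] [phi' oA' SE']; exists (FImp phi phi').
  by move=> m /= [pm|pm]; [exact: oA|exact: oA'].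
by move=> c; split=> h /SE/h/SE'.
Qed.

Lemma Def_setI A X (S S' : set (X -> M)) :
  Def A S -> Def A S' -> Def A (S `&` S').
Proof.
move=> dS dS'; apply: (@Def_iff _ _ (~` [set c | S c -> (~` S') c])).
  by move=> c; split=> [/not_implyP[? /contrapT]|[Sc Sc'] h] //; exact: h.
by apply: Def_compl; apply: Def_imp => //; exact: Def_compl.
Qed.

Lemma Def_setT A X : Def A [set: X -> M].
Proof.
exists (FNot (FBot _ _)) => [m [[]|[]]|c].
by split=> // _.
Qed.

Lemma Def_forall A X n (S : 'I_n -> set (X -> M)) :
  (forall i, Def A (S i)) -> Def A [set c | forall i, S i c].
Proof.
elim: n S => [|n IH] S dS.
  by apply: Def_iff (Def_setT A X) => c; split=> // _ -[].
apply: (@Def_iff _ _ (S ord0 `&` [set c | forall i, S (lift ord0 i) c])).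
  move=> c; split=> [[S0 h] i|h]; last by split=> [|i]; exact: h.
  by case: (unliftP ord0 i) => [j|] ->.
by apply: Def_setI => //; apply: IH.
Qed.

Lemma Def_subst A B X Y (f : X -> Y + M) (S : set (X -> M)) :
  A `<=` B -> (forall x m, f x = inr m -> B m) -> Def A S ->
  Def B [set v : Y -> M | S (join v id \o f)].
Proof.
move=> AB fB [phi oA SE].
pose g (z : X + M) : Y + M := match z with inl x => f x | inr m => inr m end.
exists (frename g phi).
  by move=> m h; have [[x|m'] px /=] := fvars_frename h; [exact: fB|move=> [<-]; exact/AB/oA].
move=> v; rewrite /psat sat_frename /= SE /psat.
by apply: sat_ext => -[].
Qed.

Lemma Def_reindex A X Y (f : X -> Y) (S : set (X -> M)) :
  Def A S -> Def A [set v : Y -> M | S (v \o f)].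
Proof. exact: (@Def_subst A A X Y (inl \o f)). Qed.

Lemma Def_param A X Z (b : Z -> M) (P : set (X + Z -> M)) :
  Def A P -> Def (A `|` range b) [set x | P (join x b)].
Proof.
move=> dP; pose f (z : X + Z) : X + M := match z with inl x => inl x | inr z => inr (b z) end.
have := @Def_subst A (A `|` range b) _ _ f P.
move=> /(_ (@subsetUl _ _ _)) h.
apply: Def_iff (h _ dP); last by move=> [x|z] m //= [<-]; right; exists z.
by move=> x /=; rewrite (_ : _ \o f = join x b) //; apply: funext => -[].
Qed.

(** Converse of [Def_param]: one index is chosen for each parameter in [range b] outside A, and the
    parameter becomes a variable. *)
Lemma Def_unparam A X Z (b : Z -> M) (S : set (X -> M)) :
  Def (A `|` range b) S ->
  exists2 P : set (X + Z -> M), Def A P & forall x, S x <-> P (join x b).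
Proof.
move=> [phi oA SE].
have /choice[h hP] : forall m, exists z : Z + M, (A `|` range b) m ->
    (exists2 y, z = inl y & b y = m) \/ (z = inr m /\ A m).
  move=> m; have [Am|nAm] := pselect (A m); first by exists (inr m); right.
  have [[y _ bm]|nr] := pselect (range b m); first by exists (inl y); left; exists y.
  by exists (inr m) => -[].
pose g (z : X + M) : X + Z + M := match z with inl x => inl (inl x)
  | inr m => match h m with inl y => inl (inr y) | inr m => inr m end end.
exists [set v | psat v (frename g phi)].
  exists (frename g phi) => // m h'; have [[x|m'] px //=] := fvars_frename h'.
  by case: (hP m' (oA _ px)) => [[y -> _]|[-> Am']] // [<-].
move=> x; rewrite SE /= /psat sat_frename.
apply: sat_ext => -[x'|m] //= /oA /hP.
by case=> [[y -> <-]|[->]].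
Qed.

Lemma Def_finite A X (S : set (X -> M)) :
  Def A S -> exists n (m : 'I_n -> M), range m `<=` A /\ Def (range m) S.
Proof.
move=> [phi oA SE].
have /finite_enum[n [g gE]] : finite_set [set m | fvars phi (inr m)].
  by apply: finite_preimage (finite_fvars phi) => x y _ _ [].
exists n, g; rewrite gE; split; first by move=> m; exact: oA.
by exists phi.
Qed.

(** The semantic substitute for the free variables of a formula lying in D. *)
Definition dep X (D : set X) (S : set (X -> M)) : Prop :=
  forall c c', (forall x, D x -> c x = c' x) -> S c -> S c'.

Lemma dep_mono X (D D' : set X) S : D `<=` D' -> dep D S -> dep D' S.
Proof. by move=> DD dS c c' cc; apply: dS => x /DD/cc. Qed.

Lemma depI X (D D' : set X) S : dep D S -> dep D' S -> dep (D `&` D') S.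
Proof.
move=> dS dS' c c' cc Sc.
pose c2 x := if pselect (D x) then c x else c' x.
apply: (dS' c2).
  by move=> x D'x; rewrite /c2; case: pselect => // Dx; exact: cc.
by apply: (dS c) Sc => x Dx; rewrite /c2; case: pselect.
Qed.

Lemma Def_dep A X (S : set (X -> M)) :
  Def A S -> exists n (g : 'I_n -> X), dep (range g) S.
Proof.
move=> [phi oA SE].
have /finite_enum[n [g gE]] : finite_set [set x | fvars phi (inl x)].
  by apply: finite_preimage (finite_fvars phi) => x y _ _ [].
exists n, g => c c' cc /SE Sc; apply/SE; move: Sc; apply: (sat_ext _).1.
by move=> [x|m] //= px; apply: cc; rewrite gE.
Qed.

Lemma Def_exists1 A Y (P : set (option Y -> M)) :
  Def A P -> Def A [set v : Y -> M | exists m, P (oapp v m)].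
Proof.
move=> [phi oA PE].
pose g (z : option Y + M) : option (Y + M) :=
  match z with inl (Some y) => Some (inl y) | inl None => None | inr m => Some (inr m) end.
apply: (@Def_iff _ _ (~` [set v : Y -> M | forall m, ~ P (oapp v m)])).
  by move=> v; split=> [/existsNP[m /contrapT]|[m Pm] h]; [exists m|exact: (h m)].
apply: Def_compl; exists (FAll (FNot (frename g phi))).
  by move=> m [h|[]]; have [[[y|]|m'] pm //= [<-]] := fvars_frename h; exact: oA.
move=> v; have E m : P (oapp v m) <-> sat (oapp (join v id) m) (frename g phi).
  by rewrite PE sat_frename; apply: sat_ext => -[[y|]|m'].
by split=> h m /E; exact: h.
Qed.

Lemma Def_existsI A n Y (P : set ('I_n + Y -> M)) :
  Def A P -> Def A [set v : Y -> M | exists x, P (join x v)].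
Proof.
elim: n P => [|n IH] P dP.
  have [m0] := dom_inhabited M.
  pose f (z : 'I_0 + Y) : Y + M := match z with inl i => inr m0 | inr y => inl y end.
  pose g (z : 'I_0 + Y) : Y := match z with inl i => match notF (ltn_ord i) with end | inr y => y end.
  apply: Def_iff (Def_reindex g dP) => v; split.
    by move=> Pv; exists (fun=> m0); congr (P _): Pv; apply: funext => -[[]|].
  by move=> [x]; congr (P _); apply: funext => -[[]|].
pose f (z : 'I_n.+1 + Y) : option ('I_n + Y) :=
  match z with inl i => omap inl (unlift ord0 i) | inr y => Some (inr y) end.
apply: Def_iff (IH _ (Def_exists1 (Def_reindex f dP))) => v; split.
  move=> [x [m Pm]]; exists (fun i => oapp x m (unlift ord0 i)).
  by congr (P _): Pm; apply: funext => -[i|y] //=; case: unlift.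
move=> [x Px]; exists (x \o lift ord0), (x ord0).
congr (P _): Px; apply: funext => -[i|y] //=.
by case: (unliftP ord0 i) => [j|] ->.
Qed.

(** A formula sees finitely many variables, so an arbitrarily long tuple x can be traded for a
    finite one. This allows quantification over x and removes size conditions on X. *)
Lemma finite_variables A X Y (P : set (X + Y -> M)) : Def A P ->
  exists n (r : X -> 'I_n) (h : (X -> M) -> 'I_n -> M),
    forall x v, P (join x v) <-> P (join (h x \o r) v).
Proof.
move=> /Def_dep[n [g dg]]; have [m0] := dom_inhabited M.
(* Index 0 is a dummy that collects the coordinates on which P does not depend. *)
have /choice[r rP] : forall x, exists j : 'I_n.+1,
    range g (inl x) -> exists2 i, g i = inl x & j = lift ord0 i.
  move=> x; have [[i _ gi]|] := pselect (range g (inl x)); last by exists ord0.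
  by exists (lift ord0 i) => _; exists i.
pose h (x : X -> M) (j : 'I_n.+1) : M := match unlift ord0 j with
  | Some i => match g i with inl x0 => x x0 | inr _ => m0 end | None => m0 end.
exists n.+1, r, h => x v.
have xh z : range g z -> join x v z = join (h x \o r) v z.
  case: z => // x0 /rP[i gi ri] /=; rewrite /h ri liftK.
  by rewrite gi.
by split; apply: dg => z /xh ->.
Qed.

Lemma Def_existsX A X Y (P : set (X + Y -> M)) :
  Def A P -> Def A [set v : Y -> M | exists x, P (join x v)].
Proof.
move=> dP; have [n [r [h hP]]] := finite_variables dP.
pose f (z : X + Y) : 'I_n + Y := match z with inl x => inl (r x) | inr y => inr y end.
apply: Def_iff (Def_existsI (Def_reindex f dP)) => v.
have fE x' : join x' v \o f = join (x' \o r) v by apply: funext => -[].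
split=> [[x' /=]|[x /hP Px]]; first by rewrite fE => Px; exists (x' \o r).
by exists (h x); rewrite /= fE.
Qed.

Lemma Def_sat X Z (b : Z -> M) (phi : formula L (X + Z)) :
  Def (range b) [set c | sat (join c b) phi].
Proof.
have := @Def_param set0 X Z b [set v | sat v phi]; rewrite set0U; apply.
exists (frename inl phi); first by move=> m h; have [] := fvars_frename h.
by move=> v; rewrite /psat sat_frename /=; apply: sat_ext.
Qed.

Lemma Def0_sat V (P : set (V -> M)) : Def set0 P ->
  exists phi : formula L V, forall v, P v <-> sat v phi.
Proof.
move=> [phi o0 PE].
have [[v0]|nV] := pselect (inhabited V).
  pose g (z : V + M) : V := match z with inl v => v | inr _ => v0 end.
  exists (frename g phi) => v; rewrite PE sat_frename.
  by apply: sat_ext => -[x|m] //= /o0.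
(* Without variables there is only one assignment, so a true or a false sentence serves as the
   formula. *)
have [[v Pv]|nP] := pselect (exists v, P v).
  exists (FNot (FBot _ _)) => w; split=> [_ h|_]; first exact: h.
  by rewrite (_ : w = v) //; apply: funext => x; exfalso; apply: nV.
by exists (FBot _ _) => v; split=> // Pv; apply: nP; exists v.
Qed.

Lemma tpP A X (b b' : X -> M) :
  tp b A = tp b' A <-> (forall S, Def A S -> S b -> S b').
Proof.
split=> [bb S [phi oA SE] /SE Sb|h].
  by apply/SE; have : tp b' A phi by [rewrite -bb]; case.
apply/seteqP; split=> phi [oA sb]; split=> //.
  by apply: (h [set c | psat c phi]) => //; exists phi.
apply: contrapT => nsb; apply: (h [set c | ~ psat c phi]) nsb _ => //.
by apply: Def_compl; exists phi.
Qed.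

Lemma psat_Def A X (phi : formula L (X + M)) :
  Defs.over A phi -> Def A [set c | psat c phi].
Proof. by move=> oA; exists phi. Qed.

End Definable.

(** * Automorphisms *)

Section Automorphisms.
Context (L : language) (M : structure L).
Implicit Types (A B C D : set M) (X Y Z : Type).

Record aut A := Aut {
  af :> M -> M;
  ag : M -> M;
  afK : cancel af ag;
  agK : cancel ag af;
  af_sat : forall V (v : V -> M) (phi : formula L V),
    sat (af \o v) phi <-> sat v phi;
  af_fix : forall a, A a -> af a = a }.

Program Definition aut_inv A (t : aut A) : aut A :=
  @Aut A (ag t) (af t) (@agK _ t) (@afK _ t) _ _.
Next Obligation.
move=> A t V v phi; rewrite -(af_sat t).
by rewrite (_ : t \o _ = v) //; apply: funext => x /=; rewrite agK.
Qed.
Next Obligation. by move=> A t a Aa; rewrite -{1}(af_fix t Aa) afK. Qed.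

Program Definition aut_comp A (t s : aut A) : aut A :=
  @Aut A (t \o s) (ag s \o ag t) _ _ _ _.
Next Obligation. by move=> A t s x /=; rewrite !afK. Qed.
Next Obligation. by move=> A t s x /=; rewrite !agK. Qed.
Next Obligation. by move=> A t s V v phi; exact: iff_trans (af_sat t (s \o v) phi) (af_sat s v phi). Qed.
Next Obligation. by move=> A t s a Aa /=; rewrite !af_fix. Qed.

Program Definition aut_id A : aut A := @Aut A id id _ _ _ _.
Next Obligation. by []. Qed.
Next Obligation. by []. Qed.
Next Obligation. by []. Qed.
Next Obligation. by []. Qed.

Definition aut_sub A B (AB : A `<=` B) (t : aut B) : aut A :=
  @Aut A t (ag t) (@afK _ t) (@agK _ t) (@af_sat _ t)
    (fun a Aa => af_fix t (AB _ Aa)).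

Lemma automorphism_sat (s : M -> M) : automorphism s ->
  forall V (v : V -> M) (phi : formula L V), sat (s \o v) phi <-> sat v phi.
Proof.
move=> [[g sK gK] sf sr] V v phi.
have ev W (w : W -> M) (t : term L W) : eval (s \o w) t = s (eval w t).
  by elim: t => [x|f ts IH] //=; rewrite sf; congr finterp; apply: funext.
elim: phi v => //= {V} [V p q|V r ts|V p1 IH1 p2 IH2|V p IH] v.
- by rewrite !ev; split=> [/(can_inj sK)|->].
- rewrite (_ : (fun i => eval (s \o v) (ts i)) = s \o (fun i => eval v (ts i))).
    exact: sr.
  by apply: funext => i; exact: ev.
- by rewrite IH1 IH2.
- have oE m : oapp (s \o v) (s m) = s \o oapp v m by apply: funext => -[].
  split=> h m; first by apply/IH; rewrite -oE.
  by rewrite -(gK m) oE; apply/IH.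
Qed.

Lemma Def_aut A X (S : set (X -> M)) (t : aut A) c :
  Def A S -> S (t \o c) <-> S c.
Proof.
move=> [phi oA SE]; rewrite !SE /psat -[X in _ <-> X](af_sat t).
by apply: sat_ext => -[x|m] //= pm; rewrite af_fix //; exact: oA.
Qed.

Definition act A X (t : aut A) (S : set (X -> M)) : set (X -> M) :=
  [set c | S (ag t \o c)].

Lemma Def_act A B X (S : set (X -> M)) (t : aut A) :
  Def B S -> Def (t @` B) (act t S).
Proof.
move=> [phi oB SE].
pose g (z : X + M) : X + M := match z with inl x => inl x | inr m => inr (t m) end.
exists (frename g phi).
  move=> m h; have [[x|m'] px //= [<-]] := fvars_frename h.
  by exists m' => //; exact: oB.
move=> c; rewrite /act /= SE /psat sat_frename -(af_sat t).
by apply: sat_ext => -[x|m] //= _; rewrite agK.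
Qed.

Lemma act_relation A B X Y (P : set (X + Y -> M)) (t : aut A) (b : Y -> M) :
  Def B P -> B `<=` A ->
  act t [set x | P (join x b)] = [set x | P (join x (t \o b))].
Proof.
move=> dP BA; apply/seteqP; split=> x; rewrite /act /= => Px.
  have /(Def_aut t _ (Def_mono BA dP)) := Px.
  by congr (P _); apply: funext => -[y|z] //=; rewrite agK.
apply/(Def_aut t _ (Def_mono BA dP)); congr (P _): Px.
by apply: funext => -[y|z] //=; rewrite agK.
Qed.

Lemma tp_aut A X (t : aut A) (b : X -> M) : tp (t \o b) A = tp b A.
Proof. by apply/tpP => S dS /(Def_aut t _ dS). Qed.

(** * Dividing *)

(* By homogeneity dividing of phi(x,b) over A can be read off the set that    *)
(* phi(x,b) defines: some sequence of translates of it under automorphisms    *)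
(* over A is k-inconsistent.                                                  *)
Definition kdiv k A X (S : set (X -> M)) : Prop :=
  exists t : nat -> aut A, forall s : 'I_k -> nat, injective s ->
    ~ exists c, forall j, act (t (s j)) S c.

Definition sdiv A X (S : set (X -> M)) : Prop := exists k, kdiv k A S.

Lemma kdiv_sub k A X (S S' : set (X -> M)) : S `<=` S' -> kdiv k A S' -> kdiv k A S.
Proof.
move=> SS [t tP]; exists t => s sinj [c cS]; apply: (tP s sinj).
by exists c => j; apply: SS; exact: cS.
Qed.

Lemma kdiv_base k A B X (S : set (X -> M)) : A `<=` B -> kdiv k B S -> kdiv k A S.
Proof. by move=> AB [t tP]; exists (fun n => aut_sub AB (t n)). Qed.

Lemma sdiv_base A B X (S : set (X -> M)) : A `<=` B -> sdiv B S -> sdiv A S.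
Proof. by move=> AB [k kS]; exists k; exact: kdiv_base kS. Qed.

Lemma kdiv_act k A X (S : set (X -> M)) (t : aut A) : kdiv k A S -> kdiv k A (act t S).
Proof.
move=> [u uP]; exists (fun n => aut_comp (u n) (aut_inv t)) => s sinj [c cS].
apply: (uP s sinj); exists c => j; move: (cS j); rewrite /act /=.
by congr S; apply: funext => x /=; rewrite afK.
Qed.

End Automorphisms.

(** * Saturation and homogeneity *)

Definition fip (T : Type) (F : set (set T)) : Prop :=
  forall n (W : 'I_n -> set T), (forall i, F (W i)) -> exists c, forall i, W i c.

Lemma fip_ultra (T : Type) (F : set (set T)) :
  fip F -> exists q : set (set T), UltraFilter q /\ F `<=` q.
Proof.
move=> Ffip.
pose G : set (set T) := [set W | exists n (V : 'I_n -> set T),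
  (forall i, F (V i)) /\ forall c, (forall i, V i c) -> W c].
have GF : ProperFilter G.
  apply: Build_ProperFilter_ex.
    by move=> W [n [V [/Ffip[c Vc] VW]]]; exists c; exact: VW.
  split.
  - by exists 0, (fun=> setT); split=> // -[].
  - move=> W W' [n [V [FV VW]]] [n' [V' [FV' VW']]].
    exists (n + n'), (fun i => match fintype.split i with inl j => V j | inr j => V' j end).
    split=> [i|c h]; first by case: fintype.split.
    split; [apply: VW => i; have := h (unsplit (inl i))|apply: VW' => i; have := h (unsplit (inr i))];
      by rewrite unsplitK.
  - by move=> W W' WW' [n [V [FV VW]]]; exists n, V; split=> // c /VW/WW'.
have [q [qU Gq]] := ultraFilterLemma GF; exists q; split=> // W FW.
by apply: Gq; exists 1, (fun=> W); split=> // c; apply; exact: ord0.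
Qed.

Lemma ultraC (T : Type) (q : set (set T)) (W : set T) :
  UltraFilter q -> q (~` W) <-> ~ q W.
Proof.
move=> qU; split=> [qnW qW|nqW].
  by have [x []] := filter_ex (filterI qW qnW).
by have [] := in_ultra_setVsetC W qU.
Qed.

Lemma filter_ord (T : Type) (q : set (set T)) n (W : 'I_n -> set T) :
  Filter q -> (forall i, q (W i)) -> q [set x | forall i, W i x].
Proof.
move=> qF; elim: n W => [|n IH] W qW.
  rewrite (_ : [set _ | _] = setT); first exact: filterT.
    by apply/seteqP; split=> // x _ [].
have -> : [set x | forall i, W i x] = W ord0 `&` [set x | forall i, W (lift ord0 i) x].
  apply/seteqP; split=> [x h|x [W0 h] i]; first by split=> [|i]; exact: h.
  by case: (unliftP ord0 i) => [j|] ->.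
by apply: filterI => //; apply: IH.
Qed.

Section Monster.
Context (L : language) (K : Type) (M : structure L).
Hypothesis Knat : small K [set: nat].
Hypothesis Msat : saturated K M.
Hypothesis Mhom : strongly_homogeneous K M.
Implicit Types (A B C D E : set M) (X Y Z : Type).

(** [strongly_homogeneous] has no parameters, so both tuples are prolonged by an enumeration of
    A. *)
Lemma homogeneity A Y (b b' : Y -> M) : small K A -> small K [set: Y] ->
  (forall S, Def A S -> S b -> S b') -> exists t : aut A, t \o b = b'.
Proof.
move=> sA sY bb.
pose v : A -> M := @set_val _ A.
have tpE : tp (join b v) set0 = tp (join b' v) set0.
  apply/tpP => S dS Sb; apply: (bb [set c | S (join c v)]) => //.
  apply: Def_mono (Def_param v dS).
  by rewrite set0U => _ [a _ <-]; exact: set_valP.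
have sYA : small K [set: Y + A] by exact: (small_sum Knat sY ((small_set_type _ _).1 sA)).
have [s [saut sE]] := Mhom sYA tpE.
have [[g sK gK] _ _] := saut.
unshelve eexists (@Aut _ _ A s g sK gK (automorphism_sat saut) _).
  by move=> a Aa; exact: (sE (inr (elt Aa))).
by apply: funext => y /=; exact: (sE (inl y)).
Qed.

Lemma aut_fixing A B (t : aut A) : (forall b, B b -> t b = b) ->
  exists u : aut B, af u = af t /\ ag u = ag t.
Proof. by move=> tB; exists (@Aut _ _ B t (ag t) (@afK _ _ _ t) (@agK _ _ _ t) (@af_sat _ _ _ t) tB). Qed.

(** Saturation is given for one variable; the coordinates of a long tuple are found one at a time,
    by Zorn's lemma on partial realisations G of an ultrafilter q containing F. The ultrafilter
    makes one-step extensions possible, because projections of its members belong to it again. *)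
Lemma realize X C (F : set (set (X -> M))) : small K [set: X] -> small K C ->
  (forall W, F W -> Def C W) -> fip F -> exists c, forall W, F W -> W c.
Proof.
move=> sX sC FC /fip_ultra[q [qU Fq]].
pose dom (G : set (X * M)) : set X := [set x | exists m, G (x, m)].
pose P (G : set (X * M)) := (forall x m m', G (x, m) -> G (x, m') -> m = m') /\
  forall W, q W -> Def C W -> dep (dom G) W ->
    forall c, (forall x m, G (x, m) -> c x = m) -> W c.
have [G [[G1 G2] Gmax]] : exists G, P G /\ forall H, G `<` H -> ~ P H.
  apply: Zorn_bigcup => F' FP Ftot; split.
    move=> x m m' [G FG Gm] [H FH Hm].
    have [GH|HG] := Ftot _ _ FG FH.
      by apply: (FP _ FH).1 Hm; exact: GH.
    by apply: (FP _ FG).1 Gm _; exact: HG.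
  move=> W qW dW depW c cG.
  (* W depends on finitely many coordinates, so one member of the chain decides it. For the empty
     chain W depends on no coordinate and, being non-empty, contains every tuple. *)
  have [n [g gW]] := Def_dep dW; have := depI depW gW.
  have [[G0 FG0]|F0] := pselect (exists G0, F' G0); last first.
    move=> depW'; have [c0 Wc0] := filter_ex qW; apply: depW' Wc0.
    by move=> x [[m [G FG _]]]; case: F0; exists G.
  have [G [FG Gg]] : exists G, F' G /\ forall i, dom (\bigcup_(X in F') X) (g i) -> dom G (g i).
    elim: (n) (g) => [|m IH] h; first by exists G0; split=> // -[].
    have [G [FG Gh]] := IH (h \o lift ord0).
    have [[y [H FH Hy]]|nd] := pselect (dom (\bigcup_(X in F') X) (h ord0)); last first.
      by exists G; split=> // i; case: (unliftP ord0 i) => [j|] -> //; exact: Gh.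
    have [GH|HG] := Ftot _ _ FG FH.
      exists H; split=> // i; case: (unliftP ord0 i) => [j|] -> hi; last by exists y.
      by have [z Gz] := Gh _ hi; exists z; exact: GH.
    exists G; split=> // i; case: (unliftP ord0 i) => [j|] -> hi; last by exists y; exact: HG.
    exact: Gh.
  move=> depW'; have [_] := FP _ FG; apply=> //.
    by apply: dep_mono depW' => x [dx [i _ gi]]; rewrite -gi; apply: Gg; rewrite gi.
  by move=> x m Gx; apply: cG; exists G.
have [m0] := dom_inhabited M.
have /choice[c cG] : forall x, exists m, dom G x -> G (x, m).
  by move=> x; have [[m Gm]|nd] := pselect (dom G x); [exists m|exists m0].
have cG' x m : G (x, m) -> c x = m by move=> Gm; apply: G1 (Gm); apply: cG; exists m.
have [domT|/existsNP[x ndx]] := pselect (forall x, dom G x).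
  exists c => W FW; apply: (G2 W) => //; [exact: Fq|exact: FC|].
  by move=> c1 c2 cc; have -> : c2 = c1 by apply: funext => y; rewrite cc.
exfalso.
pose C' := C `|` range c.
have sC' : small K C' by apply: small_setU => //; exact: small_range.
pose f (y : X) : unit + M := if pselect (dom G y) then inr (c y) else inl tt.
pose D' := dom G `|` [set x].
pose p : set (formula L (unit + M)) := [set phi | Defs.over C' phi /\
  exists W, [/\ q W, Def C W, dep D' W & forall u, psat u phi <-> W (join u id \o f)]].
have [u pu] : exists u : unit -> M, forall phi, p phi -> psat u phi.
  apply: (Msat sC'); first by move=> phi [].
  move=> n psi h; have /choice[W WP] : forall i, exists W, [/\ q W, Def C W, dep D' W &
     forall u, psat u (psi i) <-> W (join u id \o f)] by move=> i; have [] := h i.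
  pose W' := [set y | forall i, W i y].
  have qW' : q W' by apply: filter_ord => i; have [] := WP i.
  have dW' : Def C W' by apply: Def_forall => i; have [] := WP i.
  have depW' : dep D' W'.
    by move=> c1 c2 cc h1 i; have [_ _ d _] := WP i; exact: d cc (h1 i).
  pose g (y : X) : option X := if pselect (y = x) then None else Some y.
  (* Quantifying out the new coordinate x leaves a condition on the coordinates already found, which
     c satisfies. *)
  pose W1 := [set v : X -> M | exists m, W' (oapp v m \o g)].
  have [m Wm] : W1 c.
    apply: G2 cG'.
    - apply: filterS qW' => v W'v; exists (v x); congr W': W'v.
      by apply: funext => y /=; rewrite /g; case: pselect => yx /=; rewrite ?yx.
    - exact: Def_exists1 (Def_reindex g dW').
    - move=> c1 c2 cc [m W1m]; exists m; apply: depW' W1m => y D'y /=.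
      rewrite /g; case: pselect => //= yx.
      by case: D'y => [/cc|].
  exists (fun=> m) => i; have [_ _ d ->] := WP i.
  apply: d (Wm i) => y D'y /=; rewrite /g /f.
  case: (pselect (y = x)) => yx /=; first by rewrite yx; case: pselect.
  by case: pselect => //; case: D'y.
apply: (Gmax (G `|` [set (x, u tt)])).
  split; first by move=> z; left.
  by move=> /(_ (x, u tt) (or_intror erefl)) Gx; apply: ndx; exists (u tt).
split.
  move=> y m m' [Gm|[yx ->]] [Gm'|[yx' ->]] //.
  - exact: G1 Gm Gm'.
  - by case: ndx; exists m; rewrite -yx'.
  - by case: ndx; exists m'; rewrite -yx.
move=> W qW dW depW c1 c1G.
have depW' : dep D' W.
  apply: dep_mono depW => y [m [Gm|[-> _]]]; last by right.
  by left; exists m.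
have [phi oC' phiE] : Def C' [set u : unit -> M | W (join u id \o f)].
  apply: Def_subst dW; first exact: subsetUl.
  move=> y m; rewrite /f; case: pselect => // _ [<-]; right; by exists y.
have := pu phi; rewrite /p /= => /(_ _)Wu.
have : W (join u id \o f).
  apply/phiE/Wu; split=> //; exists W; split=> // u'; exact: iff_sym (phiE u').
apply: depW' => y D'y /=; rewrite /f; case: pselect => [[m Gm]|nd] /=.
  by rewrite (cG' _ _ Gm); apply/esym/c1G; left.
by case: D'y => // ->; apply/esym/c1G; right.
Qed.
End Monster.

(** * Forking *)

Section Forking.
Context (L : language) (K : Type) (M : structure L).
Hypothesis Knat : small K [set: nat].
Hypothesis Msat : saturated K M.
Hypothesis Mhom : strongly_homogeneous K M.
Implicit Types (A B C D E : set M) (X Y Z : Type).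

Lemma Def_formula A V (phi : formula L V) : Def A [set v : V -> M | sat v phi].
Proof.
exists (frename inl phi); first by move=> m h; have [] := fvars_frename h.
by move=> v; rewrite /psat sat_frename.
Qed.

Lemma Def_relation A X Y (b : Y -> M) (P : set (X + Y -> M)) :
  Def set0 P -> range b `<=` A -> Def A [set x | P (join x b)].
Proof. by move=> dP bA; apply: Def_mono (Def_param b dP); rewrite set0U. Qed.

Lemma dividesP A X Y (phi : formula L (X + Y)) (b : Y -> M) :
  small K A -> small K [set: Y] ->
  divides A phi b <-> sdiv A [set c | sat (join c b) phi].
Proof.
move=> sA sY; have dP := Def_formula A phi.
split=> [[k [b_ [btp bk]]]|[k [t tk]]].
  have /choice[t tE] : forall i, exists t : aut A, t \o b = b_ i.
    by move=> i; apply: (homogeneity Knat Mhom) => //; apply/tpP; rewrite btp.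
  exists k, t => s sinj [c cS]; apply: (bk s sinj); exists c => j.
  have := cS j; rewrite (@act_relation _ _ A A _ _ [set v | sat v phi]) //.
  by rewrite tE.
exists k, (fun i => t i \o b); split=> [i|s sinj [c cS]]; first exact: tp_aut.
apply: (tk s sinj); exists c => j; have := cS j.
by rewrite (@act_relation _ _ A A _ _ [set v | sat v phi]).
Qed.

Lemma sdiv0 A X : sdiv A (@set0 (X -> M)).
Proof.
exists 1, (fun=> aut_id A) => s _ [c /(_ ord0)]; by [].
Qed.

Lemma Def0 A X : Def A (@set0 (X -> M)).
Proof.
exists (FBot _ _) => // c; by split.
Qed.

(** Automorphisms over B fix c, so all translates of S would contain c. *)
Lemma kdiv_fixed A B X k (S : set (X -> M)) (c : X -> M) :
  kdiv k B S -> range c `<=` B -> S c -> False.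
Proof.
move=> [t tk] cB Sc; apply: (tk (fun j => val j)); first exact: val_inj.
exists c => j; rewrite /act /= (_ : ag _ \o c = c) //; apply: funext => x /=.
by rewrite -{1}(af_fix (t j) (cB _ (imageT c x))) afK.
Qed.

Lemma Def_finite_family A X r (T : 'I_r -> set (X -> M)) :
  (forall j, Def A (T j)) ->
  exists n (m : 'I_n -> M), range m `<=` A /\ forall j, Def (range m) (T j).
Proof.
move=> /(_ _)/Def_finite dT.
have /choice[F FP] : forall j, exists F : set M, [/\ finite_set F, F `<=` A & Def F (T j)].
  move=> j; have [n [m [mA dm]]] := dT j; exists (range m); split=> //.
  by apply: finite_image; exact: finite_finset.
have /finite_enum[n [m mE]] : finite_set (\bigcup_j F j).
  by apply: bigcup_finite => [|j _]; [exact: finite_finset|have [] := FP j].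
exists n, m; rewrite mE; split.
  by move=> x [j _]; have [_ FA _] := FP j; exact: FA.
by move=> j; have [_ _] := FP j; apply: Def_mono; exact: bigcup_sup.
Qed.

Lemma Def_formula_of X n (m : 'I_n -> M) (S : set (X -> M)) :
  Def (range m) S -> exists chi : formula L (X + 'I_n), forall c, S c <-> sat (join c m) chi.
Proof.
rewrite -[range m]set0U => /Def_unparam[P /Def0_sat[chi chiE] PE].
by exists chi => c; rewrite PE chiE.
Qed.

Definition forks A X (S : set (X -> M)) : Prop :=
  exists r (T : 'I_r -> set (X -> M)),
    [/\ forall j, Def setT (T j), forall j, sdiv A (T j)
      & forall c, S c -> exists j, T j c].

Lemma type_forksP A X (p : set (formula L (X + M))) : small K A ->
  type_forks A p <-> exists n (psi : 'I_n -> formula L (X + M)),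
    (forall i, p (psi i)) /\ forks A [set c | forall i, psat c (psi i)].
Proof.
move=> sA; split.
  move=> [n [psi [m [b [r [chi [ppsi chiA h]]]]]]]; exists n, psi; split=> //.
  exists r, (fun j => [set c | sat (join c b) (chi j)]); split=> // j.
    exact: Def_mono (Def_sat b (chi j)).
  by apply/dividesP => //; exact: small_countType.
move=> [n [psi [ppsi [r [T [dT TA h]]]]]].
have [m [b [_ db]]] := Def_finite_family dT.
have /choice[chi chiE] : forall j, exists chi : formula L (X + 'I_m),
    forall c, T j c <-> sat (join c b) chi by move=> j; exact: Def_formula_of.
exists n, psi, m, b, r, chi; split=> // [j|c /h[j Tj]]; last by exists j; apply/chiE.
apply/dividesP => //; first exact: small_countType.
by have -> : [set c | sat (join c b) (chi j)] = T j by apply/seteqP; split=> c /chiE.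
Qed.

Lemma type_dividesP A X (p : set (formula L (X + M))) : small K A ->
  type_divides A p <-> exists n (psi : 'I_n -> formula L (X + M)),
    (forall i, p (psi i)) /\ sdiv A [set c | forall i, psat c (psi i)].
Proof.
move=> sA; split.
  move=> [n [psi [m [b [chi [ppsi /dividesP chiA h]]]]]]; exists n, psi; split=> //.
  have [//||k kS] := chiA _ _; first exact: small_countType.
  by exists k; apply: kdiv_sub kS.
move=> [n [psi [ppsi kS]]].
have /Def_finite[m [b [_ db]]] : Def setT [set c | forall i, psat c (psi i)].
  by apply: Def_forall => i; exact: psat_Def.
have [chi chiE] := Def_formula_of db.
exists n, psi, m, b, chi; split=> // [|c /chiE//].
apply/dividesP => //; first exact: small_countType.
rewrite (_ : [set c | _] = [set c | forall i, psat c (psi i)]) //.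
by apply/seteqP; split=> c /chiE.
Qed.

(** Non-dividing of tp(c/D) over A, by [ndivP]; D is not assumed to contain A. *)
Definition ndiv A X (c : X -> M) D : Prop :=
  forall W, Def D W -> W c -> ~ sdiv A W.

Lemma tp_Def X (c : X -> M) D n (psi : 'I_n -> formula L (X + M)) :
  (forall i, tp c D (psi i)) ->
  Def D [set x | forall i, psat x (psi i)] /\ [set x | forall i, psat x (psi i)] c.
Proof.
move=> h; split=> [|i]; last by have [] := h i.
by apply: Def_forall => i; apply: psat_Def; have [] := h i.
Qed.

Lemma ndivP A X (c : X -> M) D : small K A ->
  ~ type_divides A (tp c D) <-> ndiv A c D.
Proof.
move=> sA; split.
  move=> h W [phi oD WE] Wc kW; apply/h/type_dividesP => //.
  exists 1, (fun=> phi); split=> [_|]; first by split=> //; apply/WE.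
  rewrite (_ : [set c | _] = W) //.
  by apply/seteqP; split=> x; [move=> /(_ ord0)/WE|move=> /WE ? _].
move=> h /type_dividesP[//|n [psi [/tp_Def[dW Wc] kW]]].
exact: h dW Wc kW.
Qed.

Lemma type_forks_tp A X (c : X -> M) D : small K A ->
  type_forks A (tp c D) <-> exists S, [/\ Def D S, S c & forks A S].
Proof.
move=> sA; split.
  move=> /type_forksP[//|n [psi [/tp_Def[dW Wc] kW]]].
  by exists [set c | forall i, psat c (psi i)].
move=> [S [[phi oD SE] Sc SA]]; apply/type_forksP => //.
exists 1, (fun=> phi); split=> [_|]; first by split=> //; apply/SE.
rewrite (_ : [set c | _] = S) //.
by apply/seteqP; split=> x; [move=> /(_ ord0)/SE|move=> /SE ? _].
Qed.

Lemma sdiv_forks A X (S : set (X -> M)) : Def setT S -> sdiv A S -> forks A S.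
Proof. by move=> dS sS; exists 1, (fun=> S); split=> // c Sc; exists ord0. Qed.

Lemma nonforking_ndiv A X (c : X -> M) D : small K A ->
  ~ type_forks A (tp c D) -> ndiv A c D.
Proof.
move=> sA h W dW Wc kW; apply/h/type_forks_tp => //; exists W; split=> //.
by apply: sdiv_forks => //; exact: Def_mono dW.
Qed.

Lemma Def_inconsistent A k X Y (P : set (X + Y -> M)) (s : 'I_k -> nat) :
  Def A P -> Def A [set v : nat * Y -> M |
     ~ exists x, forall j, P (join x (fun y => v (s j, y)))].
Proof.
move=> dP; apply: Def_compl.
pose g j (z : X + Y) : X + nat * Y := match z with inl x => inl x | inr y => inr (s j, y) end.
have := @Def_existsX _ _ A X (nat * Y)%type [set v : X + nat * Y -> M | forall j, P (v \o g j)].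
move=> /(_ (Def_forall (fun j => Def_reindex (g j) dP))).
apply: Def_iff => v; split=> -[x Px]; exists x => j; have := Px j; congr P;
  by apply: funext => -[].
Qed.


(* Since tp(c/D) does not divide, a k-inconsistent sequence of conjugates of  *)
(* S has arbitrarily long subfamilies whose parameters realise a given        *)
(* formula of tp(D/c) together with a conjugate of c; compactness applies.    *)
Lemma kdiv_extend A D X Z k (c : Z -> M) (S : set (X -> M)) :
  small K [set: Z] -> small K D -> A `<=` D ->
  ndiv A c D -> Def D S -> kdiv k A S -> kdiv k (A `|` range c) S.
Proof.
move=> sZ sD AD cD dS [t tk].
have sA := small_sub AD sD.
pose b : D -> M := @set_val _ D.
have bD : range b `<=` D by move=> _ [d _ <-]; exact: set_valP.
have Db : D `<=` range b by move=> d Dd; exists (elt Dd).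
have [P dP PE] : exists2 P : set (X + D -> M), Def A P & forall x, S x <-> P (join x b).
  by apply: Def_unparam; apply: Def_mono dS => d /Db; right.
have SE : S = [set x | P (join x b)] by apply/seteqP; split=> x /PE.
pose V := (Z + nat * D)%type.
have sV : small K [set: V].
  apply: (small_sum Knat) => //; apply: (small_prod Knat).
    exact: (small_countType Knat).
  exact: ((small_set_type _ _).1 sD).
pose row (v : V -> M) n : D -> M := fun d => v (inr (n, d)).
(* Sought are z and rows b_n such that every (z,b_n) has the type of (c,b) over A and the sets
   P(x,b_n) are k-inconsistent. *)
pose F1 : set (set (V -> M)) := [set W | exists R n, [/\ Def A R, R (join c b) &
   W = [set v : V -> M | R (join (v \o inl) (row v n))]]].
pose F2 : set (set (V -> M)) := [set W | exists s : 'I_k -> nat, injective s /\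
   W = [set v : V -> M | ~ exists x, forall j, P (join x (row v (s j)))]].
have [v vF] : exists v, forall W, (F1 `|` F2) W -> W v.
  apply: (realize Knat Msat sV sA).
    move=> W [[R [n [dR _ ->]]]|[s [_ ->]]].
      pose g (z : Z + D) : V := match z with inl z => inl z | inr d => inr (n, d) end.
      apply: Def_iff (Def_reindex g dR) => w; split; congr R; by apply: funext => -[].
    exact: (Def_reindex (inr : nat * D -> V) (Def_inconsistent s dP)).
  move=> n W WF.
  have /choice[R /choice[N RP]] : forall i, exists R : set (Z + D -> M), exists N : nat,
    [/\ Def A R, R (join c b) & forall v : V -> M,
      (forall n, (n < N)%N -> R (join (v \o inl) (row v n))) ->
      (forall s : 'I_k -> nat, injective s -> (forall j, (s j < N)%N) ->
        ~ exists x, forall j, P (join x (row v (s j)))) -> W i v].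
    move=> i; have [[R [m [dR Rc ->]]]|[s [sinj ->]]] := WF i.
      by exists R, m.+1; split=> // v /(_ m (ltnSn m)).
    exists setT, (\max_j s j).+1; split=> //; first exact: Def_setT.
    by move=> v _; apply=> // j; rewrite ltnS; exact: leq_bigmax.
  pose R0 := [set w | forall i, R i w].
  have dR0 : Def A R0 by apply: Def_forall => i; have [] := RP i.
  pose N0 := \max_i N i.
  (* R0(z,b) belongs to the non-dividing type of c, so some N0 of its translates under [t] have a
     common point z; the corresponding translates of b are the rows. *)
  have : ~ kdiv N0 A [set z | R0 (join z b)].
    move=> h; apply: (cD [set z | R0 (join z b)]); last by exists N0.
      by apply: Def_mono (Def_param b dR0) => d [/AD|/bD].
    by move=> i; have [] := RP i.
  move=> /forallNP/(_ t)/existsNP[s /not_implyP[sinj /contrapT[z zR]]].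
  pose s' m := if insub m is Some j then s j else 0.
  have s'E m (mN : (m < N0)%N) : s' m = s (Ordinal mN) by rewrite /s' insubT.
  pose v (x : V) : M := match x with inl y => z y | inr p => t (s' p.1) (b p.2) end.
  have NN i : (N i <= N0)%N by exact: leq_bigmax.
  exists v => i; have [_ _] := RP i; apply.
    move=> m mN; have mN0 := leq_trans mN (NN i).
    have := zR (Ordinal mN0); rewrite (act_relation _ _ dR0) // => /(_ i).
    by congr (R i _); apply: funext => -[y|d] //=; rewrite /row /v /= s'E.
  move=> s1 s1inj s1N [x xP]; apply: (tk (s' \o s1)).
    move=> j j' /=; rewrite !s'E ?(leq_trans (s1N _) (NN i)) // => p p'.
    by move=> /sinj [] /s1inj.
  exists x => j; rewrite SE (act_relation _ _ dP) //.
  by have := xP j; congr P; apply: funext => -[].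
have sZD : small K [set: Z + D].
  by apply: (small_sum Knat) => //; exact: ((small_set_type _ _).1 sD).
have /choice[u uE] : forall n, exists u : aut A, u \o join c b = join (v \o inl) (row v n).
  move=> n; apply: (homogeneity Knat Mhom) => // R dR Rc.
  by apply: (vF [set v : V -> M | R (join (v \o inl) (row v n))]); left; exists R, n.
have uc n z : u n (c z) = v (inl z) by have := congr1 (@^~ (inl z)) (uE n).
have ub n d : u n (b d) = v (inr (n, d)) by have := congr1 (@^~ (inr d)) (uE n).
(* All [u n] agree on c, so composing them with the inverse of [u 0] gives automorphisms fixing A
   and c. *)
have /choice[w wP] : forall n, exists w : aut (A `|` range c), forall m, w m = ag (u 0) (u n m).
  move=> n; have [|w [wE _]] := @aut_fixing _ _ A (A `|` range c) (aut_comp (aut_inv (u 0)) (u n)).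
    move=> m [Am|[z _ <-]] /=; first by rewrite (af_fix (u n)) // -{1}(af_fix (u 0) Am) afK.
    by rewrite uc -(uc 0) afK.
  by exists w => m; rewrite wE.
exists w => s sinj [x xS].
apply: (vF [set v : V -> M | ~ exists x, forall j, P (join x (row v (s j)))]).
  by right; exists s.
exists (u 0 \o x) => j; have := xS j.
rewrite SE (act_relation _ _ dP); last by left.
move=> /(Def_aut (u 0) _ dP); congr P; apply: funext => -[y|d] //=.
by rewrite wP agK ub.
Qed.

End Forking.

(** * Non-dividing tuples, invariant types and their Morley sequences *)

Lemma choose_sequence (T : Type) (R : seq T -> T -> Prop) :
  (forall s, exists x, R s x) -> exists c : nat -> T, forall n, R (mkseq c n) (c n).
Proof.
move=> /choice[f fR].
pose l := fix l n := if n is n'.+1 then rcons (l n') (f (l n')) else [::].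
have sl n : size (l n) = n by elim: n => //= n IH; rewrite size_rcons IH.
exists (fun n => f (l n)) => n; rewrite (_ : mkseq _ n = l n) //.
by elim: n => //= n IH; rewrite mkseqS IH.
Qed.

Section Independence.
Context (L : language) (K : Type) (M : structure L).
Hypothesis Knat : small K [set: nat].
Hypothesis Msat : saturated K M.
Hypothesis Mhom : strongly_homogeneous K M.
Implicit Types (A B C D E : set M) (X Y Z : Type).

Lemma kdiv_pullback k A X Y (f : Y -> X) (S : set (Y -> M)) :
  kdiv k A S -> kdiv k A [set c : X -> M | S (c \o f)].
Proof.
move=> [t tk]; exists t => s sinj [c cS]; apply: (tk s sinj).
by exists (c \o f) => j; exact: cS.
Qed.

Lemma ndiv_base A A' D X (c : X -> M) : A `<=` A' -> ndiv A c D -> ndiv A' c D.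
Proof. by move=> AA h W dW Wc /(sdiv_base AA); exact: h. Qed.

Lemma ndiv_mono A D D' X (c : X -> M) : D `<=` D' -> ndiv A c D' -> ndiv A c D.
Proof. by move=> DD h W dW; apply: h; exact: Def_mono dW. Qed.

Lemma ndiv_reindex A D X Y (c : X -> M) (f : Y -> X) :
  ndiv A c D -> ndiv A (c \o f) D.
Proof.
move=> h W dW Wc [k kW]; apply: (h [set c : X -> M | W (c \o f)]) => //.
  exact: Def_reindex.
by exists k; exact: kdiv_pullback.
Qed.

Lemma ndiv_act A D X (c : X -> M) (t : aut A) :
  ndiv A c D -> ndiv A (t \o c) (t @` D).
Proof.
move=> h W dW Wc [k kW]; apply: (h (act (aut_inv t) W)) => //.
  apply: Def_mono (Def_act (aut_inv t) dW) => _ [_ [d Dd <-] <-] /=.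
  by rewrite afK.
by exists k; exact: kdiv_act.
Qed.

(** Converse of [kdiv_extend]: by [kdiv_fixed], a set dividing over a base that contains c does not
    contain c. *)
Lemma ndiv_intro A D X (c : X -> M) :
  (forall (S : set (X -> M)) k, Def D S -> kdiv k A S -> exists2 B, range c `<=` B & kdiv k B S) ->
  ndiv A c D.
Proof.
move=> h W dW Wc [k /(h _ _ dW)[B cB kB]]; exact: kdiv_fixed kB cB Wc.
Qed.

Lemma ndiv_set A (B : set M) D Y (b : Y -> M) : range b `<=` B ->
  ndiv A (@set_val _ B) D -> ndiv A b D.
Proof.
move=> bB; rewrite (_ : b = @set_val _ B \o (fun y => elt (bB _ (imageT b y)))) //.
exact: ndiv_reindex.
Qed.

(** By compactness: were tp(c/E) inconsistent with the complements of the D-definable sets dividing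
    over A, it would imply a finite union of them and so fork. *)
Lemma nonforking_extension A E D X (c : X -> M) :
  small K [set: X] -> small K D -> A `<=` E -> E `<=` D ->
  ~ type_forks A (tp c E) -> exists t : aut E, ndiv A (t \o c) D.
Proof.
move=> sX sD AE ED cE.
have sE := small_sub ED sD; have sA := small_sub AE sE.
pose F : set (set (X -> M)) := [set W | (Def E W /\ W c) \/
  exists2 T, Def D T /\ sdiv A T & W = ~` T].
have [c' c'F] : exists c', forall W, F W -> W c'.
  apply: (realize Knat Msat sX sD).
    move=> W [[dW _]|[T [dT _] ->]]; first exact: Def_mono dW.
    exact: Def_compl.
  move=> n W WF; apply: contrapT => nc.
  have /choice[S /choice[T ST]] : forall i, exists S T : set (X -> M),
      [/\ Def E S, S c, Def D T, sdiv A T & forall x, S x -> ~ T x -> W i x].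
    move=> i; case: (WF i) => [[dW Wc]|[T [dT sT] WT]].
      by exists (W i), set0; split=> //; [exact: Def0|exact: sdiv0].
    by exists setT, T; split=> //; [exact: Def_setT|move=> x _; rewrite WT].
  apply/cE/(type_forks_tp Knat Mhom _ _ sA); exists [set x | forall i, S i x]; split.
  - by apply: Def_forall => i; have [] := ST i.
  - by move=> i; have [] := ST i.
  - exists n, T; split=> [j|j|x Sx]; [|by have [] := ST j|].
      by have [_ _ dT _ _] := ST j; exact: Def_mono dT.
    apply: contrapT => nT; apply: nc; exists x => i; have [_ _ _ _] := ST i; apply=> //.
    by move=> Tx; apply: nT; exists i.
have [t tc] : exists t : aut E, t \o c = c'.
  apply: (homogeneity Knat Mhom) => // S dS Sc; apply: c'F; by left.
exists t; rewrite tc => W dW Wc sW; apply: (c'F (~` W)) Wc.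
by right; exists W.
Qed.

Lemma extension_base_ndiv A D X (c : X -> M) : extension_base K A ->
  small K [set: X] -> small K D -> A `<=` D -> exists t : aut A, ndiv A (t \o c) D.
Proof.
move=> Abase sX sD AD; apply: nonforking_extension => //.
apply: Abase => //; split=> [phi []//|n psi h|phi oA].
  by exists c => i; have [] := h i.
have [pc|npc] := pselect (psat c phi); [left|right]; split=> //.
by move=> m [/oA|[]].
Qed.

(** B is moved to be non-dividing over A and b; the inverse automorphism restores B and moves b
    instead. *)
Lemma extension_base_ndiv_set A B Y (b : Y -> M) : extension_base K A ->
  small K A -> small K B -> small K [set: Y] ->
  exists t : aut A, ndiv A (@set_val _ B) (A `|` range (t \o b)).
Proof.
move=> Abase sA sB sY.
have sD : small K (A `|` range b) by apply: (small_setU Knat) => //; exact: small_range.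
have [||t tB] := extension_base_ndiv (@set_val _ B) Abase _ sD; last first.
- exists (aut_inv t); have := @ndiv_act _ _ _ _ (aut_inv t) tB.
  rewrite (_ : aut_inv t \o (t \o set_val) = set_val); last first.
    by apply: funext => x /=; rewrite afK.
  apply: ndiv_mono => m [Am|[y _ <-]]; last by exists (b y) => //; right; exists y.
  by exists m; [left|rewrite af_fix].
- exact: subsetUl.
- exact: ((small_set_type _ _).1 sB).
Qed.

Definition rng Y (f : nat -> Y -> M) (P : set nat) : set M :=
  \bigcup_(i in P) range (f i).

Lemma small_rng Y (f : nat -> Y -> M) (P : set nat) :
  small K [set: Y] -> small K (rng f P).
Proof.
move=> sY; apply: (@small_sub _ _ _ (range (fun p : nat * Y => f p.1 p.2))).
  by move=> m [i _ [y _ <-]]; exists (i, y).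
apply: small_range; apply: (small_prod Knat) => //; exact: (small_countType Knat).
Qed.

Lemma rng_mono Y (f : nat -> Y -> M) (P Q : set nat) : P `<=` Q -> rng f P `<=` rng f Q.
Proof. by move=> PQ m [i Pi fm]; exists i => //; exact: PQ. Qed.

(** Each term after t is non-dividing over its predecessors, so [kdiv_extend] adds these terms to
    the base one by one. *)
Lemma kdiv_chain A N X Y (f : nat -> Y -> M) t k (S : set (X -> M)) :
  small K A -> small K [set: Y] -> (t < N)%N ->
  (forall t', (t < t' < N)%N -> ndiv A (f t') (A `|` rng f [set i | (i < t')%N])) ->
  Def (A `|` rng f [set i | (i <= t)%N]) S ->
  kdiv k (A `|` rng f [set i | (i < t)%N]) S ->
  kdiv k (A `|` rng f [set i | (i < N)%N && (i != t)]) S.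
Proof.
move=> sA sY tN fi dS kS.
suff H n : (t < n <= N)%N -> kdiv k (A `|` rng f [set i | (i < n)%N && (i != t)]) S.
  by apply: H; rewrite tN leqnn.
elim: n => // n IH /andP[]; rewrite ltnS leq_eqVlt => /orP[/eqP <- _|tn nN].
  apply: kdiv_base kS; apply: setUS; apply: rng_mono => i /= /andP[].
  by rewrite ltnS leq_eqVlt => /orP[/eqP -> /eqP|].
have {}IH : kdiv k (A `|` rng f [set i | (i < n)%N && (i != t)]) S.
  by apply: IH; rewrite tn ltnW.
have sD : small K (A `|` rng f [set i | (i < n)%N]).
  by apply: (small_setU Knat) => //; exact: small_rng.
have AD : A `|` rng f [set i | (i < n)%N && (i != t)] `<=` A `|` rng f [set i | (i < n)%N].
  by apply: setUS; apply: rng_mono => i /= /andP[].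
have fD : ndiv (A `|` rng f [set i | (i < n)%N && (i != t)]) (f n)
    (A `|` rng f [set i | (i < n)%N]).
  by apply: ndiv_base (fi n _); [exact: subsetUl|rewrite tn].
have dS' : Def (A `|` rng f [set i | (i < n)%N]) S.
  apply: Def_mono dS; apply: setUS; apply: rng_mono => i /= it.
  exact: leq_ltn_trans it tn.
apply: kdiv_base (kdiv_extend Knat Msat Mhom sY sD AD fD dS' IH).
move=> m [Am|[i /= /andP[iN it] fm]]; first by left; left.
move: iN; rewrite ltnS leq_eqVlt => /orP[/eqP i_n|iN].
  by right; rewrite -i_n.
by left; right; exists i => //=; rewrite iN.
Qed.

Lemma ultraP (T : Type) (q : set (set T)) :
  ProperFilter q -> (forall W, q W \/ q (~` W)) -> UltraFilter q.
Proof.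
move=> qF qC; split=> // G GF qG; apply/seteqP; split=> W; last exact: qG.
move=> GW; have [//|/qG GnW] := qC W.
by have [x []] := filter_ex (filterI GW GnW).
Qed.

Lemma ultra_fmap (T U : Type) (f : T -> U) (q : set (set T)) :
  UltraFilter q -> UltraFilter (fmap f q).
Proof.
move=> qU; apply: (@ultraP _ (fmap f q)) => W.
exact: (in_ultra_setVsetC (f @^-1` W) qU).
Qed.

Lemma free_ultrafilter : exists U : set (set nat),
  UltraFilter U /\ forall m, U [set n | (m <= n)%N].
Proof.
have [|U [UU FU]] := @fip_ultra nat [set W | exists m, W = [set n | (m <= n)%N]].
  move=> n W /choice[m mE]; exists (\max_i m i) => i; rewrite mE /=.
  exact: leq_bigmax.
by exists U; split=> // m; apply: FU; exists m.
Qed.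

(** Ultrafilters on the set of all tuples play the part of global types. *)
Definition realises Y (q : set (set (Y -> M))) C (c : Y -> M) : Prop :=
  forall W, Def C W -> q W -> W c.

Definition invariant_over B Y (q : set (set (Y -> M))) : Prop :=
  forall (t : aut B) W, q W -> q (act t W).

Lemma realises_exists Y (q : set (set (Y -> M))) C : UltraFilter q ->
  small K [set: Y] -> small K C -> exists c, realises q C c.
Proof.
move=> qU sY sC.
have [||c cF] := @realize _ _ _ Knat Msat Y C [set W | Def C W /\ q W] sY sC.
- by move=> W [].
- move=> n W WF; have qW : q [set x | forall i, W i x].
    by apply: filter_ord => i; have [] := WF i.
  by have [x Wx] := filter_ex qW; exists x.
- by exists c => W dW qW; apply: cF.
Qed.

Lemma realises_sub Y (q : set (set (Y -> M))) C C' c :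
  C' `<=` C -> realises q C c -> realises q C' c.
Proof. by move=> CC h W dW; apply: h; exact: Def_mono dW. Qed.

Lemma realises_q Y (q : set (set (Y -> M))) C c W : UltraFilter q ->
  realises q C c -> Def C W -> W c -> q W.
Proof.
move=> qU h dW Wc; have [//|qnW] := in_ultra_setVsetC W qU.
by have := h _ (Def_compl dW) qnW.
Qed.

Lemma realises_act B Y (q : set (set (Y -> M))) C c (t : aut B) :
  invariant_over B q -> realises q C c -> realises q (t @` C) (t \o c).
Proof.
move=> qB h W dW qW; have := h (act (aut_inv t) W); apply; last exact: qB.
apply: Def_mono (Def_act (aut_inv t) dW) => _ [_ [d Dd <-] <-] /=.
by rewrite afK.
Qed.

Lemma realises_unique Y (q q' : set (set (Y -> M))) C c c' :
  UltraFilter q -> small K [set: Y] -> small K C ->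
  (forall W, Def C W -> q W -> q' W) ->
  realises q C c -> realises q' C c' -> exists t : aut C, t \o c = c'.
Proof.
move=> qU sY sC qq h h'; apply: (homogeneity Knat Mhom) => // S dS Sc.
by apply: h' => //; apply: qq => //; exact: realises_q h dS Sc.
Qed.

Definition Morley_in B Y (q : set (set (Y -> M))) (n : nat) (c : nat -> Y -> M) : Prop :=
  forall i, (i < n)%N -> realises q (B `|` rng c [set j | (j < i)%N]) (c i).

Lemma Morley_in_exists B Y (q : set (set (Y -> M))) : UltraFilter q ->
  small K [set: Y] -> small K B -> exists c, forall n, Morley_in B q n c.
Proof.
move=> qU sY sB.
have [s|c cP] := @choose_sequence _ (fun s c => realises q
   (B `|` \bigcup_(i in [set i | (i < size s)%N]) range (nth c s i)) c).
  have [m0] := dom_inhabited M.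
  have [|c cR] := realises_exists (C := B `|` rng (nth (fun=> m0) s) [set i | (i < size s)%N]) qU sY.
    by apply: (small_setU Knat) => //; exact: small_rng.
  exists c; apply: realises_sub cR; apply: setUS => m [i /= si mi].
  by exists i => //; rewrite (set_nth_default c).
exists c => n i _; apply: realises_sub (cP i); apply: setUS => m [j /= ji mj].
by exists j; rewrite /= ?size_mkseq // nth_mkseq.
Qed.

Lemma Morley_in_unique B Y (q : set (set (Y -> M))) n c c' : UltraFilter q ->
  invariant_over B q -> small K [set: Y] -> small K B ->
  Morley_in B q n c -> Morley_in B q n c' ->
  exists t : aut B, forall i, (i < n)%N -> t \o c i = c' i.
Proof.
move=> qU qB sY sB; elim: n => [|n IH] cM cM'; first by exists (aut_id B).
have [t tE] : exists t : aut B, forall i, (i < n)%N -> t \o c i = c' i.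
  by apply: IH => i ni; [apply: cM|apply: cM']; exact: ltnW.
pose C := B `|` rng c' [set j | (j < n)%N].
have sC : small K C by apply: (small_setU Knat) => //; exact: small_rng.
have h : realises q C (t \o c n).
  have h0 := @realises_act B Y q _ _ t qB (cM n (ltnSn n)).
  apply: realises_sub h0.
  move=> m [Bm|[j /= jn [y _ <-]]]; first by exists m; [left|rewrite af_fix].
  by exists (c j y); [right; exists j => //; exists y|rewrite -tE].
have [u uE] := realises_unique qU sY sC (fun _ _ x => x) h (cM' n (ltnSn n)).
exists (aut_comp (aut_sub (@subsetUl _ _ _) u) t) => i.
rewrite ltnS leq_eqVlt => /orP[/eqP ->|ni]; first exact: uE.
rewrite -[RHS](tE i ni); apply: funext => y /=.
apply: (af_fix u); right; exists i => //=; exists y => //.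
by rewrite -tE.
Qed.

Lemma Morley_in_subseq B Y (q : set (set (Y -> M))) N n (s : nat -> nat) c :
  (forall i j, (i < j)%N -> (j < n)%N -> (s i < s j)%N) ->
  (forall i, (i < n)%N -> (s i < N)%N) ->
  Morley_in B q N c -> Morley_in B q n (c \o s).
Proof.
move=> sinc sN cM i ni; apply: realises_sub (cM _ (sN _ ni)).
apply: setUS => m [j /= ji cm]; exists (s j) => //=.
exact: sinc.
Qed.

End Independence.

(** * Resilience *)

Section Resilience.
Context (L : language) (K : Type) (M : structure L).
Hypothesis Knat : small K [set: nat].
Hypothesis Msat : saturated K M.
Hypothesis Mhom : strongly_homogeneous K M.
Implicit Types (A B C D E : set M) (X Y Z : Type).

Definition subtuple Y n (f : nat -> Y -> M) (s : 'I_n -> nat) : 'I_n * Y -> M :=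
  fun z => f (s z.1) z.2.

Section Bound.
Context (X Y : Type) (k : nat) (R : set (X + Y -> M)).
Hypothesis sY : small K [set: Y].
Hypothesis dR : Def set0 R.

(** A finite approximation to a failure of resilience, uniform in k. *)
Definition spread N (f : nat -> Y -> M) : Prop :=
  (forall t, (t < N)%N ->
     kdiv k (rng f [set i | (i < N)%N && (i != t)]) [set x | R (join x (f t))]) /\
  exists x, forall t, (t < N)%N -> R (join x (f t)).

(** The properties that a limit of spreads inherits. The injections [s] are arbitrary because the
    definition of a spread is symmetric in its terms. *)
Definition valid n (P : set ('I_n * Y -> M)) : Prop :=
  forall N f, spread N f -> forall s : 'I_n -> nat, injective s ->
    (forall i, (s i < N)%N) -> P (subtuple f s).

Hypothesis spreads : forall N, exists f, spread N f.

Lemma valid_sequence : exists v : nat -> Y -> M,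
  forall n (P : set ('I_n * Y -> M)), Def set0 P -> valid P ->
  forall s : 'I_n -> nat, injective s -> P (subtuple v s).
Proof.
pose V := (nat * Y)%type.
have sV : small K [set: V] by apply: (small_prod Knat) => //; exact: (small_countType Knat).
pose F : set (set (V -> M)) := [set W | exists n (P : set ('I_n * Y -> M)) s,
  [/\ Def set0 P, valid P, injective s & W = [set v : V -> M | P (fun z => v (s z.1, z.2))]]].
have s0 : small K (@set0 M) by apply: (small_finite Knat); exact: finite_set0.
have [v vF] : exists v, forall W, F W -> W v.
  apply: (realize Knat Msat sV s0).
    move=> W [n [P [s [dP _ _ ->]]]].
    exact: (Def_reindex (fun z : 'I_n * Y => (s z.1, z.2)) dP).
  move=> n W WF.
  have /choice[N NW] : forall i, exists N, forall f N', (N <= N')%N -> spread N' f ->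
      W i (fun z => f z.1 z.2).
    move=> i; have [m [P [s [dP vP sinj ->]]]] := WF i.
    exists (\max_i s i).+1 => f N' NN' fs; apply: (vP N' f fs s) => // j.
    by apply: leq_trans NN'; rewrite ltnS; exact: leq_bigmax.
  have [f fs] := spreads (\max_i N i); exists (fun z => f z.1 z.2) => i.
  by apply: (NW i f _ _ fs); exact: leq_bigmax.
exists (fun n y => v (n, y)) => n P dP vP s sinj.
by apply: (vF [set v : V -> M | P (fun z => v (s z.1, z.2))]); exists n, P, s.
Qed.

(* A Morley sequence of an ultrafilter limit q of the terms of v is           *)
(* indiscernible, which replaces Ramsey's theorem. A property of the tuples   *)
(* of distinct terms of v passes to it by replacing its terms, from the last  *)
(* one on, by terms of v: each time the negation would belong to q.           *)
Lemma indiscernible_sequence : exists c : nat -> Y -> M,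
  (forall n (P : set ('I_n * Y -> M)), Def set0 P -> valid P ->
     P (subtuple c val)) /\
  (forall n (P : set ('I_n * Y -> M)) (s : 'I_n -> nat), Def set0 P ->
     (forall i j : 'I_n, (i < j)%N -> (s i < s j)%N) ->
     P (subtuple c val) <-> P (subtuple c s)).
Proof.
have [v vP] := valid_sequence.
have [U [UU Uinf]] := free_ultrafilter.
pose q : set (set (Y -> M)) := fmap v U.
have qU : UltraFilter q by exact: ultra_fmap.
pose B := rng v setT.
have sB : small K B by exact: small_rng.
have qB : invariant_over B q.
  move=> t W; rewrite /q /fmap /=; congr U; apply: funext => n; rewrite /act /=.
  congr W; apply: funext => y /=; have : B (v n y) by exists n => //; exists y.
  by move=> /(af_fix t) h; apply: (can_inj (afK t)); rewrite agK.
have [c cM] := Morley_in_exists Knat Msat qU sY sB.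
exists c; split=> [n P dP vdP|n P s dP sinc].
  pose mix m (e : 'I_n -> nat) : 'I_n * Y -> M := fun z =>
    if (z.1 < m)%N then c z.1 z.2 else v (e z.1) z.2.
  suff H m : (m <= n)%N -> forall e, injective e -> P (mix m e).
    have := H n (leqnn n) val val_inj; congr P; apply: funext => z.
    by rewrite /mix ltn_ord.
  elim: m => [|m IH] mn e einj.
    have := vP n P dP vdP e einj; congr P.
  pose i0 := Ordinal mn.
  apply: contrapT => nP.
  pose g (z : 'I_n * Y) : Y + 'I_n * Y := if z.1 == i0 then inl z.2 else inr z.
  pose W := [set y : Y -> M | ~ P (join y (mix m e) \o g)].
  have dW : Def (B `|` rng c [set j | (j < m)%N]) W.
    apply: Def_compl.
    apply: Def_relation (Def_reindex g dP) _ => _ [[i y] _ <-] /=.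
    rewrite /mix /=; case: ifP => im; last by left; exists (e i) => //; exists y.
    by right; exists i => //; exists y.
  have Wc : W (c m).
    rewrite /W /=; congr (~ P _): nP; apply: funext => -[i y].
    rewrite /mix /g /=; case: eqP => [->|/eqP ii0] /=; first by rewrite ltnSn.
    by rewrite ltnS leq_eqVlt (negbTE (ii0 : val i != m)).
  have qW : q W by apply: (realises_q qU _ dW Wc); exact: (cM m.+1 m (ltnSn m)).
  have [t [Wt te]] := filter_ex (filterI (qW : U (v @^-1` W)) (Uinf (\max_i e i).+1)).
  (* The index t exceeds all values of [e], so inserting it at place m keeps the indices
     distinct. *)
  apply: Wt; pose e' i := if i == i0 then t else e i.
  have einj' : injective e'.
    have et i : (e i < t)%N by apply: leq_trans te; rewrite ltnS; exact: leq_bigmax.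
    move=> i j; rewrite /e'; case: eqP => [->|_]; case: eqP => [->|_] //.
    - by move=> tj; have := et j; rewrite -tj ltnn.
    - by move=> tj; have := et i; rewrite tj ltnn.
    - exact: einj.
  have := IH (ltnW mn) e' einj'; congr P; apply: funext => -[i y].
  rewrite /mix /g /e' /=; case: eqP => [->|//] /=.
  by rewrite ltnn.
pose s' i := if insub i is Some j then s j else 0.
have s'E i (ni : (i < n)%N) : s' i = s (Ordinal ni) by rewrite /s' insubT.
have cM' : Morley_in B q n (c \o s').
  apply: (Morley_in_subseq (N := (\max_i s i).+1)) (cM _).
    by move=> i j ij jn; rewrite !s'E; [exact: ltn_trans ij jn|move=> ?; exact: sinc].
  by move=> i ni; rewrite s'E ltnS; exact: leq_bigmax.
have [t tE] := Morley_in_unique Knat Mhom qU qB sY sB (cM n) cM'.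
rewrite -(Def_aut (aut_sub (@sub0set _ _) t) _ dP).
suff -> : aut_sub (@sub0set _ B) t \o subtuple c val = subtuple c s by [].
apply: funext => -[i y]; have := congr1 (@^~ y) (tE i (ltn_ord i)).
by rewrite /subtuple /= s'E => ->; congr (c (s _) _); exact: val_inj.
Qed.

End Bound.

(** X has no bound on its size, while [realize] requires a small set of variables. *)
Lemma spread_finite X Y k (R : set (X + Y -> M)) : Def set0 R ->
  exists n (R' : set ('I_n + Y -> M)), Def set0 R' /\
    forall N f, spread k R N f -> spread k R' N f.
Proof.
move=> dR; have [n [r [h hE]]] := finite_variables dR.
pose g (z : X + Y) : 'I_n + Y := match z with inl x => inl (r x) | inr y => inr y end.
have gE x v : join x v \o g = join (x \o r) v by apply: funext => -[].
exists n, [set w : 'I_n + Y -> M | R (w \o g)]; split; first exact: Def_reindex.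
move=> N f [fk [x xR]]; split.
  move=> t tN; have := kdiv_pullback r (fk t tN); apply: kdiv_sub => x' /=.
  by rewrite gE.
by exists (h x) => t tN; rewrite /= gE -hE; exact: xR.
Qed.

(** Identifies the integers from -m to m with the indices below 2m+1. *)
Definition shift (m : nat) (z : int) : nat := `|(z + Posz m)%R|%N.

Lemma shift_ltn m (z z' : int) : (`|z| <= m)%N -> (z < z')%R ->
  (shift m z < shift m z')%N.
Proof. rewrite /shift; lia. Qed.

Lemma shift_neq m (z : int) : (`|z| <= m)%N -> z <> 0%R -> shift m z <> m.
Proof. rewrite /shift; lia. Qed.

Lemma shift0 m : shift m 0%R = m.
Proof. rewrite /shift; lia. Qed.

Lemma shift_bound m (z : int) : (`|z| <= m)%N -> (shift m z < (m + m).+1)%N.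
Proof. rewrite /shift; lia. Qed.

Lemma shiftK m (z : int) : (`|z| <= m)%N -> (Posz (shift m z) - Posz m)%R = z.
Proof. rewrite /shift; lia. Qed.

(** Stretches the indiscernible limit of spreads to a sequence w over the integers, together with
    realisations u_i of the type of w_0 over the other terms on which R is k-inconsistent. These u_i
    witness dividing. *)
Lemma int_sequence X Y k (R : set (X + Y -> M)) :
  small K [set: Y] -> Def set0 R -> (forall N, exists f, spread k R N f) ->
  exists (w : int -> Y -> M) (u : nat -> Y -> M),
  [/\ indiscernible set0 w,
      forall m, exists x, forall z : int, (`|z| <= m)%N -> R (join x (w z)),
      forall n (Q : set ('I_n * Y + Y -> M)) (s : 'I_n -> int) i, Def set0 Q ->
        (forall j, s j <> 0%R) ->
        Q (join (fun z => w (s z.1) z.2) (w 0%R)) ->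
        Q (join (fun z => w (s z.1) z.2) (u i))
    & forall s : 'I_k -> nat, injective s ->
        ~ exists x, forall j, R (join x (u (s j)))].
Proof.
move=> sY dR spreads.
have [c [cvalid cind]] := indiscernible_sequence sY spreads.
pose V := (int * Y + nat * Y)%type.
have sV : small K [set: V].
  by apply: (small_sum Knat); apply: (small_prod Knat) => //; exact: (small_countType Knat).
have s0 : small K (@set0 M) by apply: (small_finite Knat); exact: finite_set0.
pose wof (v : V -> M) : int -> Y -> M := fun z y => v (inl (z, y)).
pose uof (v : V -> M) : nat -> Y -> M := fun n y => v (inr (n, y)).
pose F1 : set (set (V -> M)) := [set W | exists n (P : set ('I_n * Y -> M)) (s : 'I_n -> int),
  [/\ Def set0 P, forall i j : 'I_n, (i < j)%N -> (s i < s j)%R, P (subtuple c val) &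
  W = [set v : V -> M | P (fun z => wof v (s z.1) z.2)]]].
pose F2 : set (set (V -> M)) := [set W | exists n (Q : set ('I_n * Y + Y -> M)) (s : 'I_n -> int) i,
  [/\ Def set0 Q, forall j, s j <> 0%R &
  W = [set v : V -> M | Q (join (fun z => wof v (s z.1) z.2) (wof v 0%R)) ->
    Q (join (fun z => wof v (s z.1) z.2) (uof v i))]]].
pose F3 : set (set (V -> M)) := [set W | exists s : 'I_k -> nat, injective s /\
  W = [set v : V -> M | ~ exists x, forall j, R (join x (uof v (s j)))]].
have dF2 n (Q : set ('I_n * Y + Y -> M)) (s : 'I_n -> int) i : Def set0 Q ->
    Def set0 [set v : V -> M | Q (join (fun z => wof v (s z.1) z.2) (uof v i))].
  move=> dQ; pose g (z : 'I_n * Y + Y) : V := match z with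
    | inl z => inl (s z.1, z.2) | inr y => inr (i, y) end.
  apply: Def_iff (Def_reindex g dQ) => v; split; congr Q; by apply: funext => -[].
have dF3 (s : 'I_k -> nat) : Def set0 [set v : V -> M | ~ exists x, forall j, R (join x (uof v (s j)))].
  exact: (Def_reindex (inr : nat * Y -> V) (Def_inconsistent s dR)).
have [v vF] : exists v, forall W, (F1 `|` F2 `|` F3) W -> W v.
  apply: (realize Knat Msat sV s0).
    move=> W [[[n [P [s [dP _ _ ->]]]]|[n [Q [s [i [dQ _ ->]]]]]]|[s [_ ->]]].
    - exact: (Def_reindex (fun z : 'I_n * Y => inl (s z.1, z.2) : V) dP).
    - apply: Def_imp (dF2 _ _ _ _ dQ).
      pose g (z : 'I_n * Y + Y) : V := match z with
        | inl z => inl (s z.1, z.2) | inr y => inl (0%R, y) end.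
      apply: Def_iff (Def_reindex g dQ) => v; split; congr Q; by apply: funext => -[].
    - exact: dF3.
  move=> n W WF.
  pose kinc (u : nat * Y -> M) := forall s : 'I_k -> nat, injective s ->
    ~ exists x, forall j, R (join x (fun y => u (s j, y))).
  (* Each requirement is cut down to a window of 2m+1 terms: H holds in c, and C links the window to
     u. C follows from H once the u_j are conjugates of the middle term over the other terms and R
     is k-inconsistent on them. *)
  have /choice[N NW] : forall i, exists N, forall m, (N <= m)%N ->
    exists (H : set ('I_(m + m).+1 * Y -> M)) (C : set ('I_(m + m).+1 * Y + nat * Y -> M)),
    [/\ Def set0 H /\ Def set0 C, H (subtuple c val),
      forall a (b : set M) u, H a ->
        (forall l y, nat_of_ord l <> m -> b (a (l, y))) ->
        (forall j, exists t : aut b, forall y, t (a (inord m, y)) = u (j, y)) ->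
        kinc u -> C (join a u)
      & forall v : V -> M, (forall z y, (`|z| <= m)%N -> v (inl (z, y)) = c (shift m z) y) ->
        C (join (subtuple c val) (v \o inr)) -> W i v].
    move=> i; case: (WF i) => [[[l [P [s [dP sinc Pc ->]]]]|[l [Q [s [i0 [dQ s_neq ->]]]]]]|[s [sinj ->]]].
    - exists (\max_j `|s j|%N) => m Nm; exists setT, setT.
      split=> //; first by split; exact: Def_setT.
      move=> v vE _ /=.
      have sm j : (`|s j| <= m)%N by apply: leq_trans Nm; exact: (leq_bigmax j).
      have := (cind l P (fun j => shift m (s j)) dP _).1 Pc.
      rewrite (_ : (fun z => _) = subtuple c (fun j => shift m (s j))).
        by apply=> j j' jj; apply: shift_ltn => //; exact: sinc.
      by apply: funext => -[j y]; rewrite /wof vE.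
    - exists (\max_j `|s j|%N) => m Nm.
      have sm j : (`|s j| <= m)%N by apply: leq_trans Nm; exact: (leq_bigmax j).
      pose h (z : 'I_l * Y + Y) : 'I_(m + m).+1 * Y := match z with
        | inl z => (inord (shift m (s z.1)), z.2) | inr y => (inord m, y) end.
      pose h' (z : 'I_l * Y + Y) : 'I_(m + m).+1 * Y + nat * Y := match z with
        | inl z => inl (inord (shift m (s z.1)), z.2) | inr y => inr (i0, y) end.
      have cE v : (forall z y, (`|z| <= m)%N -> v (inl (z, y)) = c (shift m z) y) ->
          join (fun z => wof v (s z.1) z.2) (wof v 0%R) = subtuple c val \o h.
        move=> vE; apply: funext => -[[j y]|y] /=; rewrite /wof vE //= /subtuple /=.
          by rewrite inordK //; exact: shift_bound.
        by rewrite shift0 inordK // ltnS leq_addr.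
      have [Qc|nQc] := pselect (Q (subtuple c val \o h)); last first.
        exists setT, setT; split=> //; first by split; exact: Def_setT.
        by move=> v vE _ /=; rewrite cE.
      exists [set a : 'I_(m + m).+1 * Y -> M | Q (a \o h)],
        [set a : 'I_(m + m).+1 * Y + nat * Y -> M | Q (a \o h')].
      split=> //; first by split; exact: Def_reindex.
      + move=> a b u Ha ab tu _; have [t tE] := tu i0.
        have := (Def_aut (aut_sub (@sub0set _ b) t) _ dQ).2 Ha; congr Q.
        apply: funext => -[[j y]|y] /=; last exact: tE.
        apply: af_fix; apply: ab; rewrite inordK; last exact: shift_bound.
        by apply: shift_neq.
      + move=> v vE /= QC _; congr Q: QC.
        apply: funext => -[[j y]|y] //=.
        by rewrite /wof vE // /subtuple /= inordK //; exact: shift_bound.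
    - exists 0 => m _.
      exists setT, [set a : 'I_(m + m).+1 * Y + nat * Y -> M | ~ exists x, forall j, R (join x (fun y => a (inr (s j, y))))].
      split=> //; first split; first exact: Def_setT.
      + exact: (Def_reindex (inr : nat * Y -> 'I_(m + m).+1 * Y + nat * Y) (Def_inconsistent s dR)).
      + by move=> a b u _ _ _; apply.
  pose m := \max_i N i.
  have /choice[H /choice[C HC]] := fun i => NW i m (leq_bigmax i).
  pose Ps := [set a : 'I_(m + m).+1 * Y -> M | (forall i, H i a) ->
    exists u : nat * Y -> M, forall i, C i (join a u)].
  have m_lt : (m < (m + m).+1)%N by rewrite ltnS leq_addr.
  have dPs : Def set0 Ps.
    apply: Def_imp; first by apply: Def_forall => i; have [[]] := HC i.
    pose g (z : 'I_(m + m).+1 * Y + nat * Y) : nat * Y + 'I_(m + m).+1 * Y :=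
      match z with inl z => inr z | inr z => inl z end.
    have gE a u : join u a \o g = join a u :> (_ -> M) by apply: funext => -[].
    have dC i : Def set0 [set w : nat * Y + 'I_(m + m).+1 * Y -> M | C i (w \o g)].
      by apply: Def_reindex; have [[]] := HC i.
    apply: Def_iff (Def_existsX (Def_forall dC)) => a.
    by split=> -[u uC]; exists u => i; have := uC i; rewrite /= gE.
  (* In a spread such conjugates exist, as R at the middle term k-divides over the other terms. So
     the existence of u is a valid property and passes to c. *)
  have vPs : valid k R Ps.
    move=> N' f fs s sinj sN Ha.
    have [t tk] := fs.1 _ (sN (inord m)).
    exists (fun p => t p.1 (f (s (inord m)) p.2)) => i.
    have [_ _ hC _] := HC i; apply: (hC (subtuple f s) (rng f [set l | (l < N')%N && (l != s (inord m))]) _ (Ha i)).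
    - move=> l y lm; exists (s l); last by exists y.
      rewrite /= sN /=; apply/eqP => /sinj lE; apply: lm.
      by rewrite lE inordK.
    - by move=> j; exists (t j).
    - move=> s1 s1inj [x xR]; apply: (tk s1 s1inj); exists x => j.
      by rewrite (act_relation _ _ dR); [exact: xR|exact: sub0set].
  have [|u uC] := cvalid _ Ps dPs vPs; first by move=> i; have [] := HC i.
  exists (fun z : V => match z with inl p => c (shift m p.1) p.2 | inr p => u p end) => i.
  by have [_ _ _] := HC i; apply; last exact: uC.
exists (wof v), (uof v); split.
- move=> n s t sinc tinc.
  have h (s' : 'I_n -> int) S : Def set0 S -> {homo s' : i j / (i < j)%N >-> (i < j)%O} ->
      S (subtuple c val) -> S (fun z => wof v (s' z.1) z.2).
    move=> dS s'inc Sc; apply: (vF [set v : V -> M | S (fun z => wof v (s' z.1) z.2)]).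
    by left; left; exists n, S, s'.
  apply/tpP => S dS Sv; apply: (h t S dS tinc); apply: contrapT => nSc.
  exact: (h s (~` S) (Def_compl dS) sinc nSc).
- move=> m; pose T := (m + m).+1.
  pose P := [set a : 'I_T * Y -> M | exists x, forall l, R (join x (fun y => a (l, y)))].
  have dP : Def set0 P.
    pose g l (z : X + Y) : X + 'I_T * Y := match z with inl x => inl x | inr y => inr (l, y) end.
    apply: Def_iff (Def_existsX (Def_forall (fun l => Def_reindex (g l) dR))) => a.
    split=> -[x xR]; exists x => l; have := xR l; congr R; by apply: funext => -[].
  have Pc : P (subtuple c val).
    by apply: cvalid => // N f [_ [x xR]] s _ sN; exists x => l; exact: (xR _ (sN l)).
  have : P (fun z => wof v (Posz (val z.1) - Posz m)%R z.2).
    apply: (vF [set v : V -> M | P (fun z => wof v (Posz (val z.1) - Posz m)%R z.2)]).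
    left; left; exists T, P, (fun i => (Posz (val i) - Posz m)%R); split=> // i j ij.
    by rewrite Num.Theory.ltrD2r.
  move=> [x xR]; exists x => z zm; have := xR (inord (shift m z)).
  by rewrite /= inordK ?shiftK //; exact: shift_bound.
- move=> n Q s i dQ s_neq; apply: (vF [set v : V -> M |
    Q (join (fun z => wof v (s z.1) z.2) (wof v 0%R)) ->
    Q (join (fun z => wof v (s z.1) z.2) (uof v i))]).
  by left; right; exists n, Q, s, i.
- move=> s sinj; apply: (vF [set v : V -> M | ~ exists x, forall j, R (join x (uof v (s j)))]).
  by right; exists s.
Qed.

(** Arbitrarily long spreads have a limit w in which R(x,w_0) divides over the other terms, while
    compactness realises all R(x,w_i) together. *)
Lemma resilience_bound X Y k (R : set (X + Y -> M)) : resilient M K ->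
  small K [set: Y] -> Def set0 R -> (forall N, exists f, spread k R N f) -> False.
Proof.
move=> Mres sY dR0 spreads0.
have [n [R' [dR sprR]]] := spread_finite k dR0.
have spreads N : exists f, spread k R' N f by have [f /sprR] := spreads0 N; exists f.
have [w [u [wind wcons wu uk]]] := int_sequence sY dR spreads.
have [phi phiE] := Def0_sat dR.
pose C := \bigcup_(i in [set i : int | i != 0%R]) range (w i).
have sw : small K (range (fun p : int * Y => w p.1 p.2)).
  apply: small_range; apply: (small_prod Knat) => //; exact: (small_countType Knat).
apply: (Mres _ _ w phi sY wind).
  exists k, u; split=> [i|s sinj [x xs]]; last first.
    by apply: (uk s sinj); exists x => j; apply/phiE.
  apply/esym/tpP => S dS Sw0.
  have [l [m [mC]]] := Def_finite dS.
  rewrite -[range m]set0U => /Def_unparam[P dP PE].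
  have /choice[s sE] : forall j, exists p : int * Y, p.1 <> 0%R /\ w p.1 p.2 = m j.
    by move=> j; have [z /eqP z0 [y _ wE]] := mC _ (imageT m j); exists (z, y).
  pose g (z : Y + 'I_l) : 'I_l * Y + Y :=
    match z with inl y => inr y | inr j => inl (j, (s j).2) end.
  have gE v : join (fun z : 'I_l * Y => w (s z.1).1 z.2) v \o g = join v m.
    by apply: funext => -[y|j] //=; have [] := sE j.
  apply/PE; rewrite -gE.
  pose Q := [set a : 'I_l * Y + Y -> M | P (a \o g)].
  have := wu l Q (fun j => (s j).1) i (Def_reindex g dP); rewrite /Q /= !gE; apply.
    by move=> j; have [] := sE j.
  exact/PE.
have sn : small K [set: 'I_n] by exact: small_countType.
have [x xF] : exists x, forall W, [set W | exists i, W = [set x | R' (join x (w i))]] W -> W x.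
  apply: (realize Knat Msat sn sw).
    move=> W [i ->]; apply: Def_relation dR _ => _ [y _ <-].
    by exists (i, y).
  move=> r W /choice[i WE].
  have [x xR] := wcons (\max_j `|i j|%N); exists x => j.
  by rewrite WE; apply: xR; exact: (leq_bigmax j).
exists x => i; apply/phiE.
by apply: (xF [set x | R' (join x (w i))]); exists i.
Qed.

End Resilience.

(** * Forking implies quasi-dividing *)

Section QuasiDividing.
Context (L : language) (K : Type) (M : structure L).
Hypothesis Knat : small K [set: nat].
Hypothesis Msat : saturated K M.
Hypothesis Mhom : strongly_homogeneous K M.
Implicit Types (A B C D E : set M) (X Y Z : Type).

Definition quasi_divides A X (S : set (X -> M)) : Prop :=
  exists N (s : 'I_N -> aut A), ~ exists x, forall i, act (s i) S x.

(** Translates over B of a member of q belong to q, so any finitely many of them meet. *)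
Lemma realises_ndiv B C Y (q : set (set (Y -> M))) c : UltraFilter q ->
  invariant_over B q -> realises q C c -> ndiv B c C.
Proof.
move=> qU qB cq W dW Wc [k [t tk]]; apply: (tk (fun l => val l)); first exact: val_inj.
have qW := realises_q qU cq dW Wc.
have : q [set x | forall l : 'I_k, act (t (val l)) W x].
  by apply: filter_ord => l; exact: qB.
by move=> /filter_ex[x xW]; exists x.
Qed.

Section Translates.
Variables (A : set M) (X : Type) (S : set (X -> M)).

(** The filter generated by the conjugates of S over A; S quasi-divides exactly when the empty set
    is good. *)
Definition good (W : set (X -> M)) : Prop :=
  exists N (s : 'I_N -> aut A), forall x, (forall i, act (s i) S x) -> W x.

Lemma good_sub W W' : W `<=` W' -> good W -> good W'.
Proof. by move=> WW [N [s sW]]; exists N, s => x /sW/WW. Qed.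

Lemma goodI W W' : good W -> good W' -> good (W `&` W').
Proof.
move=> [N [s sW]] [N' [s' sW']].
exists (N + N'), (fun i => match fintype.split i with inl j => s j | inr j => s' j end).
move=> x h; split; [apply: sW => i; have := h (unsplit (inl i))|
  apply: sW' => i; have := h (unsplit (inr i))]; by rewrite unsplitK.
Qed.

Lemma good_forall N (W : 'I_N -> set (X -> M)) :
  (forall i, good (W i)) -> good [set x | forall i, W i x].
Proof.
elim: N W => [|N IH] W gW; first by exists 0, (fun=> aut_id A) => x _ [].
have := goodI (gW ord0) (IH (fun i => W (lift ord0 i)) (fun i => gW _)).
apply: good_sub => x [W0 h] i.
by case: (unliftP ord0 i) => [j|] ->.
Qed.

Lemma good_act B (t : aut B) W : A `<=` B -> good W -> good (act t W).
Proof.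
move=> AB [N [s sW]]; exists N, (fun i => aut_comp (aut_sub AB t) (s i)) => x h.
by apply: sW => i; exact: h.
Qed.

End Translates.

Section MorleySeq.
Variables (J : Type) (B : set M) (Y : Type) (q : J -> set (set (Y -> M))).
Hypothesis qU : forall j, UltraFilter (q j).
Hypothesis qB : forall j, invariant_over B (q j).
Hypothesis sY : small K [set: Y].

(** A Morley sequence whose invariant type may change from term to term, as listed by [l]. *)
Fixpoint mor (C : set M) (l : seq J) (cs : seq (Y -> M)) : Prop :=
  match l, cs with
  | [::], [::] => True
  | j :: l, c :: cs => realises (q j) C c /\ mor (C `|` range c) l cs
  | _, _ => False
  end.

Fixpoint ranges (cs : seq (Y -> M)) : set M :=
  if cs is c :: cs then range c `|` ranges cs else set0.

Lemma mor_sub C C' l cs : C' `<=` C -> mor C l cs -> mor C' l cs.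
Proof.
elim: l cs C C' => [|j l IH] [|c cs] C C' CC //= [cq cM]; split.
  exact: realises_sub cq.
by apply: IH cM; exact: setSU.
Qed.

Lemma mor_exists l C : small K C -> exists cs, mor C l cs.
Proof.
elim: l C => [|j l IH] C sC; first by exists [::].
have [c cq] := realises_exists Knat Msat (qU j) sY sC.
have [|cs csM] := IH (C `|` range c); last by exists (c :: cs).
by apply: (small_setU Knat) => //; exact: small_range.
Qed.

Lemma mor_cat C l l' cs cs' :
  mor C l cs -> mor (C `|` ranges cs) l' cs' -> mor C (l ++ l') (cs ++ cs').
Proof.
elim: l cs C => [|j l IH] [|c cs] C //=; first by rewrite setU0.
by move=> [cq cM]; rewrite setUA => csM; split=> //; exact: IH.
Qed.

Lemma mor_act C l cs (t : aut B) : mor C l cs -> mor (t @` C) l (map (comp t) cs).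
Proof.
elim: l cs C => [|j l IH] [|c cs] C //= [cq cM]; split.
  exact: (@realises_act _ _ B Y (q j) _ _ t (@qB j) cq).
apply: mor_sub (IH _ _ cM) => m [[x Cx <-]|[y _ <-]].
  by exists x => //; left.
by exists (c y) => //; right; exists y.
Qed.

Lemma mor_unique C l cs cs' : B `<=` C -> small K C ->
  mor C l cs -> mor C l cs' -> exists t : aut C, map (comp t) cs = cs'.
Proof.
elim: l cs cs' C => [|j l IH] [|c cs] [|c' cs'] C BC sC //=.
  by exists (aut_id C).
move=> [cq cM] [cq' cM'].
have [t tE] := realises_unique Knat Mhom (qU j) sY sC (fun _ _ x => x) cq cq'.
have sC' : small K (C `|` range c') by apply: (small_setU Knat) => //; exact: small_range.
have [|//|||u uE] := IH (map (comp t) cs) cs' (C `|` range c').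
- exact: subset_trans BC (@subsetUl _ _ _).
- have := mor_act (aut_sub BC t) cM; apply: mor_sub => m [Cm|[y _ <-]].
    by exists m; [left|exact: (af_fix t)].
  by exists (c y); [right; exists y|rewrite -tE].
- exact: cM'.
exists (aut_comp (aut_sub (@subsetUl _ _ _) u) t) => /=; congr (_ :: _).
  rewrite -{2}tE; apply: funext => y /=; apply: (af_fix u).
  by right; exists y => //; rewrite -tE.
by rewrite -uE -map_comp.
Qed.

Lemma mor_realises C l cs j0 c0 i : mor C l cs -> (i < size l)%N ->
  realises (q (nth j0 l i)) (C `|` rng (nth c0 cs) [set i' | (i' < i)%N]) (nth c0 cs i).
Proof.
elim: l cs C i => [|j l IH] [|c cs] C i //= [cq cM].
case: i => [_|i il] /=.
  by apply: realises_sub cq => m [//|[i' /=]].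
apply: realises_sub (IH _ _ i cM il).
move=> m [Cm|[[|i'] /= ii cm]]; first by left; left.
  by left; right.
by right; exists i'.
Qed.

Lemma mor_size C l cs : mor C l cs -> size cs = size l.
Proof. by elim: l cs C => [|j l IH] [|c cs] C //= [_ /IH ->]. Qed.

End MorleySeq.

(* Replacing the first term of a Morley sequence by a Morley sequence of q_j, *)
(* on which P_j is inconsistent, removes j from the disjunction at the price  *)
(* of more terms; these are then removed one at a time.                       *)
Section Broom.
Variables (A B : set M) (X Y J : Type) (S : set (X -> M)).
Variables (q : J -> set (set (Y -> M))) (P : J -> set (X + Y -> M)).
Hypothesis AB : A `<=` B.
Hypothesis sB : small K B.
Hypothesis sY : small K [set: Y].
Hypothesis qU : forall j, UltraFilter (q j).
Hypothesis qB : forall j, invariant_over B (q j).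
Hypothesis q_agree : forall j j' W, Def B W -> q j W -> q j' W.
Hypothesis dP : forall j, Def set0 (P j).
Hypothesis Pbound : forall j, exists N, forall c, Morley_in B (q j) N c ->
  ~ exists x, forall i, (i < N)%N -> P j (join x (c i)).

Fixpoint instances (js : seq J) (c : Y -> M) : set (X -> M) :=
  if js is j :: js then [set x | P j (join x c)] `|` instances js c else set0.

Fixpoint all_instances (js : seq J) (cs : seq (Y -> M)) : set (X -> M) :=
  if cs is c :: cs then instances js c `|` all_instances js cs else set0.

Lemma act_instances js c (t : aut B) : act t (instances js c) `<=` instances js (t \o c).
Proof.
elim: js => //= j js IH x [Px|/IH]; last by right.
have : act t [set x | P j (join x c)] x by [].
by rewrite (act_relation _ _ (dP j)) //; left.
Qed.

Lemma act_all_instances js cs (t : aut B) :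
  act t (all_instances js cs) `<=` all_instances js (map (comp t) cs).
Proof. by elim: cs => //= c cs IH x [/act_instances|/IH]; [left|right]. Qed.

Lemma broom js l c cs j (Psi : seq (Y -> M) -> set (X -> M)) :
  (forall (t : aut B) cs, act t (Psi cs) `<=` Psi (map (comp t) cs)) ->
  realises (q j) B c -> mor q (B `|` range c) l cs ->
  good A S (instances js c `|` Psi cs) -> good A S (Psi cs).
Proof.
(* Induction on the disjuncts left at c. [Psi] is an arbitrary equivariant family, so that further
   terms can be hidden in it. *)
elim: js l c cs j Psi => [|i js IH] l c cs j Psi Psi_act cq csM.
  by apply: good_sub => x [].
move=> g.
have [N Nbound] := Pbound i.
have [cs0 cs0M] := mor_exists qU sY (nseq N i) sB.
have s_ranges (ds : seq (Y -> M)) : small K (ranges ds).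
  elim: ds => [|d ds IHd] /=; first by apply: (small_finite Knat); exact: finite_set0.
  by apply: (small_setU Knat) => //; exact: small_range.
have [cs' cs'M] := mor_exists qU sY l (small_setU Knat sB (s_ranges cs0)).
have [m0] := dom_inhabited M; pose c0 : Y -> M := fun=> m0.
have sz0 : size cs0 = N by rewrite (mor_size cs0M) size_nseq.
have ranges_nth d (ds : seq (Y -> M)) k : (k < size ds)%N -> range (nth d ds k) `<=` ranges ds.
  elim: ds k => //= e ds IHd [|k] kd m /= em; [by left|right].
  exact: IHd em.
(* The types agree over B, so c can be moved to any term of a Morley sequence [cs0] of q_i, with the
   same continuation [cs'] each time. *)
have moved k : (k < N)%N -> good A S (instances (i :: js) (nth c0 cs0 k) `|` Psi cs').
  move=> kN; set d := nth c0 cs0 k.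
  have dq : realises (q i) B d.
    have := mor_realises (j0 := i) (c0 := c0) (i := k) cs0M; rewrite size_nseq nth_nseq kN.
    by move=> /(_ isT); apply: realises_sub; exact: subsetUl.
  have [t tE] := realises_unique Knat Mhom (qU j) sY sB (@q_agree j i) cq dq.
  have sBd : small K (B `|` range d) by apply: (small_setU Knat) => //; exact: small_range.
  have [||||u uE] := @mor_unique _ B _ q qU qB sY (B `|` range d) l (map (comp t) cs) cs'.
  - exact: subsetUl.
  - exact: sBd.
  - apply: mor_sub (mor_act qB t csM) => m [Bm|[y _ <-]].
      by exists m; [left|exact: (af_fix t)].
    by exists (c y); [right; exists y|rewrite -tE].
  - apply: mor_sub cs'M; apply: setUS; apply: ranges_nth; by rewrite sz0.
  pose w := aut_comp (aut_sub (@subsetUl _ B (range d)) u) t.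
  have wc : w \o c = d.
    rewrite -[RHS]tE; apply: funext => y /=; apply: (af_fix u).
    by right; exists y => //; rewrite -tE.
  have wcs : map (comp w) cs = cs' by rewrite -uE -map_comp.
  apply: good_sub (good_act w AB g) => x [/act_instances|/Psi_act].
    by rewrite wc; left.
  by rewrite wcs; right.
(* Intersecting over k removes the disjunct i, since [Nbound] excludes points satisfying P_i at
   every term of [cs0]. *)
have {}moved : good A S (all_instances js cs0 `|` Psi cs').
  apply: good_sub (good_forall (W := fun k : 'I_N => _) (fun k => moved k (ltn_ord k))).
  move=> x xk; apply: contrapT => nx.
  have nall k : (k < N)%N -> ~ instances js (nth c0 cs0 k) x.
    move=> kN xj; apply: nx; left; move: kN xj; rewrite -sz0.
    elim: (cs0) k => //= d ds IHd [|k] kN xj /=; [by left|right].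
    exact: IHd xj.
  apply: (Nbound (nth c0 cs0)).
    move=> k kN; have := mor_realises (j0 := i) (c0 := c0) (i := k) cs0M.
    by rewrite size_nseq nth_nseq kN; apply.
  exists x => k kN; have [[//|xj]|xPsi] := xk (Ordinal kN).
    by case: (nall _ kN).
  by case: nx; right.
(* The terms of [cs0] now carry only the disjuncts [js]; the induction hypothesis removes them in
   turn, later terms being absorbed in [Psi']. *)
have {}moved : good A S (Psi cs').
  elim: cs0 (nseq N i) cs0M cs'M moved {sz0} => [|d ds IHd] [|e es] //=.
    by move=> _ _; apply: good_sub => x [].
  move=> [dq dsM] cs'M gd.
  apply: (IHd es).
  - by apply: mor_sub dsM; exact: subsetUl.
  - by apply: mor_sub cs'M => m [|]; [left|right; right].
  pose Psi' fs := all_instances js (take (size ds) fs) `|` Psi (drop (size ds) fs).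
  have Psi'E : Psi' (ds ++ cs') = all_instances js ds `|` Psi cs'.
    by rewrite /Psi' take_size_cat // drop_size_cat.
  rewrite -Psi'E; apply: (IH (es ++ l) d (ds ++ cs') e Psi') => //.
  - move=> t fs x; rewrite /Psi' -map_take -map_drop.
    by move=> [/act_all_instances|/Psi_act]; [left|right].
  - by apply: mor_cat => //; rewrite -setUA.
  - by rewrite Psi'E setUA.
have BB : B `<=` B by [].
have [||t tE] := @mor_unique _ B _ q qU qB sY B l cs' cs BB sB.
- by apply: mor_sub cs'M; exact: subsetUl.
- by apply: mor_sub csM; exact: subsetUl.
by apply: good_sub (good_act t AB moved) => x /Psi_act; rewrite tE.
Qed.

End Broom.

End QuasiDividing.

Section ForkingDividing.
Context (L : language) (K : Type) (M : structure L).
Hypothesis Knat : small K [set: nat].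
Hypothesis Msat : saturated K M.
Hypothesis Mhom : strongly_homogeneous K M.
Hypothesis Mres : resilient M K.
Variable A : set M.
Hypothesis sA : small K A.
Hypothesis Abase : extension_base K A.
Implicit Types (B C D E : set M) (X Y Z : Type).

(** By [realises_ndiv] and [kdiv_chain], P(x,c_t) k-divides over all other terms of a Morley
    sequence of q, so a consistent family is a spread. *)
Lemma Morley_bound B X Y k (q : set (set (Y -> M))) (P : set (X + Y -> M)) :
  small K B -> small K [set: Y] -> UltraFilter q -> invariant_over B q -> Def set0 P ->
  (forall C c, B `<=` C -> small K C -> realises q C c -> kdiv k C [set x | P (join x c)]) ->
  exists N, forall c, Morley_in B q N c ->
    ~ exists x, forall i, (i < N)%N -> P (join x (c i)).
Proof.
move=> sB sY qU qB dP Pk; apply: contrapT => /forallNP nN.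
apply: (resilience_bound (k := k) Knat Msat Mhom Mres sY dP) => N.
have /existsNP[c /not_implyP[cM /contrapT cx]] := nN N; exists c; split=> // t tN.
apply: (@kdiv_base _ _ _ _ (B `|` rng c [set i | (i < N)%N && (i != t)])).
  exact: subsetUr.
have sC n : small K (B `|` rng c [set i | (i < n)%N]).
  by apply: (small_setU Knat) => //; exact: small_rng.
apply: (kdiv_chain Knat Msat Mhom sB sY tN).
- by move=> t' /andP[_ t'N]; exact: realises_ndiv qU qB (cM t' t'N).
- by apply: Def_relation => // _ [y _ <-]; right; exists t; [exact: leqnn|exists y].
- by apply: Pk; [exact: subsetUl|exact: sC|exact: cM].
Qed.

Section Rows.
Variables (X : Type) (r n : nat) (m : 'I_n -> M).
Variables (P : 'I_r -> set (X + 'I_n -> M)) (k : 'I_r -> nat).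
Hypothesis dP : forall j, Def set0 (P j).
Hypothesis Pdiv : forall j, kdiv (k j) A [set x | P j (join x m)].

(** Across all rows the entries have one type over B; this makes the limit types q_j agree later. *)
Definition rows B (g : 'I_r -> nat -> aut A) : Prop :=
  (forall j (s : 'I_(k j) -> nat), injective s ->
     ~ exists x, forall l, P j (join x (g j (s l) \o m))) /\
  (forall j i j' i' (W : set ('I_n -> M)), Def B W -> W (g j i \o m) -> W (g j' i' \o m)).

Let sn : small K [set: 'I_n].
Proof. exact: small_countType. Qed.

(** For a conjugate tm of m with tp(B/A,tm) non-dividing over A, [kdiv_extend] makes every P_j(x,tm)
    divide over B; the conjugates of tm over B form the rows. *)
Lemma rows_exist B : small K B -> A `<=` B -> exists g, rows B g.
Proof.
move=> sB AB.
have [t tB] := extension_base_ndiv_set Knat Msat Mhom m Abase sA sB sn.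
have sD : small K (A `|` range (t \o m)).
  by apply: (small_setU Knat) => //; exact: small_range.
have tE j : act t [set x | P j (join x m)] = [set x | P j (join x (t \o m))].
  by apply: act_relation (dP j) _; exact: sub0set.
have h j : kdiv (k j) B [set x | P j (join x (t \o m))].
  apply: (@kdiv_base _ _ _ _ (A `|` range (@set_val _ B))).
    by move=> b Bb; right; exists (elt Bb).
  apply: (kdiv_extend Knat Msat Mhom _ sD (@subsetUl _ _ _) tB).
  - exact: ((small_set_type _ _).1 sB).
  - by apply: Def_relation => //; exact: subsetUr.
  - by rewrite -tE; exact: kdiv_act.
have /choice[u uP] := h.
exists (fun j i => aut_comp (aut_sub AB (u j i)) t); split.
  move=> j s sinj [x xP]; apply: (uP j s sinj); exists x => l.
  by rewrite (act_relation _ _ (dP j)); [exact: xP|exact: sub0set].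
move=> j i j' i' W dW /(Def_aut (u j i) (t \o m) dW) Wt.
exact: (Def_aut (u j' i') (t \o m) dW).2.
Qed.

Definition row_set (g : 'I_r -> nat -> aut A) : set M :=
  range (fun p : 'I_r * nat * 'I_n => g p.1.1 p.1.2 (m p.2)).

Lemma row_sequence : exists G : nat -> 'I_r -> nat -> aut A,
  forall i, rows (A `|` \bigcup_(i' in [set i' | (i' < i)%N]) row_set (G i')) (G i).
Proof.
have small_rows (s : nat -> 'I_r -> nat -> aut A) (I : set nat) :
    small K (A `|` \bigcup_(i in I) row_set (s i)).
  apply: (small_setU Knat) => //.
  apply: (@small_sub _ _ _ (range (fun p : nat * ('I_r * nat * 'I_n) =>
     s p.1 p.2.1.1 p.2.1.2 (m p.2.2)))).
    by move=> _ [i _ [p _ <-]]; exists (i, p).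
  by apply: small_range; exact: small_countType.
pose g0 : 'I_r -> nat -> aut A := fun _ _ => aut_id A.
have [s|G GP] := @choose_sequence _ (fun s g => rows
   (A `|` \bigcup_(i in [set i | (i < size s)%N]) row_set (nth g0 s i)) g).
  by apply: rows_exist; [exact: small_rows|exact: subsetUl].
exists G => i; have [h1 h2] := GP i; split=> // j a j' a' W dW.
apply: h2; apply: Def_mono dW; apply: setUS => x [l /= li xl].
by exists l; rewrite /= ?size_mkseq // nth_mkseq.
Qed.

(* The rows of G i, for growing i, approach types q_j that agree on the union *)
(* B of all rows and are finitely satisfiable there. Terms of a row having    *)
(* the same type over the previous rows, P_j(x,c) divides over C whenever c   *)
(* realises q_j over C, so Morley sequences of q_j fall under resilience.     *)
Lemma rows_quasi_divide : quasi_divides A [set x | exists j, P j (join x m)].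
Proof.
have [r0|[j0]] : r = 0 \/ inhabited 'I_r.
  by case: (r) => [|r']; [left|right; constructor; exact: ord0].
  exists 1, (fun=> aut_id A) => -[x /(_ ord0)[j _]].
  by have := ltn_ord j; rewrite {2}r0.
have [G GP] := row_sequence.
pose Bi i := A `|` \bigcup_(i' in [set i' | (i' < i)%N]) row_set (G i').
pose B := A `|` \bigcup_i row_set (G i).
have AB : A `<=` B by exact: subsetUl.
have BiB i : Bi i `<=` B by apply: setUS => x [l _ xl]; exists l.
have sB : small K B.
  apply: (small_setU Knat) => //.
  apply: (@small_sub _ _ _ (range (fun p : nat * ('I_r * nat * 'I_n) =>
     G p.1 p.2.1.1 p.2.1.2 (m p.2.2)))).
    by move=> _ [i _ [p _ <-]]; exists (i, p).
  by apply: small_range; exact: small_countType.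
have mB i j s : range (G i j s \o m) `<=` B.
  by move=> _ [y _ <-]; right; exists i => //; exists (j, s, y).
have [U [UU Uinf]] := free_ultrafilter.
(* An iterated limit: the inner one, along a row, preserves the inconsistency within that row; the
   outer one, over i, makes the types agree over B. *)
pose q j : set (set ('I_n -> M)) := [set W | U [set i | U [set s | W (G i j s \o m)]]].
have UT (W : set nat) : (forall i, W i) -> U W.
  by move=> WT; rewrite (_ : W = setT); [exact: filterT|apply/seteqP; split].
have US (W W' : set nat) : U W -> (forall i, W i -> W' i) -> U W'.
  by move=> UW WW; exact: (filterS WW).
have qU j : UltraFilter (q j).
  apply: ultraP.
    apply: Build_ProperFilter_ex.
      move=> W qW; have [i Wi] := @filter_ex _ U _ _ qW.
      by have [s Ws] := @filter_ex _ U _ _ Wi; exists (G i j s \o m).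
    split.
    - by apply: (UT) => i; apply: (UT).
    - move=> W W' qW qW'; apply: (US _ _ (filterI (qW : U _) (qW' : U _))) => i [Ui Ui'].
      by apply: (US _ _ (filterI (Ui : U _) (Ui' : U _))).
    - move=> W W' WW' qW; apply: (US _ _ qW) => i Ui; apply: (US _ _ Ui) => s; exact: WW'.
  move=> W; have [|nqW] := pselect (q j W); [by left|right].
  rewrite /q /=; have : U (~` [set i | U [set s | W (G i j s \o m)]]) by apply/ultraC.
  by move=> Un; apply: (US _ _ Un) => i nUi; exact: ((ultraC [set s | W (G i j s \o m)] UU).2 nUi).
have act_fix (t : aut B) i j s : ag t \o (G i j s \o m) = G i j s \o m.
  apply: funext => y /=; apply: (can_inj (afK t)); rewrite agK (af_fix t) //.
  by apply: (mB i j s); exists y.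
have qB j : invariant_over B (q j).
  by move=> t W qW; apply: (US _ _ qW) => i Ui; apply: (US _ _ Ui) => s; rewrite /act /= act_fix.
have q_agree j j' W : Def B W -> q j W -> q j' W.
  move=> dW; have [l [p [pB dpW]]] := Def_finite dW.
  have /choice[b bP] : forall a, exists i, Bi i (p a).
    move=> a; have [Ap|[i _ ip]] := pB _ (imageT p a); first by exists 0; left.
    by exists i.+1; right; exists i => /=.
  move=> qW; apply: (US _ _ (filterI (qW : U _) (Uinf (\max_a b a)))) => i [Ui bi].
  have dWi : Def (Bi i) W.
    apply: Def_mono dpW => _ [a _ <-]; have [Ap|[i' /= i'b ip]] := bP a; first by left.
    right; exists i' => //=; apply: leq_trans i'b _; apply: leq_trans bi.
    exact: leq_bigmax.
  have [s Ws] := @filter_ex _ U _ _ Ui.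
  by apply: UT => s'; have [_ h] := GP i; exact: h dWi Ws.
have qk j C c : B `<=` C -> small K C -> realises (q j) C c ->
    kdiv (k j) C [set x | P j (join x c)].
  move=> BC sC cq.
  pose V := (nat * 'I_n)%type.
  have sV : small K [set: V] by exact: (small_countType Knat).
  pose F1 : set (set (V -> M)) := [set W | exists W' s, [/\ Def C W', q j W' &
    W = [set v : V -> M | W' (fun y => v (s, y))]]].
  pose F2 : set (set (V -> M)) := [set W | exists s : 'I_(k j) -> nat, injective s /\
    W = [set v : V -> M | ~ exists x, forall l, P j (join x (fun y => v (s l, y)))]].
  have [v vF] : exists v, forall W, (F1 `|` F2) W -> W v.
    apply: (realize Knat Msat sV sC).
      move=> W [[W' [s [dW' _ ->]]]|[s [_ ->]]].
        exact: (Def_reindex (fun y => (s, y) : V) dW').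
      exact: Def_mono (@sub0set _ C) (Def_inconsistent s (dP j)).
    move=> N W WF.
    have /choice[W' WP] : forall i, exists W' : set ('I_n -> M), q j W' /\
      forall v : V -> M, (forall s, W' (fun y => v (s, y))) ->
       (forall s : 'I_(k j) -> nat, injective s ->
         ~ exists x, forall l, P j (join x (fun y => v (s l, y)))) -> W i v.
      move=> i; have [[W' [s [_ qW' ->]]]|[s [sinj ->]]] := WF i.
        by exists W'; split=> // v h _; exact: h.
      by exists setT; split; [exact: filterT|move=> v _; apply].
    have : q j [set w | forall i, W' i w] by apply: filter_ord => i; have [] := WP i.
    (* A single row meets the finitely many conditions at infinitely many entries, and these entries
       remain k_j-inconsistent. *)
    move=> qW'; have [i Ui] := @filter_ex _ U _ _ qW'.
    have /infiniteP/card_le_setTP[e [einj eW]] :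
        infinite_set [set s | forall a, W' a (G i j s \o m)].
      move=> /finite_enum[l [h hE]].
      have [s [sW]] := @filter_ex _ U _ _ (filterI (Ui : U _) (Uinf (\max_a h a).+1)).
      have [a _ <-] : range h s by rewrite hE.
      by rewrite /= ltnNge leq_bigmax.
    exists (fun p => G i j (e p.1) (m p.2)) => a; have [_] := WP a; apply.
      by move=> s; exact: (eW s a).
    move=> s sinj [x xP]; have [h _] := GP i; apply: (h j (e \o s)).
      exact: inj_comp.
    by exists x => l; exact: xP.
  have /choice[u uE] : forall s, exists u : aut C, u \o c = (fun y => v (s, y)).
    move=> s; apply: (homogeneity Knat Mhom) => // W dW Wc.
    apply: (vF [set v : V -> M | W (fun y => v (s, y))]); left.
    by exists W, s; split=> //; exact: realises_q cq dW Wc.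
  exists u => s sinj [x xP].
  apply: (vF [set v : V -> M | ~ exists x, forall l, P j (join x (fun y => v (s l, y)))]).
    by right; exists s.
  exists x => l; have := xP l.
  by rewrite (act_relation _ _ (dP j)) ?uE //; exact: sub0set.
have [c cq] := realises_exists Knat Msat (qU j0) sn sB.
have [t tE] : exists t : aut A, t \o m = c.
  apply: (homogeneity Knat Mhom) => // W dW Wm; apply: cq; first exact: Def_mono dW.
  apply: (UT) => i; apply: (UT) => s /=.
  exact/(Def_aut (G i j0 s) _ dW).
have g0 : good A [set x | exists j, P j (join x m)]
   (instances P (enum 'I_r) c `|` set0).
  exists 1, (fun=> t) => x /(_ ord0)[j]; rewrite /act /= => Px; left.
  have {}Px : P j (join x c).
    have /(Def_aut (aut_sub (@sub0set _ _) t) _ (dP j)) := Px.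
    rewrite -tE; congr (P j); apply: funext => -[y|y] //=.
    by rewrite agK.
  have : j \in enum 'I_r by rewrite mem_enum.
  elim: (enum 'I_r) => //= a l IH; rewrite inE => /orP[/eqP <-|/IH]; first by left.
  by right.
have [N [s sN]] := broom Knat Msat Mhom AB sB sn qU qB q_agree dP
  (fun j => Morley_bound sB sn (qU j) (qB j) (dP j) (@qk j))
  (l := [::]) (cs := [::]) (Psi := fun=> set0) (fun _ _ _ h => h) cq I g0.
by exists N, s => -[x /sN].
Qed.

End Rows.

Lemma forks_quasi_divides X (S : set (X -> M)) : forks A S -> quasi_divides A S.
Proof.
move=> [r [T [dT /choice[k kT] ST]]].
have [n [m [_ dm]]] := Def_finite_family dT.
have /choice[P PP] : forall j, exists P : set (X + 'I_n -> M), Def set0 P /\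
    forall x, T j x <-> P (join x m).
  move=> j; have := dm j; rewrite -[range m]set0U => /Def_unparam[P dP PE].
  by exists P.
have [|j|N [s sN]] := @rows_quasi_divide X r n m P k.
- by move=> j; have [] := PP j.
- by apply: kdiv_sub (kT j) => x; have [_ h] := PP j; move=> /h.
exists N, s => -[x xS]; apply: sN; exists x => i.
have [j Tj] := ST _ (xS i); exists j; have [_ h] := PP j; exact/h.
Qed.

End ForkingDividing.

(** * Forking equals dividing *)

Lemma pigeonhole_increasing r (N : 'I_r -> nat) (col : 'I_(\sum_i N i).+1 -> 'I_r) :
  exists i (e : 'I_(N i) -> 'I_(\sum_i N i).+1),
    (forall l l' : 'I_(N i), (l < l')%N -> (e l < e l')%N) /\ forall l, col (e l) = i.
Proof.
set n := (\sum_i N i).+1 in col *.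
pose F i := [seq l <- enum 'I_n | col l == i].
have [i Ni] : exists i, (N i <= size (F i))%N.
  apply: contrapT => /forallNP nN.
  have : (\sum_i size (F i) <= \sum_i N i)%N.
    by apply: leq_sum => i _; rewrite ltnW // ltnNge; exact/negP/nN.
  suff -> : (\sum_i size (F i))%N = n by rewrite ltnn.
  transitivity (\sum_(i < r) \sum_(l < n) (col l == i : nat))%N.
    apply: eq_bigr => i _; rewrite size_filter -sum1_count big_enum_cond /=.
    by rewrite big_mkcond /=; apply: eq_bigr => l _; case: (col l == i).
  rewrite exchange_big /= -[RHS]card_ord -sum1_card; apply: eq_bigr => l _.
  by rewrite (bigD1 (col l)) //= eqxx big1 // => i /negbTE; rewrite eq_sym => ->.
have lN (l : 'I_(N i)) : (l < size (F i))%N by apply: leq_trans Ni.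
have n_gt0 : (0 < n)%N by [].
pose d := Ordinal n_gt0.
have Fsorted : sorted ltn (map val (F i)).
  have : subseq (map val (F i)) (map val (enum 'I_n)) by apply/map_subseq/filter_subseq.
  by move=> /subseq_sorted; apply; [exact: ltn_trans|rewrite val_enum_ord iota_ltn_sorted].
exists i, (fun l => nth d (F i) l); split=> [l l' ll|l].
  have := sorted_ltn_nth ltn_trans 0 Fsorted.
  move=> /(_ l l'); rewrite !inE !size_map !lN => /(_ isT isT ll).
  by rewrite !(nth_map d).
by apply/eqP; have := mem_nth d (lN l); rewrite mem_filter => /andP[].
Qed.

Lemma ord_increasing_inj n m (e : 'I_n -> 'I_m) :
  (forall l l' : 'I_n, (l < l')%N -> (e l < e l')%N) -> injective e.
Proof.
move=> einc l l' ee; apply: val_inj.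
by case: (ltngtP l l') => // /einc; rewrite ee ltnn.
Qed.

Section ForkingIsDividing.
Context (L : language) (K : Type) (M : structure L).
Hypothesis Knat : small K [set: nat].
Hypothesis Msat : saturated K M.
Hypothesis Mhom : strongly_homogeneous K M.
Hypothesis Mres : resilient M K.
Variable A : set M.
Hypothesis sA : small K A.
Hypothesis Abase : extension_base K A.
Implicit Types (B C D E : set M) (X Y Z : Type).

(** Whether P(f,z) divides over A depends only on the type of f over A. *)
Lemma kdiv_second X Y k (f : X -> M) (t : aut A) (P : set (X + Y -> M)) : Def A P ->
  kdiv k A [set z | P (join (t \o f) z)] -> kdiv k A [set z | P (join f z)].
Proof.
move=> dP /(kdiv_act (aut_inv t)); apply: kdiv_sub => z Pz.
rewrite /act /=; have := (Def_aut t _ dP).2 Pz; congr P.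
by apply: funext => -[].
Qed.

(* The forbidden formulas psi(f,y) form a forking formula; it quasi-divides,  *)
(* and a tuple of conjugates of f witnessing this can be moved to be          *)
(* nondividing over D, so some member of it avoids all forbidden formulas.    *)
Lemma strict_conjugate Y (f : Y -> M) D : small K [set: Y] -> small K D -> A `<=` D ->
  exists t : aut A, ndiv A (t \o f) D /\
    ndiv A (@set_val _ D) (A `|` range (t \o f)).
Proof.
move=> sY sD AD; pose delta : D -> M := @set_val _ D.
have deltaD : range delta `<=` D by move=> _ [d _ <-]; exact: set_valP.
have DP (P : set (Y + D -> M)) : Def A P -> Def D [set y | P (join y delta)].
  by move=> dP; apply: Def_mono (Def_param delta dP) => x [/AD|/deltaD].
pose F1 : set (set (Y -> M)) := [set W | Def A W /\ W f].
pose F2 : set (set (Y -> M)) := [set W | exists T, [/\ Def D T, sdiv A T & W = ~` T]].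
pose F3 : set (set (Y -> M)) := [set W | exists P : set (Y + D -> M), [/\ Def A P,
  sdiv A [set z | P (join f z)] & W = ~` [set y | P (join y delta)]]].
have [f' f'F] : exists f', forall W, (F1 `|` F2 `|` F3) W -> W f'.
  apply: (realize Knat Msat sY sD).
    move=> W [[[dW _]|[T [dT _ ->]]]|[P [dP _ ->]]].
    - exact: Def_mono dW.
    - exact: Def_compl.
    - exact/Def_compl/DP.
  move=> n W WF; apply: contrapT => nc.
  have /choice[S /choice[T /choice[P SP]]] : forall i, exists S T (P : set (Y + D -> M)),
    [/\ Def A S /\ S f, Def D T /\ sdiv A T,
        Def A P /\ sdiv A [set z | P (join f z)] &
        forall y, S y -> ~ T y -> ~ P (join y delta) -> W i y].
    move=> i; have [[[dW Wf]|[T [dT sT ->]]]|[P [dP sP ->]]] := WF i.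
    - by exists (W i), set0, set0; split=> //; split; [exact: Def0|exact: sdiv0|exact: Def0|exact: (sdiv0 A)].
    - exists setT, T, set0; split=> //; split=> //; [exact: Def_setT|exact: Def0|exact: (sdiv0 A)].
    - exists setT, set0, P; split=> //; split=> //; [exact: Def_setT|exact: Def0|exact: sdiv0].
  (* This union forks over A by construction, so finitely many of its conjugates have no common
     point. *)
  have [N [s sN]] : quasi_divides A [set z | exists i, P i (join f z)].
    apply: (forks_quasi_divides Knat Msat Mhom Mres sA Abase).
    exists n, (fun i => [set z | P i (join f z)]); split=> // i; have [_ _ [dP sP] _] := SP i => //.
    pose g (z : Y + D) : D + Y := match z with inl y => inr y | inr d => inl d end.
    apply: Def_iff (Def_mono (@subsetT _ _) (Def_param f (Def_reindex g dP))) => z.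
    by split; congr (P i); apply: funext => -[].
  pose g (z : 'I_N * Y) := s z.1 (f z.2).
  have sNY : small K [set: 'I_N * Y].
    by apply: (small_prod Knat) => //; exact: (small_countType Knat).
  (* After the move by u, each conjugate of f avoids the sets T, hence satisfies some P_i with
     [delta]. Then the preimage of [delta] under u is a common point of the conjugates, a
     contradiction. *)
  have [u uD] := extension_base_ndiv Knat Msat Mhom g Abase sNY sD AD.
  apply: sN; exists (ag u \o delta) => l.
  have nW : ~ forall i, W i (u \o (s l \o f)) by move=> h; apply: nc; exists (u \o (s l \o f)).
  have [i /contrapT Pi] : exists i, ~ ~ P i (join (u \o (s l \o f)) delta).
    apply/existsNP => h; apply: nW => i; have [[dS Sf] [dT [k kT]] _ hW] := SP i.
    apply: hW => //; first by apply/(Def_aut u _ dS)/(Def_aut (s l) _ dS).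
    move=> Tu; apply: (uD [set v : 'I_N * Y -> M | T i (v \o (fun y => (l, y)))]) => //.
      exact: Def_reindex.
    by exists k; exact: (kdiv_pullback (fun y => (l, y)) kT).
  exists i; have [_ _ [dP _] _] := SP i.
  apply/(Def_aut (s l) _ dP)/(Def_aut u _ dP); congr (P i _): Pi.
  by apply: funext => -[y|d] //=; rewrite !agK.
have [t tE] : exists t : aut A, t \o f = f'.
  by apply: (homogeneity Knat Mhom) => // S dS Sf; apply: f'F; left; left.
exists t; rewrite tE; split=> W dW Wc [k kW].
  by apply: (f'F (~` W)) Wc; left; right; exists W; split=> //; exists k.
have [P' dP' PE] := Def_unparam dW.
pose g (z : D + Y) : Y + D := match z with inl y => inr y | inr d => inl d end.
pose P := [set w : Y + D -> M | P' (w \o g)].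
have gE y z : join y z \o g = join z y :> (_ -> M) by apply: funext => -[].
apply: (f'F (~` [set y | P (join y delta)])); last by rewrite /P /= gE; exact/PE.
right; exists P; split=> //; first exact: Def_reindex.
exists k; apply: (@kdiv_second _ _ _ _ t) (Def_reindex g dP') _.
by apply: kdiv_sub kW => z; rewrite /= gE tE => /PE.
Qed.

Lemma strict_sequence Y (f : Y -> M) : small K [set: Y] ->
  exists s : nat -> aut A, forall t,
    ndiv A (s t \o f) (A `|` rng (fun i => s i \o f) [set i | (i < t)%N]) /\
    ndiv A (@set_val _ (A `|` rng (fun i => s i \o f) [set i | (i < t)%N]))
      (A `|` range (s t \o f)).
Proof.
move=> sY.
pose D (s : seq (aut A)) := A `|` rng (fun i => nth (aut_id A) s i \o f) [set i | (i < size s)%N].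
have [s|s sP] := @choose_sequence (aut A) (fun s t => ndiv A (t \o f) (D s) /\
    ndiv A (@set_val _ (D s)) (A `|` range (t \o f))).
  apply: strict_conjugate => //; last exact: subsetUl.
  by apply: (small_setU Knat) => //; exact: small_rng.
exists s => t; have := sP t.
suff -> : D (mkseq s t) = A `|` rng (fun i => s i \o f) [set i | (i < t)%N] by [].
apply/seteqP; rewrite /D size_mkseq.
by split; apply: setUS => m [i /= it mi]; exists i => //; move: mi; rewrite nth_mkseq.
Qed.

(** The strictness clause at t brings the earlier terms into the base, and [kdiv_chain] brings in
    the later ones. *)
Lemma kdiv_strict N X Y (f : nat -> Y -> M) t k (S : set (X -> M)) :
  small K [set: Y] -> (t < N)%N ->
  (forall t', (t' < N)%N -> ndiv A (f t') (A `|` rng f [set i | (i < t')%N]) /\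
     ndiv A (@set_val _ (A `|` rng f [set i | (i < t')%N])) (A `|` range (f t'))) ->
  Def (A `|` range (f t)) S -> kdiv k A S ->
  kdiv k (A `|` rng f [set i | (i < N)%N && (i != t)]) S.
Proof.
move=> sY tN fi dS kS.
have sD n : small K (A `|` rng f [set i | (i < n)%N]).
  by apply: (small_setU Knat) => //; exact: small_rng.
have st : small K (A `|` range (f t)) by apply: (small_setU Knat) => //; exact: small_range.
apply: (kdiv_chain Knat Msat Mhom) => //.
- by move=> t' /andP[_ t'N]; have [] := fi t' t'N.
- apply: Def_mono dS => m [Am|fm]; first by left.
  by right; exists t => //=; exact: leqnn.
have [_ ft] := fi t tN.
apply: kdiv_base (kdiv_extend Knat Msat Mhom ((small_set_type _ _).1 (sD t)) st
  (@subsetUl _ _ _) ft dS kS).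
by move=> m mD; right; exists (elt mD).
Qed.

(** Let S be covered by sets T_j dividing over A, with parameters m. Along a strict sequence of
    conjugates of m, no N_j translates of T_j share a point, as they would form a spread. Among 1
    plus the sum of the N_j translates of S, a common point would lie in N_j translates of one T_j;
    so S divides. *)
Lemma ndiv_nonforking X (c : X -> M) E : ndiv A c E ->
  ~ type_forks A (tp c E).
Proof.
move=> cE /(type_forks_tp Knat Mhom _ _ sA)[S [dS Sc [r [T [dT /choice[k kT] ST]]]]].
have [n [m [_ dm]]] := Def_finite_family dT.
have /choice[P PP] : forall j, exists P : set (X + 'I_n -> M), Def set0 P /\
    forall x, T j x <-> P (join x m).
  move=> j; have := dm j; rewrite -[range m]set0U => /Def_unparam[P dP PE].
  by exists P.
have sn : small K [set: 'I_n] by exact: (small_countType Knat).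
have [s sP] := strict_sequence m sn.
have /choice[N NP] : forall j, exists N, forall f, ~ spread (k j) (P j) N f.
  move=> j; apply: contrapT => /forallNP h.
  apply: (resilience_bound (k := k j) Knat Msat Mhom Mres sn (PP j).1) => N.
  by have /existsNP[f /contrapT fs] := h N; exists f.
pose N0 := (\sum_j N j).+1.
apply: (cE S dS Sc); exists N0, s => a ainj [x xS].
have /choice[col colP] : forall l, exists j, act (s (a l)) (T j) x.
  by move=> l; have [j Tj] := ST _ (xS l); exists j.
have [j [e [einc ecol]]] := pigeonhole_increasing (col : 'I_(\sum_i N i).+1 -> _).
pose b l := if insub l is Some i then a (e i) else 0.
have bE l (lN : (l < N j)%N) : b l = a (e (Ordinal lN)) by rewrite /b insubT.
have einj := ord_increasing_inj einc.
apply: (NP j (fun l => s (b l) \o m)); split=> [t tN|]; last first.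
  exists x => t tN; have := colP (e (Ordinal tN)); rewrite ecol -bE.
  have -> : T j = [set x | P j (join x m)] by apply/seteqP; split=> y /(PP j).2.
  by rewrite (act_relation _ _ (PP j).1) //; exact: sub0set.
pose Q := (\max_l a l).+1.
have bQ l : (l < N j)%N -> (b l < Q)%N by move=> lN; rewrite bE ltnS leq_bigmax.
apply: (@kdiv_base _ _ _ _
  (A `|` rng (fun i => s i \o m) [set i | (i < Q)%N && (i != b t)])).
  move=> y [l /= /andP[lN lt] yl]; right; exists (b l) => //=.
  rewrite bQ //=; apply: contra lt => /eqP.
  by rewrite (bE l lN) (bE t tN) => /ainj/einj[->].
apply: (kdiv_strict sn (bQ t tN)) => //.
  apply: Def_relation (PP j).1 _; exact: subsetUr.
have <- : act (s (b t)) (T j) = [set x | P j (join x (s (b t) \o m))].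
  have -> : T j = [set x | P j (join x m)] by apply/seteqP; split=> y /(PP j).2.
  by rewrite (act_relation _ _ (PP j).1) //; exact: sub0set.
exact: kdiv_act.
Qed.

End ForkingIsDividing.

(** * Strict Morley sequences *)

Section Increasing.
Context (d : Order.disp_t) (I : orderType d).

Definition increasing n (k : 'I_n -> I) : Prop :=
  {homo k : i j / (i < j)%N >-> (i < j)%O}.

Lemma increasing_sort (s : seq I) : uniq s ->
  exists k : 'I_(size s) -> I,
    [/\ increasing k, forall l, k l \in s & forall x, x \in s -> exists l, k l = x].
Proof.
move=> us; pose s' := sort <=%O s.
have ss : size s' = size s by rewrite size_sort.
have lts : sorted <%O s'.
  by rewrite Order.POrderTheory.lt_sorted_uniq_le sort_uniq us Order.TotalTheory.sort_le_sorted.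
pose k (l : 'I_(size s)) := nth (tnth (in_tuple s) l) s' l.
have ls (l : 'I_(size s)) : (l < size s')%N by rewrite ss.
exists k; split=> [l l' ll|l|x].
- rewrite /k (set_nth_default (tnth (in_tuple s) l')) //.
  by apply: (sorted_ltn_nth Order.POrderTheory.lt_trans) => //; rewrite inE ls.
- by rewrite -(mem_sort <=%O); exact: mem_nth.
- rewrite -(mem_sort <=%O) => xs; have xi : (index x s' < size s)%N by rewrite -ss index_mem.
  by exists (Ordinal xi); rewrite /k /= nth_index.
Qed.

Lemma increasing_cover n (j : 'I_n -> I) : exists N (k : 'I_N -> I),
  [/\ increasing k, forall l, exists i, k l = j i & forall i, exists l, k l = j i].
Proof.
have [k [kinc ks sk]] := increasing_sort (undup_uniq (codom j)).
exists (size (undup (codom j))), k; split=> // [l|i].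
  by have := ks l; rewrite mem_undup => /codomP.
by apply: sk; rewrite mem_undup codom_f.
Qed.

(** An infinite linear order may have no infinite increasing sequence, so only finite increasing
    families are extracted. *)
Lemma increasing_in (g : nat -> I) N : injective g ->
  exists k : 'I_N -> I, increasing k /\ forall l, exists n, k l = g n.
Proof.
move=> ginj; have us : uniq (mkseq g N) by rewrite map_inj_uniq ?iota_uniq.
have := increasing_sort us; rewrite size_mkseq => -[k [kinc ks _]].
by exists k; split=> // l; have /mapP[n _ ->] := ks l; exists n.
Qed.

Definition ord_cat n m T (p : 'I_n -> T) (k : 'I_m -> T) (x : 'I_(n + m)) : T :=
  match fintype.split x with inl j => p j | inr l => k l end.

Lemma increasing_cat n m (p : 'I_n -> I) (k : 'I_m -> I) :
  increasing p -> increasing k -> (forall j l, (p j < k l)%O) -> increasing (ord_cat p k).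
Proof.
move=> pinc kinc pk x y; rewrite /ord_cat.
case: splitP => [j ->|j ->]; case: splitP => [l ->|l ->] h.
- exact: pinc.
- exact: pk.
- by have := leq_trans (leq_ltn_trans (leq_addr _ _) h) (ltnW (ltn_ord l)); rewrite ltnn.
- by apply: kinc; rewrite ltn_add2l in h.
Qed.

Lemma increasing1 (i : I) : increasing (fun=> i : I) (n := 1).
Proof. by move=> [[|x] //= xP] [[|y] //= yP]. Qed.

End Increasing.

Section Main.
Context (L : language) (K : Type) (M : structure L).
Hypothesis Knat : small K [set: nat].
Hypothesis Msat : saturated K M.
Hypothesis Mhom : strongly_homogeneous K M.
Hypothesis Mres : resilient M K.
Variable A : set M.
Hypothesis sA : small K A.
Hypothesis Abase : extension_base K A.
Implicit Types (B C D E : set M) (X Y Z : Type).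

Let valA : A -> M := @set_val _ A.

(** The tuple c itself realises q over A and b, so the last clause of strict non-forking is applied
    to c, with D the union of A and the range of b. *)
Lemma strict_nonforking_ndiv X Y (c : X -> M) (b : Y -> M) :
  small K [set: Y] -> strict_nonforking K A c b ->
  ndiv A c (A `|` range b) /\
  ndiv A (@set_val _ (A `|` range b)) (A `|` range c).
Proof.
move=> sY [q [[qo qfs qc] tpq qnf qst]]; split.
  move=> W [phi oW WE] Wc sW; apply: qnf; apply/(type_forksP Knat Mhom _ sA).
  exists 1, (fun=> phi); split.
    by move=> _; apply: tpq; split=> //; apply/WE.
  apply: sdiv_forks.
    by apply: Def_forall => _; apply: Def_mono (psat_Def oW); exact: subsetT.
  have [k kW] := sW; exists k; apply: kdiv_sub kW => x /(_ ord0) xphi.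
  exact/WE.
apply/(ndivP Knat Mhom _ _ sA); apply: qst => //.
  by apply: (small_setU Knat) => //; exact: small_range.
move=> phi qphi ophi; apply: contrapT => ncphi.
have qn : q (FNot phi) by apply: tpq; split=> // m [/ophi|[]].
have [|x xphi] := qfs 2 (fun i => if i == ord0 then phi else FNot phi).
  by move=> i; case: eqP.
by have := xphi (Ordinal (isT : 1 < 2)%N); apply; exact: xphi ord0.
Qed.

Section Sequence.
Context (d : Order.disp_t) (I : orderType d) (Y : Type) (a : I -> Y -> M).
Hypothesis sY : small K [set: Y].

Lemma indiscernible_Def n (S : set ('I_n * Y -> M)) (s t : 'I_n -> I) :
  indiscernible A a -> Def A S -> increasing s -> increasing t ->
  S (fun z => a (s z.1) z.2) -> S (fun z => a (t z.1) z.2).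
Proof. by move=> ind dS sinc tinc; exact: (tpP _ _ _).1 (ind n s t sinc tinc) S dS. Qed.

Lemma indiscernible_tp i j : indiscernible A a -> tp (a i) A = tp (a j) A.
Proof.
move=> ind; apply/tpP => S dS.
have dS' := Def_reindex (fun y : Y => (ord0 : 'I_1, y)) dS.
exact: (indiscernible_Def ind dS' (@increasing1 _ I i) (@increasing1 _ I j)).
Qed.

Lemma before_sub i (k : nat -> I) n : (forall j, (j < n)%N -> (k j < i)%O) ->
  rng (a \o k) [set j | (j < n)%N] `<=` range (@before L M d I Y a i).
Proof.
move=> ki m [j /= jn [y _ <-]].
by exists (@elt _ [set j : I | (j < i)%O] (k j) (ki j jn), y).
Qed.

Lemma small_before i : small K [set: I] -> small K [set: [set j : I | (j < i)%O] * Y].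
Proof.
move=> sI; apply: (small_prod Knat) => //.
exact: ((small_set_type _ _).1 (small_sub (@subsetT _ _) sI)).
Qed.

(** If the instances over S were consistent, any N terms indexed in S, in increasing order, would
    form a spread by [kdiv_strict]. *)
Lemma strict_Morley_witness : small K [set: I] -> infinite_set [set: I] ->
  strict_Morley K A a -> witness A a.
Proof.
move=> sI Iinf [ind ast]; split=> //; first by move=> i j; exact: indiscernible_tp.
move=> X phi i e etp /(dividesP Knat Mhom)[//||k kphi S Snat [c cS]].
  exact: (small_sum Knat sY ((small_set_type _ _).1 sA)).
have sYA := small_sum Knat sY ((small_set_type _ _).1 sA).
pose R := [set w : X + (Y + A) -> M | sat w phi].
have dR : Def set0 R by exact: Def_formula.
apply: (resilience_bound (k := k) Knat Msat Mhom Mres sYA dR) => N.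
have [g [ginj gS]] : exists g : nat -> I, injective g /\ forall n, S (g n).
  by apply/card_le_setTP; move: Snat; rewrite card_eq_le => /andP[].
have [kk [kinc kg]] := increasing_in N ginj.
have [i0] : inhabited I by constructor.
pose k' n := if insub n is Some l then kk l else i0.
have k'E n (nN : (n < N)%N) : k' n = kk (Ordinal nN) by rewrite /k' insubT.
have k'inc l n : (l < n)%N -> (n < N)%N -> (k' l < k' n)%O.
  by move=> ln nN; rewrite (k'E n nN) (k'E l (ltn_trans ln nN)); exact: kinc.
(* The enumeration of A is appended to each term, as spreads concern formulas without parameters. *)
exists (fun n => join (a (k' n)) valA); split; last first.
  exists c => t tN; apply: cS; rewrite (k'E t tN).
  by have [n ->] := kg (Ordinal tN).
move=> t tN.
apply: (@kdiv_base _ _ _ _ (A `|` rng (a \o k') [set i | (i < N)%N && (i != t)])).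
  move=> m [l lt [[y|x] _ <-]]; last by left; exact: set_valP.
  by right; exists l => //; exists y.
apply: (kdiv_strict Knat Msat Mhom sA sY tN).
- move=> t' t'N; have := strict_nonforking_ndiv (small_before (i := k' t') sI) (ast (k' t')).
  have sub : A `|` rng (a \o k') [set i | (i < t')%N] `<=` A `|` range (@before L M d I Y a (k' t')).
    by apply: setUS; apply: before_sub => j jt; exact: k'inc.
  move=> [h1 h2]; split; first exact: ndiv_mono h1.
  apply: ndiv_set h2 => _ [x _ <-]; apply: sub; exact: set_valP.
- apply: Def_relation => // _ [[y|x] _ <-]; [by right; exists y|by left; exact: set_valP].
have [s sE] : exists s : aut A, s \o e = a (k' t).
  apply: (homogeneity Knat Mhom) => //; apply/tpP.
  by rewrite etp; exact: indiscernible_tp.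
have := kdiv_act s kphi; rewrite (act_relation _ _ dR); last exact: sub0set.
rewrite (_ : s \o _ = join (a (k' t)) valA) //.
apply: funext => -[y|x] /=; first by rewrite -sE.
by apply: (af_fix s); exact: set_valP.
Qed.

(** The finite form of the witness property: indiscernibility carries consistency to all increasing
    tuples of the same length, and compactness to a countable set of terms. *)
Lemma witness_bound Z (P : set (Y + Z -> M)) i : indiscernible A a -> witness A a ->
  Def A P -> sdiv A [set z | P (join (a i) z)] ->
  exists N, forall k : 'I_N -> I, increasing k ->
    ~ exists z, forall l, P (join (a (k l)) z).
Proof.
move=> ind [Iinf atp awit] dP sP; apply: contrapT => /forallNP nN.
have all N (k : 'I_N -> I) : increasing k -> exists z, forall l, P (join (a (k l)) z).
  move=> kinc; have /existsNP[k0 /not_implyP[k0inc /contrapT kz]] := nN N.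
  pose S := [set v : 'I_N * Y -> M | exists z, forall l, P (join (fun y => v (l, y)) z)].
  have dS : Def A S.
    pose g l (z : Y + Z) : Z + 'I_N * Y := match z with inl y => inr (l, y) | inr z => inl z end.
    apply: Def_iff (Def_existsX (Def_forall (fun l => Def_reindex (g l) dP))) => v.
    split=> -[z zP]; exists z => l; have := zP l; congr P; by apply: funext => -[].
  exact: (indiscernible_Def ind dS k0inc kinc kz).
have [g [ginj _]] : exists g : nat -> I, injective g /\ forall n, [set: I] (g n).
  by apply/card_le_setTP; exact/infiniteP.
pose sw (z : Y + Z) : Z + Y := match z with inl y => inr y | inr z => inl z end.
have swE (y : Y -> M) (z : Z -> M) : join z y \o sw = join y z by apply: funext => -[].
have [n [r [h hE]]] := finite_variables (Def_reindex sw dP).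
have sg : small K (A `|` rng (a \o g) setT).
  by apply: (small_setU Knat) => //; exact: small_rng.
have sn : small K [set: 'I_n] by exact: (small_countType Knat).
have [z zF] : exists z : 'I_n -> M, forall W, [set W | exists l,
    W = [set z : 'I_n -> M | P (join (a (g l)) (z \o r))]] W -> W z.
  apply: (realize Knat Msat sn sg).
    move=> W [l ->].
    pose g' (z : Y + Z) : 'I_n + Y := match z with inl y => inr y | inr z => inl (r z) end.
    have gE x : join x (a (g l)) \o g' = join (a (g l)) (x \o r) by apply: funext => -[].
    have := Def_param (a (g l)) (Def_reindex g' dP).
    rewrite (_ : [set x | _] = [set z : 'I_n -> M | P (join (a (g l)) (z \o r))]); last first.
      by apply/seteqP; split=> x /=; rewrite gE.
    by apply: Def_mono; apply: setUS => m lm; exists l.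
  move=> m W /choice[l WE].
  have [N [k [kinc _ kl]]] := increasing_cover (g \o l).
  have [z zP] := all N k kinc; exists (h z) => j; rewrite WE /=.
  have [j' kj] := kl j; have := zP j'; rewrite kj -swE => /hE.
  by rewrite /= swE.
have dP' : Def (set0 `|` range valA) P.
  by apply: Def_mono dP => x Ax; right; exists (elt Ax).
have [P' dP0 P'E] := Def_unparam dP'.
pose g' (z : Y + Z + A) : Z + (Y + A) := match z with
  | inl (inl y) => inr (inl y) | inl (inr z) => inl z | inr x => inr (inr x) end.
have [phi phiE] := Def0_sat (Def_reindex g' dP0).
have satE j z' : sat (join z' (join (a j) valA)) phi <-> P (join (a j) z').
  rewrite -phiE P'E /= (_ : _ \o g' = join (join (a j) z') valA) //.
  by apply: funext => -[[y|x]|x].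
apply: (awit Z phi i (a i) erefl _ (range g)).
- apply/(dividesP Knat Mhom) => //.
    exact: (small_sum Knat sY ((small_set_type _ _).1 sA)).
  have [k kP] := sP; exists k; apply: kdiv_sub kP => z' /satE; exact.
- by apply: inj_card_eq => x y _ _ /ginj.
- exists (z \o r) => _ [l _ <-]; apply/satE.
  by apply: (zF [set z : 'I_n -> M | P (join (a (g l)) (z \o r))]); exists l.
Qed.

End Sequence.
End Main.

(** * A criterion for strict non-forking and its two applications *)

Section Strict.
Context (L : language) (K : Type) (M : structure L).
Hypothesis Knat : small K [set: nat].
Hypothesis Msat : saturated K M.
Hypothesis Mhom : strongly_homogeneous K M.
Hypothesis Mres : resilient M K.
Variable A : set M.
Hypothesis sA : small K A.
Hypothesis Abase : extension_base K A.
Implicit Types (B C D E : set M) (X Y Z : Type).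

Section Criterion.
Context (Y : Type) (c : Y -> M) (Z : Type) (b : Z -> M).
Hypothesis sY : small K [set: Y].
Hypothesis sZ : small K [set: Z].

(* The negation of the last clause of strict non-forking, as a condition on   *)
(* the left-hand tuple y instead of on the enumeration delta of D.            *)
Let bad : set (set (Y -> M)) := [set W | exists (V : Type) (delta : V -> M)
  (P : set (Y + V -> M)), [/\ Def A P, sdiv A [set z | P (join c z)] &
   W = [set y | P (join y delta)]]].

(** An ultrafilter containing the family yields the global type q. A failure of the last clause at
    c', a conjugate of c over A, would put c' into a bad set, whose complement lies in q. *)
Lemma strict_nonforking_fip :
  fip [set W : set (Y -> M) | (Def (A `|` range b) W /\ W c) \/
    exists2 T, (Def setT T /\ sdiv A T) \/ bad T & W = ~` T] ->
  strict_nonforking K A c b.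
Proof.
set F := (X in fip X) => /fip_ultra[q [qU Fq]].
pose p : set (formula L (Y + M)) := [set phi | q [set y | psat y phi]].
exists p; split.
- split; first by move=> phi _ m _.
    move=> n psi ppsi; have : q [set y | forall i, psat y (psi i)] by exact: filter_ord.
    by move=> /filter_ex[y ?]; exists y.
  by move=> phi _; have [|] := in_ultra_setVsetC [set y | psat y phi] qU; [left|right].
- by move=> phi [ophi cphi]; apply: Fq; left; split=> //; exact: psat_Def.
- move=> /(type_forksP Knat Mhom _ sA)[n [psi [ppsi [r [T [dT sT ST]]]]]].
  have q1 : q [set y | forall i, psat y (psi i)] by exact: filter_ord.
  have q2 : q [set y | forall j, (~` T j) y].
    by apply: filter_ord => j; apply: Fq; right; exists (T j) => //; left.
  have [y [yS yT]] := filter_ex (filterI q1 q2).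
  by have [j Tj] := ST y yS; exact: yT j Tj.
move=> D sD bD c' c'p.
apply/(ndivP Knat Mhom _ _ sA) => W dW Wd [k kW].
have c'E W' : Def D W' -> q W' -> W' c'.
  move=> [phi ophi WE] qW'; apply/WE/c'p => //.
  by rewrite /p /= (_ : [set y | _] = W') //; apply/seteqP; split=> y /WE.
have [t tE] : exists t : aut A, t \o c = c'.
  apply: (homogeneity Knat Mhom) => // S dS Sc; apply: c'E.
    by apply: Def_mono dS => x Ax; apply: bD; left.
  by apply: Fq; left; split=> //; apply: Def_mono dS; exact: subsetUl.
have [P dP PE] := Def_unparam dW.
pose sw (z : D + Y) : Y + D := match z with inl y => inr y | inr z => inl z end.
have swE (y : Y -> M) (z : D -> M) : join y z \o sw = join z y by apply: funext => -[].
pose delta : D -> M := @set_val _ D.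
pose T := [set y : Y -> M | P (join delta y)].
have dT : Def D T.
  have := Def_param delta (Def_reindex sw dP).
  rewrite (_ : [set x | _] = T); last by apply/seteqP; split=> y /=; rewrite swE.
  apply: Def_mono => m [Am|[x _ <-]]; last exact: set_valP.
  by apply: bD; left.
suff nT : (~` T) c' by exact: (nT ((PE _).1 Wd)).
apply: c'E; first exact: Def_compl.
apply: Fq; right; exists T => //; right.
exists D, delta, [set w : Y + D -> M | P (w \o sw)]; split; first exact: Def_reindex.
  exists k; apply: (kdiv_second (t := t) (Def_reindex sw dP)).
  by apply: kdiv_sub kW => z; rewrite /= swE tE => /PE.
by apply/seteqP; split=> y /=; rewrite swE.
Qed.

Context (d : Order.disp_t) (I : orderType d) (a : I -> Y -> M) (i : I).
Hypothesis ca : c = a i.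
Hypothesis ind : indiscernible A a.
Hypothesis awit : witness A a.

(* A long piece of the sequence that has, up to an automorphism, the type of  *)
(* a_i over b and does not divide over its base, moves off all sets dividing  *)
(* over A; the witness property bounds the number of its members in each bad  *)
(* set.                                                                       *)
Lemma strict_nonforking_of_witness :
  (forall W N, Def (A `|` range b) W -> W c ->
     exists (s : aut A) E (k : 'I_N -> I), increasing k /\
     [/\ small K E, A `<=` E, Def E (act s W),
         ndiv A (fun z : 'I_N * Y => a (k z.1) z.2) E
       & forall l, act s W (a (k l))]) ->
  strict_nonforking K A c b.
Proof.
move=> H; apply: strict_nonforking_fip => n W WF; apply: contrapT => nc.
have badN Q : bad Q -> exists N, forall (t : aut A) (k : 'I_N -> I), increasing k ->
    ~ forall l, Q (t \o a (k l)).
  move=> [V [delta [P [dP sP ->]]]].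
  rewrite ca in sP; have [N NP] := witness_bound Knat Msat Mhom sA sY ind awit dP sP.
  exists N => t k kinc h; apply: (NP k kinc); exists (ag t \o delta) => l.
  apply/(Def_aut t _ dP); congr P: (h l).
  by apply: funext => -[y|v] //=; rewrite agK.
have /choice[S /choice[T /choice[Q SP]]] : forall j, exists S T Q : set (Y -> M),
    [/\ Def (A `|` range b) S /\ S c, Def setT T /\ sdiv A T,
      exists N, forall (t : aut A) (k : 'I_N -> I), increasing k ->
        ~ forall l, Q (t \o a (k l)) &
      forall y, S y -> ~ T y -> ~ Q y -> W j y].
  have b0 : exists N, forall (t : aut A) (k : 'I_N -> I), increasing k ->
      ~ forall l, (@set0 (Y -> M)) (t \o a (k l)).
    by exists 1 => t k _ /(_ ord0).
  move=> j; have [[dW Wc]|[T [[dT sT]|bT] ->]] := WF j.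
  - by exists (W j), set0, set0; split=> //; split; [exact: Def0|exact: (sdiv0 A)].
  - by exists setT, T, set0; split=> //; split=> //; exact: Def_setT.
  - exists setT, set0, T; split=> //; last exact: badN.
      by split=> //; exact: Def_setT.
    by split; [exact: Def0|exact: (sdiv0 A)].
have /choice[N NP] : forall j, exists N, forall (t : aut A) (k : 'I_N -> I),
    increasing k -> ~ forall l, Q j (t \o a (k l)).
  by move=> j; have [] := SP j.
pose N0 := (\sum_j N j).+1.
have [||s [E [k [kinc [sE AE dE kE sk]]]]] := H [set y | forall j, S j y] N0.
- by apply: Def_forall => j; have [[]] := SP j.
- by move=> j; have [[]] := SP j.
have [|m' [m [_ dm]]] := @Def_finite_family _ _ setT Y n (fun j => act s (T j)).
  move=> j; have [_ [dT _] _ _] := SP j.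
  by apply: Def_mono (Def_act s dT); exact: subsetT.
have sNY : small K [set: 'I_N0 * Y].
  by apply: (small_prod Knat) => //; exact: (small_countType Knat).
have sD : small K (E `|` range m).
  apply: (small_setU Knat) => //; apply: small_range; exact: (small_countType Knat).
(* Here forking equals dividing is used: the piece does not fork over A, so over E it can be moved
   off the translates of the T_j. Each of its members must then satisfy some Q_j. *)
have [u uD] := nonforking_extension Knat Msat Mhom sNY sD AE (@subsetUl _ _ _)
  (ndiv_nonforking Knat Msat Mhom Mres sA Abase kE).
pose t := aut_comp (aut_inv s) (aut_sub AE u).
have /choice[col colP] : forall l, exists j, Q j (t \o a (k l)).
  move=> l; apply: contrapT => /forallNP nQ; apply: nc; exists (t \o a (k l)) => j.
  have [_ [_ [k' kT]] _ hW] := SP j; apply: hW; last exact: nQ.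
    have : act s [set y | forall j, S j y] (u \o a (k l)) by apply/(Def_aut u _ dE).
    by move=> /(_ j).
  move=> Tt; apply: (uD [set v : 'I_N0 * Y -> M | act s (T j) (v \o (fun y => (l, y)))]).
  - by apply: Def_reindex; apply: Def_mono (dm j); exact: subsetUr.
  - exact: Tt.
  - by exists k'; apply: (kdiv_pullback (fun y => (l, y))); exact: kdiv_act.
have [j [e [einc ecol]]] := pigeonhole_increasing (col : 'I_(\sum_j N j).+1 -> _).
apply: (NP j t (k \o e)); first by move=> l l' /einc/kinc.
by move=> l; have := colP (e l); rewrite ecol.
Qed.

End Criterion.

(** Left transitivity of non-dividing: [kdiv_extend] adds the terms to the base until it contains
    the whole tuple, and [ndiv_intro] concludes. *)
Lemma ndiv_tuple Y N (f : nat -> Y -> M) E : small K [set: Y] -> small K E -> A `<=` E ->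
  (forall l, (l < N)%N -> ndiv A (f l) (E `|` rng f [set i | (i < l)%N])) ->
  ndiv A (fun z : 'I_N * Y => f z.1 z.2) E.
Proof.
move=> sY sE AE fi; apply: ndiv_intro => S k dS kS.
exists (A `|` rng f [set i | (i < N)%N]).
  by move=> _ [[l y] _ <-]; right; exists l; [exact: ltn_ord|exists y].
suff H l : (l <= N)%N -> kdiv k (A `|` rng f [set i | (i < l)%N]) S by exact: H.
elim: l => [_|l IH lN].
  by apply: kdiv_base kS => m [Am|[i /=]]; [exact: Am|rewrite ltn0].
have sD : small K (E `|` rng f [set i | (i < l)%N]).
  by apply: (small_setU Knat) => //; exact: small_rng.
have fl : ndiv (A `|` rng f [set i | (i < l)%N]) (f l) (E `|` rng f [set i | (i < l)%N]).
  by apply: ndiv_base (fi l lN); exact: subsetUl.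
have dS' : Def (E `|` rng f [set i | (i < l)%N]) S by apply: Def_mono dS; exact: subsetUl.
have AD : A `|` rng f [set i | (i < l)%N] `<=` E `|` rng f [set i | (i < l)%N].
  exact: setSU.
apply: kdiv_base (kdiv_extend Knat Msat Mhom sY sD AD fl dS' (IH (ltnW lN))).
move=> m [Am|[i /=]]; first by left; left.
rewrite ltnS leq_eqVlt => /orP[/eqP ->|il] im; first by right.
by left; right; exists i.
Qed.

Section Parts.
Context (d : Order.disp_t) (I : orderType d) (Y : Type) (a : I -> Y -> M).
Hypothesis sY : small K [set: Y].

Lemma indiscernible_aut n (s t : 'I_n -> I) : indiscernible A a ->
  increasing s -> increasing t ->
  exists u : aut A, u \o (fun z : 'I_n * Y => a (s z.1) z.2) = (fun z => a (t z.1) z.2).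
Proof.
move=> ind sinc tinc; apply: (homogeneity Knat Mhom) => //.
  by apply: (small_prod Knat) => //; exact: (small_countType Knat).
by move=> S dS; exact: (indiscernible_Def ind dS sinc tinc).
Qed.

Lemma indiscernible_pair n (P : set (Y + 'I_n * Y -> M)) (p p' : 'I_n -> I) i i' :
  indiscernible A a -> Def A P -> increasing p -> increasing p' ->
  (forall j, (p j < i)%O) -> (forall j, (p' j < i')%O) ->
  P (join (a i) (fun z => a (p z.1) z.2)) -> P (join (a i') (fun z => a (p' z.1) z.2)).
Proof.
move=> ind dP pinc pinc' pi pi' Pi.
pose g (z : Y + 'I_n * Y) : 'I_(n + 1) * Y :=
  match z with inl y => (rshift n ord0, y) | inr z => (lshift 1 z.1, z.2) end.
have gE q j : (fun z : 'I_(n + 1) * Y => a (ord_cat q (fun=> j) z.1) z.2) \o g =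
    join (a j) (fun z => a (q z.1) z.2).
  apply: funext => -[y|[l y]] /=; rewrite /ord_cat.
    by rewrite (unsplitK (inr _)).
  by rewrite (unsplitK (inl _)).
have := indiscernible_Def ind (Def_reindex g dP)
  (increasing_cat pinc (@increasing1 _ I i) (fun j _ => pi j))
  (increasing_cat pinc' (@increasing1 _ I i') (fun j _ => pi' j)).
by rewrite /= !gE; apply.
Qed.

(** W involves finitely many terms before a_i. Indiscernibility moves them below N further terms,
    which by non-forking and [ndiv_tuple] form a non-dividing tuple. *)
Lemma Morley_witness_strict : small K [set: I] ->
  Morley A a -> witness A a -> strict_Morley K A a.
Proof.
move=> sI [ind anf] awit; split=> // i.
have sb := small_before Knat sY (i := i) sI.
apply: (@strict_nonforking_of_witness _ _ _ _ sY d I a i erefl ind awit) => W N dW Wi.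
have [n0 [m0 [m0sub dm0]]] := Def_finite dW.
have [l [j [jm ji]]] : exists l (j : 'I_l -> I),
    (forall x, A (m0 x) \/ exists y z, m0 x = a (j z) y) /\ forall z, (j z < i)%O.
  have /choice[o oP] : forall x, exists o : option I, if o is Some z then
      (z < i)%O /\ exists y, m0 x = a z y else A (m0 x).
    move=> x; have [Ax|[[z y] _ zy]] := m0sub _ (imageT m0 x); first by exists None.
    by exists (Some (val z)); split; [exact: (set_valP z)|exists y].
  pose s := pmap o (enum 'I_n0).
  exists (size s), (tnth (in_tuple s)); split=> [x|z].
    have := oP x; case ox: (o x) => [z|]; last by left.
    move=> [_ [y my]]; right; exists y.
    have /tnthP[z' zE] : z \in in_tuple s.
      by rewrite /= mem_pmap; apply/mapP; exists x => //; rewrite mem_enum.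
    by exists z'; rewrite -zE.
  have : tnth (in_tuple s) z \in s by exact: mem_tnth.
  rewrite mem_pmap => /mapP[x _ ox]; have := oP x; rewrite -ox.
  by case.
have [n [p [pinc pj jp]]] := increasing_cover j.
have pi z : (p z < i)%O by have [z' ->] := pj z.
pose ap := fun z : 'I_n * Y => a (p z.1) z.2.
have [|P dP PE] := @Def_unparam _ M A Y _ ap W.
  apply: Def_mono dm0 => _ [x _ <-]; have [Ax|[y [z ->]]] := jm x; first by left.
  by have [z' pz] := jp z; right; exists (z', y) => //; rewrite /ap /= pz.
have [Iinf _ _] := awit.
have [g [ginj _]] : exists g : nat -> I, injective g /\ forall n, [set: I] (g n).
  by apply/card_le_setTP; exact/infiniteP.
(* There may be fewer than N indices above i, so n + N fresh indices are taken: n for the parameters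
   and N for the piece. *)
have [kk [kkinc _]] := increasing_in (n + N) ginj.
pose p' z := kk (lshift N z); pose k z := kk (rshift n z).
have pinc' : increasing p' by move=> x y xy; exact: kkinc.
have kinc : increasing k by move=> x y xy; apply: kkinc; rewrite /= ltn_add2l.
have pk x y : (p' x < k y)%O by apply: kkinc; exact: (ltn_addr _ (ltn_ord x)).
pose ap' := fun z : 'I_n * Y => a (p' z.1) z.2.
have [s sE] := indiscernible_aut ind pinc pinc'.
have sW : act s W = [set y | P (join y ap')].
  have -> : W = [set y | P (join y ap)] by apply/seteqP; split=> y /PE.
  by rewrite (act_relation _ _ dP) // sE.
have sE' : small K (A `|` range ap').
  apply: (small_setU Knat) => //; apply: small_range.
  by apply: (small_prod Knat) => //; exact: (small_countType Knat).
exists s, (A `|` range ap'), k; split=> //; split=> //.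
- by rewrite sW; exact: Def_param.
- pose k' x := if insub x is Some z then k z else i.
  have k'E x (xN : (x < N)%N) : k' x = k (Ordinal xN) by rewrite /k' insubT.
  have -> : (fun z : 'I_N * Y => a (k z.1) z.2) = (fun z => (a \o k') z.1 z.2).
    by apply: funext => -[x y] /=; rewrite k'E; congr (a (k _) _); exact: val_inj.
  apply: (ndiv_tuple (f := a \o k') sY sE' (@subsetUl _ _ _)).
  move=> x xN; apply: ndiv_mono (nonforking_ndiv Knat Mhom sA (anf (k' x))).
  move=> m [[Am|[[z y] _ <-]]|]; first by left.
    right; have pkx : (p' z < k' x)%O by rewrite k'E.
    by exists (@elt _ [set j | (j < k' x)%O] (p' z) pkx, y).
  move=> h; right; apply: (before_sub _ h) => z zx.
  by rewrite (k'E x xN) (k'E z (ltn_trans zx xN)); exact: kinc.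
- move=> z; rewrite sW /=.
  by apply: (indiscernible_pair ind dP pinc pinc' pi _ ((PE _).1 Wi)) => x; exact: pk.
Qed.

End Parts.

(** All pairs (a_l, a_N) with l < N have the type of (a_i, a_(i+1)), and strictness at N makes the
    tuple of the a_l non-dividing over A and a_N. *)
Lemma strict_Morley_next Y (a : nat -> Y -> M) : small K [set: Y] ->
  strict_Morley K A a -> forall i, strict_nonforking K A (a i) (a i.+1).
Proof.
move=> sY aM i; have [ind ast] := aM.
have awit := strict_Morley_witness Knat Msat Mhom Mres sA sY Knat infinite_nat aM.
apply: (@strict_nonforking_of_witness _ _ _ _ sY _ nat a i erefl ind awit) => W N dW Wi.
have [P dP PE] := Def_unparam dW.
pose pr (i0 i1 : nat) (x : 'I_2) := if x == ord0 then i0 else i1.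
have princ i0 i1 : (i0 < i1)%N -> increasing (pr i0 i1).
  by move=> ii [[|[|x]] // xP] [[|[|y]] // yP].
have [s sE] := indiscernible_aut sY ind (@increasing1 _ nat i.+1) (@increasing1 _ nat N).
have {}sE : s \o a i.+1 = a N by apply: funext => y; have := congr1 (@^~ (ord0, y)) sE.
have sW : act s W = [set y | P (join y (a N))].
  have -> : W = [set y | P (join y (a i.+1))] by apply/seteqP; split=> y /PE.
  by rewrite (act_relation _ _ dP) // sE.
exists s, (A `|` range (a N)), (fun l : 'I_N => val l); split=> //; split.
- by apply: (small_setU Knat) => //; exact: small_range.
- exact: subsetUl.
- by rewrite sW; exact: Def_param.
- have sb := small_before Knat sY (i := N) Knat.
  have [_] := strict_nonforking_ndiv Knat Mhom sA sb (ast N).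
  apply: ndiv_set => _ [[l y] _ <-]; right.
  by exists (@elt _ [set j | (j < N)%O] (val l) (ltn_ord l), y).
- move=> l; rewrite sW /=.
  pose g (z : Y + Y) : 'I_2 * Y := match z with inl y => (ord0, y) | inr y => (ord_max, y) end.
  have gE i0 i1 : (fun z : 'I_2 * Y => a (pr i0 i1 z.1) z.2) \o g = join (a i0) (a i1).
    by apply: funext => -[].
  have := indiscernible_Def ind (Def_reindex g dP) (princ _ _ (ltnSn i)) (princ _ _ (ltn_ord l)).
  by rewrite /= !gE; apply; exact/PE.
Qed.

End Strict.

Unset Implicit Arguments.

Theorem theorem7p4 (L : language) (T : set (sentence L)) (K : Type)
  (M : structure L) (A : set M)
  (Tcomplete : complete_theory T) (Mmonster : monster T K M)
  (Asmall : small K A)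
  (Tresilient : resilient M K) (Abase : extension_base K A) :
  (forall (d : Order.disp_t) (I : orderType d) (Y : Type) (a : I -> Y -> M),
     small K [set: I] -> small K [set: Y] -> infinite_set [set: I] ->
     strict_Morley K A a -> witness A a) /\
  (forall (d : Order.disp_t) (I : orderType d) (Y : Type) (a : I -> Y -> M),
     small K [set: I] -> small K [set: Y] ->
     Morley A a -> witness A a -> strict_Morley K A a) /\
  (forall (Y : Type) (a : nat -> Y -> M),
     small K [set: Y] -> strict_Morley K A a ->
     forall i : nat, strict_nonforking K A (a i) (a i.+1)).

Proof.
have [_ [Knat _ _] Msat Mhom] := Mmonster.
split; [|split].
- move=> d I Y a sI sY; exact: (strict_Morley_witness Knat Msat Mhom Tresilient Asmall sY sI).
- move=> d I Y a sI sY; exact: (Morley_witness_strict Knat Msat Mhom Tresilient Asmall Abase sY sI).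
- by move=> Y a sY aM; exact: (strict_Morley_next Knat Msat Mhom Tresilient Asmall Abase sY aM).
Qed.
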